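(* Let $\mathbb{E}$ be the Engel group equipped with a homogeneous distance $d$ and a graded left invariant Riemannian metric $g$. Let $\Sigma\subset\mathbb{E}$ be a $C^1$ smooth surface with $d(\Sigma)=3$. If $p\in\Sigma$ is a point of maximum degree, then $$\theta^3(\mu_\Sigma,p)=\beta_d(A_p\Sigma).$$
   Context: Engel group. $\mathbb{E}$ is the connected, simply connected Lie group whose Lie algebra $\mathrm{Lie}(\mathbb{E})=V_1\oplus V_2\oplus V_3$ has a basis $(X_1,X_2,X_3,X_4)$ with only nontrivial brackets $[X_1,X_2]=X_3$, $[X_1,X_3]=X_4$; $V_1=\mathrm{span}\{X_1,X_2\}$, $V_2=\mathrm{span}\{X_3\}$, $V_3=\mathrm{span}\{X_4\}$. Via the exponential map, $\mathbb{E}$ is identified with a graded vector space $H_1\oplus H_2\oplus H_3$ ($H_j$ corresponding to $V_j$) with product given by the Baker-Campbell-Hausdorff formula and unit element $0$. Dilations: $\delta_r v=r^jv$ for $v\in H_j$, $r>0$. A homogeneous distance $d$ is a continuous, left invariant distance with $d(\delta_rx,\delta_ry)=r\,d(x,y)$; $\mathbb{B}(x,r)$ is the closed ball. A graded basis $(Y_1,\dots,Y_4)$ of $\mathrm{Lie}(\mathbb{E})$ is a basis with $Y_1,Y_2\in V_1$, $Y_3\in V_2$, $Y_4\in V_3$; the degrees are $d_1=d_2=1$, $d_3=2$, $d_4=3$. A left invariant Riemannian metric $g$ is graded if some graded basis is orthonormal; one such $g$ is fixed, $|\cdot|_g$ also denotes its norm on $2$-vectors, and $|\cdot|$ is the norm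 of the scalar product induced by $g$ on $\mathbb{E}\cong T_0\mathbb{E}$. Degree. For a $2$-dimensional $C^1$ submanifold (surface) $\Sigma$ and $p\in\Sigma$, let $\tau_\Sigma(p)=t_1\wedge t_2$ with $(t_1,t_2)$ a basis of $T_p\Sigma$ and let $\xi_{p,\Sigma}=\sum_{i<j}c_{ij}Y_i\wedge Y_j$ be the left invariant $2$-vector field with $\xi_{p,\Sigma}(p)=\tau_\Sigma(p)$. Then $d_\Sigma(p)=\max\{d_i+d_j:c_{ij}\ne0\}$, $d(\Sigma)=\max_\Sigma d_\Sigma$, and $p$ has maximum degree if $d_\Sigma(p)=d(\Sigma)$. Put $\xi_{p,\Sigma,M}=\sum_{d_i+d_j=M}c_{ij}Y_i\wedge Y_j$. With $M=d_\Sigma(p)$, $\mathcal{A}_p\Sigma=\{X\in\mathrm{Lie}(\mathbb{E}):X\wedge\xi_{p,\Sigma,M}=0\}$ and the homogeneous tangent space is $A_p\Sigma=\exp(\mathcal{A}_p\Sigma)\subset\mathbb{E}$. Intrinsic measure. With $N=d(\Sigma)$, for any Riemannian metric $\tilde g$ choose $\tau_\Sigma$ (not necessarily continuous) with $|\tau_\Sigma|_{\tilde g}=1$ and put $\tau^{\tilde g}_{\Sigma,N}(p)=\xi_{p,\Sigma,N}(p)$; then $\mu_\Sigma=|\tau^{\tilde g}_{\Sigma,N}|_g\,\sigma_{\tilde g}$, with $\sigma_{\tilde g}$ the Riemannian surface measure on $\Sigma$ induced by $\tilde g$ (independent of $\tilde g$), regarded as a measure on $\mathbb{E}$ concentrated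 on $\Sigma$. Spherical Federer density. $\theta^a(\mu,p)=\inf_{\varepsilon>0}\sup\{2^a\mu(B)/\mathrm{diam}(B)^a:\ p\in B,\ B\text{ a closed ball of positive radius},\ \mathrm{diam}(B)<\varepsilon\}$. Spherical factor. For a $k$-dimensional linear subspace $V\subset\mathbb{E}$, $\beta_d(V)=\max_{d(u,0)\le1}\mathcal{H}^k_{|\cdot|}(\mathbb{B}(u,1)\cap V)$, with $\mathcal{H}^k_{|\cdot|}$ the standard Euclidean Hausdorff measure of $|\cdot|$. *)

(* Defs.v *)
From HB Require Import structures.
From mathcomp Require Import all_boot all_order all_algebra.
From mathcomp Require Import ring.
From mathcomp Require Import all_classical all_reals all_analysis.

Set Implicit Arguments.
Unset Strict Implicit.
Unset Printing Implicit Defensive.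

Import Order.TTheory GRing.Theory Num.Theory.
Import numFieldNormedType.Exports.

Local Open Scope classical_set_scope.
Local Open Scope ring_scope.

Section Engel.
Variable R : realType.

(* The row (x_1, x_2, x_3, x_4) is both x_1 X_1 + ... + x_4 X_4 in Lie(E) and,
   the exponential map being read as the identity, the point
   exp(x_1 X_1 + ... + x_4 X_4) of the group; the index i : 'I_4 stands for
   i + 1. *)
Definition engel := 'rV[R]_4.

(* Tangent vectors in T_p E are written in these linear coordinates of E. *)

Definition deg (i : 'I_4) : nat := nth 0%N [:: 1; 1; 2; 3]%N i.

Definition bracket (x y : engel) : engel :=
  \row_i nth 0 [:: 0; 0; x 0 (inord 0) * y 0 (inord 1) - x 0 (inord 1) * y 0 (inord 0);
                        x 0 (inord 0) * y 0 (inord 2) - x 0 (inord 2) * y 0 (inord 0)] i.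

(* The Baker-Campbell-Hausdorff series stops here: the group has step 3. *)
Definition emul (x y : engel) : engel :=
  x + y + 2^-1 *: bracket x y
  + 12^-1 *: (bracket x (bracket x y) + bracket y (bracket y x)).

(* For the BCH product, the inverse of p is - p. *)
Definition einv (p : engel) : engel := - p.

Definition dilation (r : R) (x : engel) : engel := \row_i (r ^+ deg i * x 0 i).

(* Matrix, acting on row vectors, of the differential at q of the left
   translation by p, from T_q E to T_{pq} E. *)
Definition dL (p q : engel) : 'M[R]_4 := 'J (emul p) q.

Definition homogeneous_distance (d : engel -> engel -> R) :=
  [/\ (forall x y, d x y = 0 <-> x = y),
      (forall x y, d x y = d y x),
      (forall x y z, d x z <= d x y + d y z),
      continuous (fun z : engel * engel => d z.1 z.2) &
      (forall p x y, d (emul p x) (emul p y) = d x y) /\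
      (forall r x y, 0 < r -> d (dilation r x) (dilation r y) = r * d x y)].

Definition cball (d : engel -> engel -> R) (x : engel) (r : R) : set engel :=
  [set y | d x y <= r].

(* Adding 0 to the set of distances only serves to give diam set0 = 0. *)
Definition diam (d : engel -> engel -> R) (S : set engel) : \bar R :=
  ereal_sup (0%E |` [set (d z.1 z.2)%:E | z in S `*` S]).

(* Row i of Y is the vector Y_i. *)
Definition graded_basis (Y : 'M[R]_4) :=
  Y \in unitmx /\ forall i j, deg i != deg j -> Y i j = 0.

Fixpoint Ck {V : normedModType R} (k : nat) (f : engel -> V) : Prop :=
  match k with
  | 0%N => continuous f
  | k'.+1 => forall v : engel,
      (forall x, derivable f x v) /\ Ck k' (fun x => 'D_v f x)
  end.

(* g p is the Gram matrix of the scalar product on T_p E. *)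
Definition riemannian_metric (g : engel -> 'M[R]_4) :=
  [/\ (forall p, (g p)^T = g p),
      (forall p (v : engel), v != 0 -> 0 < (v *m g p *m v^T) 0 0) &
      (forall k, Ck k g)].

Definition left_invariant (g : engel -> 'M[R]_4) :=
  forall p q, dL p q *m g (emul p q) *m (dL p q)^T = g q.

(* For a left invariant metric, a basis of left invariant fields is orthonormal
   everywhere as soon as it is orthonormal at 0. *)
Definition graded_metric (g : engel -> 'M[R]_4) :=
  [/\ riemannian_metric g, left_invariant g &
      exists2 Y, graded_basis Y & Y *m g 0 *m Y^T = 1%:M].

(* The norm on T_0 E, identified with E. *)
Definition metric_norm (g : engel -> 'M[R]_4) (v : engel) : R :=
  Num.sqrt ((v *m g 0 *m v^T) 0 0).

(* 2-vectors are encoded as skew-symmetric matrices: the entries xi i j, i < j,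
   are the coordinates of xi on the basis of the e_i /\ e_j. *)
Definition wedge (v w : engel) : 'M[R]_4 := v^T *m w - w^T *m v.

(* The map induced on 2-vectors by v |-> v *m A. *)
Definition push2 (A xi : 'M[R]_4) : 'M[R]_4 := A^T *m xi *m A.

(* The norm of the scalar product given by
   <v1 /\ v2, w1 /\ w2> = det (<vi, wj>), for the Gram matrix G. *)
Definition norm2 (G xi : 'M[R]_4) : R :=
  Num.sqrt (\sum_(i < 4) \sum_(j < 4 | (i < j)%N)
            \sum_(k < 4) \sum_(l < 4 | (k < l)%N)
              xi i j * xi k l * (G i k * G j l - G i l * G j k)).

(* For i < j, the coefficient c_ij of xi on Y_i /\ Y_j; see coef2E. *)
Definition coef2 (Y xi : 'M[R]_4) : 'M[R]_4 :=
  (invmx Y)^T *m xi *m invmx Y.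

Definition degree2 (Y xi : 'M[R]_4) : nat :=
  \max_(i < 4) \max_(j < 4 | (i < j)%N && (coef2 Y xi i j != 0%R)) (deg i + deg j).

Definition part2 (Y : 'M[R]_4) (M : nat) (xi : 'M[R]_4) : 'M[R]_4 :=
  \sum_(i < 4) \sum_(j < 4 | (i < j)%N && (deg i + deg j == M)%N)
    coef2 Y xi i j *: wedge (row i Y) (row j Y).

Lemma coef2E (Y xi : 'M[R]_4) : Y \in unitmx -> xi^T = - xi ->
  xi = \sum_(i < 4) \sum_(j < 4 | (i < j)%N)
         coef2 Y xi i j *: wedge (row i Y) (row j Y).
Proof.
move=> uY skew.
have skewc : (coef2 Y xi)^T = - coef2 Y xi.
  by rewrite /coef2 !trmx_mul trmxK skew mulNmx mulmxN mulmxA.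
have cN i j : coef2 Y xi j i = - coef2 Y xi i j.
  by have /matrixP/(_ i j) := skewc; rewrite !mxE.
have {1}-> : xi = Y^T *m coef2 Y xi *m Y.
  rewrite /coef2 !mulmxA -trmx_mul mulVmx // trmx1 mul1mx.
  by rewrite -mulmxA mulVmx // mulmx1.
move: (coef2 Y xi) cN => c cN; apply/matrixP => a b.
have c0 i : c i i = 0.
  have /eqP := cN i i; rewrite -subr_eq0 opprK -mulr2n -mulr_natr.
  by rewrite mulf_eq0 pnatr_eq0 orbF => /eqP.
rewrite !mxE; under eq_bigr => j _ do rewrite !mxE big_distrl /=.
rewrite exchange_big /= summxE.
have splitsum i (F : 'I_4 -> R) : \sum_(j < 4) F j =
    F i + \sum_(j < 4 | (i < j)%N) F j + \sum_(j < 4 | (j < i)%N) F j.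
  rewrite (bigD1 i) //= -addrA; congr (_ + _).
  rewrite (bigID (fun j : 'I_4 => (i < j)%N)) /=; congr (_ + _);
    apply: eq_bigl => j; rewrite -val_eqE neq_ltn; by case: ltngtP.
under eq_bigr => i _ do rewrite (splitsum i).
rewrite 2!big_split /= big1 ?add0r; last first.
  by move=> i _; rewrite !mxE c0 mulr0 mul0r.
rewrite [X in _ + X](exchange_big_dep predT) //= -big_split /=.
apply: eq_bigr => i _; rewrite summxE -big_split /=; apply: eq_bigr => j _.
rewrite !mxE !big_ord_recl !big_ord0 !mxE (cN i j) /=.
by rewrite !addr0 mulrBr mulrN mulNr !mulrA ![Y _ _ * c _ _]mulrC [c i j * Y j a * _]mulrAC.
Qed.

(* X /\ xi, through its (alternating) coordinates on the basis of 3-vectors. *)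
Definition wedge3 (xi : 'M[R]_4) (X : engel) : {ffun 'I_4 * 'I_4 * 'I_4 -> R^o} :=
  [ffun t => X 0 t.1.1 * xi t.1.2 t.2 + X 0 t.1.2 * xi t.2 t.1.1
             + X 0 t.2 * xi t.1.1 t.1.2].

Fact wedge3_is_linear xi : linear (wedge3 xi).
Proof.
move=> a X Z; apply/ffunP => t; rewrite !ffunE !mxE.
by rewrite /GRing.scale /=; ring.
Qed.

HB.instance Definition _ xi :=
  GRing.isLinear.Build R engel {ffun 'I_4 * 'I_4 * 'I_4 -> R^o} _
    (wedge3 xi) (wedge3_is_linear xi).

Definition annihilator (xi : 'M[R]_4) : {vspace engel} :=
  lker (linfun (wedge3 xi)).

Definition surface_chart (Sigma : set engel) (U : set (R * R))
    (phi : R * R -> engel) :=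
  [/\ open U,
      (forall z, U z -> differentiable phi z),
      (forall w z, U z -> {for z, continuous (fun z => 'd phi z w)}),
      (forall z, U z -> injective ('d phi z)) &
      [/\ set_inj U phi, phi @` U `<=` Sigma &
          (* phi is open onto Sigma: it is a homeomorphism from U onto a
             relatively open subset of Sigma *)
          forall V, open V -> V `<=` U ->
            exists2 W, open W & phi @` V = Sigma `&` W]].

Definition C1_surface (Sigma : set engel) :=
  forall p, Sigma p ->
    exists U phi, surface_chart Sigma U phi /\ (phi @` U) p.

Definition tangent (Sigma : set engel) (p : engel) : set engel :=
  [set v | exists U phi z w,
    [/\ surface_chart Sigma U phi, U z, phi z = p & v = 'd phi z w]].

(* The tangent 2-vectors t_1 /\ t_2; T_p Sigma has dimension 2, so that two
   independent vectors in it form a basis. *)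
Definition tangent2s (Sigma : set engel) (p : engel) : set 'M[R]_4 :=
  [set wedge t.1 t.2 | t in [set t : engel * engel |
    [/\ tangent Sigma p t.1, tangent Sigma p t.2 & free [:: t.1; t.2]]]].

(* An arbitrary choice of tau_Sigma. *)
Definition tau (Sigma : set engel) (p : engel) : 'M[R]_4 :=
  get (tangent2s Sigma p).

Definition unit_tau (gt : engel -> 'M[R]_4) (Sigma : set engel) (p : engel) :=
  (norm2 (gt p) (tau Sigma p))^-1 *: tau Sigma p.

(* A left invariant 2-vector field is encoded by its value at 0. *)
Definition left_field2 (xi : 'M[R]_4) (p : engel) : 'M[R]_4 := push2 (dL p 0) xi.

(* The left invariant 2-vector field with value t at p. *)
Definition left_trivialize (p : engel) (t : 'M[R]_4) : 'M[R]_4 :=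
  push2 (dL (einv p) p) t.

Definition xi_ (Sigma : set engel) (p : engel) := left_trivialize p (tau Sigma p).

Definition point_degree (Y : 'M[R]_4) (Sigma : set engel) (p : engel) : nat :=
  degree2 Y (xi_ Sigma p).

(* N = max_Sigma d_Sigma *)
Definition surface_degree (Y : 'M[R]_4) (Sigma : set engel) (N : nat) :=
  (exists2 p, Sigma p & point_degree Y Sigma p = N) /\
  (forall p, Sigma p -> (point_degree Y Sigma p <= N)%N).

(* As exp is the identity in our coordinates, this is both the subspace of
   Lie(E) and its image in the group. *)
Definition homogeneous_tangent (Y : 'M[R]_4) (Sigma : set engel) (p : engel) :
    {vspace engel} :=
  annihilator (part2 Y (point_degree Y Sigma p) (xi_ Sigma p)).

Definition borelE := g_sigma_algebraType (@open engel).

Definition area_element (gt : engel -> 'M[R]_4) (phi : R * R -> engel)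
    (z : R * R) : R :=
  norm2 (gt (phi z)) (wedge ('d phi z (1, 0)) ('d phi z (0, 1))).

(* The Riemannian surface measure of gt is the unique Borel measure which is
   concentrated on Sigma and is given by the area element in every chart. *)
Definition riemannian_surface_measure (gt : engel -> 'M[R]_4)
    (Sigma : set engel) (sigma : {measure set borelE -> \bar R}) :=
  sigma (~` Sigma) = 0%E /\
  forall U phi, surface_chart Sigma U phi ->
  forall B : set borelE, measurable B ->
    sigma (B `&` phi @` U) =
    (\int[lebesgue_measure \x lebesgue_measure]_(z in U `&` phi @^-1` B) (area_element gt phi z)%:E)%E.

(* tau^gt_{Sigma,N}(p) *)
Definition tau_part (Y : 'M[R]_4) (gt : engel -> 'M[R]_4) (Sigma : set engel)
    (N : nat) (p : engel) : 'M[R]_4 :=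
  left_field2 (part2 Y N (left_trivialize p (unit_tau gt Sigma p))) p.

(* mu_Sigma, where N = d(Sigma) and sigma is the surface measure of gt. *)
Definition intrinsic_measure (Y : 'M[R]_4) (g gt : engel -> 'M[R]_4)
    (sigma : {measure set borelE -> \bar R}) (Sigma : set engel) (N : nat)
    (B : set engel) : \bar R :=
  (\int[sigma]_(p in B `&` Sigma) (norm2 (g p) (tau_part Y gt Sigma N p))%:E)%E.

Definition federer_density (d : engel -> engel -> R) (a : nat)
    (mu : set engel -> \bar R) (p : engel) : \bar R :=
  ereal_inf [set ereal_sup
    [set ((2 ^+ a / fine (diam d B) ^+ a)%:E * mu B)%E | B in
      [set B | B p /\ (exists x r, 0 < r /\ B = cball d x r) /\
               (diam d B < eps%:E)%E]] | eps in [set eps : R | 0 < eps]].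

(* The volume of the Euclidean unit ball of dimension k. *)
Fixpoint unit_ball_volume (k : nat) : R :=
  match k with
  | 0%N => 1
  | 1%N => 2
  | k'.+2 => 2 * pi / k%:R * unit_ball_volume k'
  end.

Definition hausdorff_size (d : engel -> engel -> R) (k : nat) (S : set engel) :
    \bar R :=
  if S == set0 then 0%E
  else ((unit_ball_volume k / 2 ^+ k)%:E * diam d S ^+ k)%E.

Definition hausdorff_measure (d : engel -> engel -> R) (k : nat)
    (S : set engel) : \bar R :=
  ereal_sup [set ereal_inf [set (\sum_(0 <= n <oo) hausdorff_size d k (F n))%E |
      F in [set F : nat -> set engel | S `<=` \bigcup_n F n /\
                                      forall n, (diam d (F n) <= delta%:E)%E]]
    | delta in [set delta : R | 0 < delta]].

Definition spherical_factor (d : engel -> engel -> R) (g : engel -> 'M[R]_4)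
    (V : {vspace engel}) : \bar R :=
  ereal_sup [set hausdorff_measure (fun x y => metric_norm g (x - y)) (\dim V)
                   (cball d u 1 `&` [set x | x \in V])
            | u in [set u | d u 0 <= 1]].

End Engel.

(* Main.v *)
Require Import Defs.
From HB Require Import structures.
From mathcomp Require Import all_boot all_order all_algebra.
From mathcomp Require Import ring lra zify.
From mathcomp Require Import all_classical all_reals all_analysis.
From mathcomp Require Import measurable_realfun.

Set Implicit Arguments.
Unset Strict Implicit.
Unset Printing Implicit Defensive.

Import Order.TTheory GRing.Theory Num.Theory.
Import numFieldNormedType.Exports.

Local Open Scope classical_set_scope.
Local Open Scope ring_scope.

(** Read from p, the surface is, at small scale, the plane of X_2 and X_3 with the
    Euclidean area of g; the theorem compares the two sides on that plane.

    _The surface at p_. Use coordinates (a, b, c, w) of the second kind at p, for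
    which the left invariant coframe is da, db, dc + b da, dw - a dc. Every
    2-vector X_i /\ X_4 has degree at least 4, so degree at most 3 on the whole
    surface means that dw = a dc there (contact, dS3). The form a dc is not closed,
    so a and c cannot be parameters of the surface at p (no_x_dy, wdet02). As p has
    degree 3, b and c are parameters (wdet12). Then w is a function of c with
    derivative a, so a = O(c) and w = O(c^2), and the degree-3 part of the tangent
    2-vector is j X_2 /\ X_3 with j continuous and j = 1 at p (adapted_chart). In
    particular the homogeneous tangent space is the plane of X_2 and X_3
    (homogeneous_tangentE).

    _The measure of a ball_. Let B be a ball of radius r that contains p. On B one
    has b = O(r) and c = O(r^2), so a = O(r^2) and w = O(r^4) are negligible before
    the sizes r and r^3 that the distance allows them: the point of the surface
    with parameters (b, c) is at distance o(r) from the point of the plane with the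
    same parameters (close_to_plane). Moreover the intrinsic measure is
    alpha * beta * db dc up to a factor that tends to 1 at p, where alpha and beta
    are the lengths of X_2 and X_3 (local_measure). So the measure of B is, up to
    such factors, alpha * beta times the area of the slice of B by the plane, after
    translating p to 0 (blow_up_upper, blow_up_lower). Write the translate of B as
    the dilation by r of the unit ball centred at u, with d(u, 0) <= 1. The slice
    has r^3 times the area of the slice of that unit ball (leb2_trace_dilation),
    and B has diameter 2 r (diam_cball), so 2^3 mu(B) / diam(B)^3 tends to
    alpha * beta times the area of the unit slice, uniformly in u. The Federer
    density is therefore alpha * beta * trace_sup.

    _The spherical factor_. It remains to see that the Hausdorff measure of a slice
    is alpha * beta times its area (spherical_factorE), that is, that the
    2-dimensional Hausdorff measure of the Euclidean plane is the Lebesgue measure.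
    The lower bound is the isodiametric inequality, proved by two Steiner
    symmetrizations (isodiametric). The upper bound follows from covers of an open
    set by small discs whose total area exceeds that of the set by as little as
    desired (disc_cover_open). *)

(** * Lebesgue measure in the plane *)

Section PlanarLebesgue.
Variable R : realType.
Local Notation mR := (measurableTypeR R).
Local Notation lam := (@lebesgue_measure R).
Local Notation leb2 := (@lebesgue_measure R \x @lebesgue_measure R)%E.

Definition affine1 (s t : R) (x : mR) : mR := (s * x + t : R).

Lemma measurable_affine1 s t : measurable_fun setT (affine1 s t).
Proof.
apply: measurable_funD => //.
Qed.

(** The pushforward of the measure by an affine map, rescaled, agrees with the
    Lebesgue measure on half-open intervals, which characterizes the latter. *)
Lemma lebesgue_measure_affine (s t : R) (A : set mR) : 0 < s -> measurable A ->
  lam (affine1 s t @^-1` A) = (s^-1%:E * lam A)%E.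
Proof.
move=> s0 mA.
have s0' : 0 <= s by exact: ltW.
have mf := measurable_affine1 s t.
pose m := mscale (NngNum s0') (pushforward lam (affine1 s t)).
have mE B : m mf B = (s%:E * lam (affine1 s t @^-1` B))%E by [].
have : lam A = m mf A.
  apply: (@lebesgue_measure_unique R (m mf)) => // X [[a b] /= ab <-].
  change (lam `]a, b]%classic = s%:E * lam (affine1 s t @^-1` `]a, b]%classic))%E.
  have -> : affine1 s t @^-1` `]a, b] = `](a - t) / s, (b - t) / s]%classic.
    apply/seteqP; split => x /=; rewrite /affine1 !in_itv /= ltr_pdivrMr// ler_pdivlMr//.
      by rewrite ltrBlDr lerBrDr (mulrC x).
    by rewrite ltrBlDr lerBrDr (mulrC x).
  rewrite !lebesgue_measure_itv /= !lte_fin ltr_pM2r ?invr_gt0// ltrD2r.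
  case: ifP => _; rewrite ?mule0// -!EFinB -EFinM; congr EFin.
  by field; rewrite gt_eqF.
rewrite mE => ->; rewrite muleA -EFinM mulVf ?gt_eqF// mul1e //.
Qed.

Lemma leb2_setX (A B : set mR) : measurable A -> measurable B ->
  leb2 (A `*` B) = (lam A * lam B)%E.
Proof. exact: product_measure1E. Qed.

Definition affine2 (s t s' t' : R) (z : mR * mR) : mR * mR :=
  (affine1 s t z.1, affine1 s' t' z.2).

Lemma measurable_affine2 s t s' t' : measurable_fun setT (affine2 s t s' t').
Proof.
apply: measurable_fun_pair.
- exact: measurableT_comp (measurable_affine1 s t) measurable_fst.
- exact: measurableT_comp (measurable_affine1 s' t') measurable_snd.
Qed.

(** Both sides are measures in A; they are compared on rectangles. *)
Lemma leb2_affine (s t s' t' : R) (A : set (mR * mR)) : 0 < s -> 0 < s' ->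
  measurable A ->
  leb2 (affine2 s t s' t' @^-1` A) = ((s * s')^-1%:E * leb2 A)%E.
Proof.
move=> s0 s'0 mA.
have ss0 : 0 <= s * s' by rewrite mulr_ge0 ?ltW.
have mf := measurable_affine2 s t s' t'.
pose m := mscale (NngNum ss0) (pushforward leb2 (affine2 s t s' t')).
suff : leb2 A = ((s * s')%:E * leb2 (affine2 s t s' t' @^-1` A))%E.
  by move=> ->; rewrite muleA -EFinM mulVf ?mul1e// mulf_neq0 ?gt_eqF.
apply: (@product_measure_unique _ _ _ _ _ lam lam (m mf)) => // X Y mX mY.
change ((s * s')%:E * leb2 (affine2 s t s' t' @^-1` (X `*` Y)) = lam X * lam Y)%E.
have -> : affine2 s t s' t' @^-1` (X `*` Y) =
    (affine1 s t @^-1` X) `*` (affine1 s' t' @^-1` Y) by [].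
have mpre u v Z : measurable Z -> measurable (affine1 u v @^-1` Z).
  by move=> mZ; rewrite -[X in measurable X]setTI; exact: measurable_affine1.
rewrite leb2_setX ?lebesgue_measure_affine//; try exact: mpre.
have K u Z : 0 < u -> (u%:E * (u^-1%:E * Z) = Z :> \bar R)%E.
  by move=> u0; rewrite muleA -EFinM mulfV ?gt_eqF// mul1e.
by rewrite EFinM muleACA !K.
Qed.

Definition flip (T : Type) (z : T * T) : T * T := (z.2, z.1).

Lemma measurable_flip : measurable_fun setT (@flip mR).
Proof. exact: measurable_swap. Qed.

Lemma leb2_flip (A : set (mR * mR)) : measurable A ->
  leb2 (@flip mR @^-1` A) = leb2 A.
Proof.
move=> mA; pose m := pushforward leb2 (@flip mR) : {measure set (mR * mR) -> \bar R}.
have mf := measurable_flip.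
suff -> : leb2 A = m mf A by [].
apply: product_measure_unique => // X Y mX mY.
change (leb2 (@flip mR @^-1` (X `*` Y)) = lam X * lam Y)%E.
have -> : @flip mR @^-1` (X `*` Y) = Y `*` X.
  by apply/seteqP; split => -[x y] [].
by rewrite leb2_setX// muleC.
Qed.

Definition box (c : R * R) (s : R) : set (R * R) :=
  `[c.1, c.1 + s[%classic `*` `[c.2, c.2 + s[%classic.

Lemma measurable_box c s : measurable (box c s : set (mR * mR)).
Proof. by apply: measurableX; exact: measurable_itv. Qed.

Lemma leb2_box c s : 0 <= s -> leb2 (box c s) = (s ^+ 2)%:E.
Proof.
move=> s0; rewrite leb2_setX; try exact: measurable_itv.
have E x : lam `[x, x + s[%classic = s%:E.
  rewrite lebesgue_measure_itv /= lte_fin ltrDl -EFinB addrAC subrr add0r.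
  by case: ltP => // sle; congr EFin; apply/le_anti; rewrite s0 sle.
by rewrite !E -EFinM expr2.
Qed.

(** The indices of the dyadic square of side 2^-n that contains z. *)
Definition cell (n : nat) (z : R * R) : int * int :=
  (Num.floor (2 ^+ n * z.1), Num.floor (2 ^+ n * z.2)).

Lemma floor_eqP (x : R) (k : int) :
  Num.floor x = k <-> k%:~R <= x < k%:~R + 1.
Proof.
split=> [<-|h].
  by rewrite ge_floor /= -[1]/(1%:~R) -intrD -floor_lt_int ltzD1.
by apply/floor_def; rewrite intrD.
Qed.

(** Dyadic squares are nested: the square of order n is determined by the one
    of any higher order. *)
Lemma cell_mono n m z z' : (n <= m)%N -> cell m z = cell m z' -> cell n z = cell n z'.
Proof.
have half (x y : R) : Num.floor (2 * x) = Num.floor (2 * y) ->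
    Num.floor x = Num.floor y.
  move=> h; apply/floor_eqP.
  have /floor_eqP/andP[y1 y2] : Num.floor y = Num.floor y by [].
  set a := Num.floor y in y1 y2 *.
  have /floor_eqP := h.
  have /floor_eqP : Num.floor (2 * y) = Num.floor (2 * y) by [].
  set m' := Num.floor (2 * y) => /andP[ym1 ym2] /andP[xm1 xm2].
  have am : (2 * a <= m')%R.
    rewrite /m' floor_ge_int intrM; lra.
  have ma : (m' < 2 * a + 2)%R.
    rewrite -(ltr_int R) intrD intrM (le_lt_trans ym1)//; lra.
  have ma' : (m' + 1 <= 2 * a + 2)%R by lia.
  have := ma'; rewrite -(ler_int R) !intrD intrM => {}ma'.
  move: am; rewrite -(ler_int R) intrM => am.
  by apply/andP; split; lra.
elim: m => [|m IH]; first by rewrite leqn0 => /eqP ->.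
rewrite leq_eqVlt => /predU1P[-> //|]; rewrite ltnS => nm h.
apply: IH => //; move: h; rewrite /cell !exprS -!mulrA => -[h1 h2].
by congr pair; exact: half.
Qed.

Lemma cell_dist n z z' : cell n z = cell n z' ->
  `|z.1 - z'.1| < (2 ^+ n)^-1 /\ `|z.2 - z'.2| < (2 ^+ n)^-1.
Proof.
have p : 0 < 2 ^+ n :> R by rewrite exprn_gt0.
have aux (x y : R) : Num.floor (2 ^+ n * x) = Num.floor (2 ^+ n * y) ->
    `|x - y| < (2 ^+ n)^-1.
  move=> /floor_eqP/andP[h1 h2].
  have /floor_eqP/andP[h3 h4] : Num.floor (2 ^+ n * y) = Num.floor (2 ^+ n * y) by [].
  rewrite -(ltr_pM2l p) mulfV ?gt_eqF// -{1}(gtr0_norm p) -normrM mulrBr.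
  by rewrite ltr_norml; apply/andP; split; lra.
by move=> [h1 h2]; split; exact: aux.
Qed.

Lemma cell_box n k : [set z | cell n z = k] =
  box (k.1%:~R / 2 ^+ n, k.2%:~R / 2 ^+ n) (2 ^+ n)^-1.
Proof.
have p : 0 < 2 ^+ n :> R by rewrite exprn_gt0.
have aux (x : R) (i : int) : Num.floor (2 ^+ n * x) = i <->
    x \in `[i%:~R / 2 ^+ n, i%:~R / 2 ^+ n + (2 ^+ n)^-1[.
  rewrite floor_eqP in_itv /= ler_pdivrMr// mulrC.
  have -> : i%:~R / 2 ^+ n + (2 ^+ n)^-1 = (i%:~R + 1) / 2 ^+ n :> R.
    by rewrite mulrDl mul1r.
  by rewrite ltr_pdivlMr// [2 ^+ n * x]mulrC.
case: k => i j; apply/seteqP; split=> [[x y] /= [/aux ? /aux ?]|[x y] [/aux /= <- /aux /= <-]] //.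
Qed.

Lemma small_pow (e : R) : 0 < e -> exists n : nat, (2 ^+ n)^-1 < e.
Proof.
move=> e0; have [n _ /(_ n (leqnn n)) /= h] := near_infty_natSinv_expn_lt (PosNum e0).
by exists n; rewrite -div1r.
Qed.

(** The maximal dyadic squares contained in O, among those of order at least
    n0 with 2^-n0 < e, are disjoint and cover O. They are numbered through the countable type of
    pairs (order, indices), the unused numbers being given an empty box of
    side 0. *)
Lemma open_box_partition (O : set (R * R)) (e : R) : open O -> 0 < e ->
  exists (c : nat -> R * R) (s : nat -> R),
    [/\ forall m, 0 <= s m <= e, trivIset setT (fun m => box (c m) (s m)) &
        O = \bigcup_m box (c m) (s m)].
Proof.
move=> oO e0; have [n0 n0e] := small_pow e0.
pose Q n (k : int * int) : set (R * R) := [set z | cell n z = k].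
pose sel (n : nat) (k : int * int) : Prop := [/\ (n0 <= n)%N, Q n k `<=` O &
  forall z m, Q n k z -> (n0 <= m < n)%N -> ~ (Q m (cell m z) `<=` O)].
pose dec (i : nat) : option (nat * (int * int)) :=
  if @pickle_inv (nat * (int * int))%type i is Some nk then
    if `[< sel nk.1 nk.2 >] then Some nk else None else None.
pose c i : R * R := if dec i is Some nk then
  (nk.2.1%:~R / 2 ^+ nk.1, nk.2.2%:~R / 2 ^+ nk.1) else (0, 0).
pose s i : R := if dec i is Some nk then (2 ^+ nk.1)^-1 else 0.
have boxE i z : box (c i) (s i) z <-> exists2 nk, dec i = Some nk & Q nk.1 nk.2 z.
  rewrite /c /s; case: (dec i) => [[n k]|].
    rewrite -cell_box; split=> [h|[_ [<-]]] //.
    by exists (n, k).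
  split=> [|[]//]; case=> /=; rewrite in_itv /= addr0 => /andP[h1 h2].
  by have := le_lt_trans h1 h2; rewrite ltxx.
have decP i nk : dec i = Some nk -> pickle nk = i /\ sel nk.1 nk.2.
  rewrite /dec; have := @pickle_invK (nat * (int * int))%type i.
  by case: pickle_inv => //= mk ki; case: asboolP => // hs [<-].
exists c, s; split.
- move=> i; rewrite /s; case E : (dec i) => [[n k]|]; last by rewrite lexx ltW.
  have [_ [/= n0n _ _]] := decP _ _ E.
  rewrite invr_ge0 exprn_ge0//= (le_trans _ (ltW n0e))//.
  by rewrite lef_pV2 ?posrE ?exprn_gt0// ler_eXn2l// ltr1n.
- move=> i j _ _ [z [/boxE[[n k] /decP[<- [/= n0n nO nmin]] nz]]].
  move=> /boxE[[m l] /decP[<- [/= n0m mO mmin]] mz]; congr pickle.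
  case: (ltngtP n m) => [nm|mn|nm].
  + have := mmin z n mz; rewrite n0n nm => /(_ isT).
    by rewrite nz.
  + have := nmin z m nz; rewrite n0m mn => /(_ isT).
    by rewrite mz.
  + by rewrite nm; congr pair; rewrite -mz -nz nm.
- apply/seteqP; split=> [z Oz|z [i _ /boxE[nk /decP[_ [_ sub _]] Qz]]]; last exact: sub.
  have [r /= r0 rO] : exists2 r : R, 0 < r & ball z r `<=` O.
    by have /nbhs_ballP[r r0 h] := oO z Oz; exists r.
  have [n1 n1r] := small_pow r0.
  pose P n := (n0 <= n)%N && `[< Q n (cell n z) `<=` O >].
  have exP : exists n, P n.
    exists (maxn n0 n1); rewrite /P leq_maxl /=; apply/asboolP => y Qy; apply: rO.
    have [h1 h2] : `|z.1 - y.1| < (2 ^+ maxn n0 n1)^-1 /\ `|z.2 - y.2| < (2 ^+ maxn n0 n1)^-1.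
      exact: cell_dist.
    have le : (2 ^+ maxn n0 n1)^-1 <= (2 ^+ n1)^-1 :> R.
      by rewrite lef_pV2 ?posrE ?exprn_gt0// ler_eXn2l ?ltr1n ?leq_maxr.
    by split; rewrite /ball /=; lra.
  have [n /andP[n0n /asboolP nO] nmin] := ex_minnP exP.
  exists (pickle (n, cell n z)) => //; apply/boxE; exists (n, cell n z) => //.
  rewrite /dec pickleK_inv /= asboolT//; split => // y m Qy /andP[n0m mn] Qm.
  have : P m.
    rewrite /P n0m /=; apply/asboolP => w Qw; apply: Qm.
    by rewrite /Q /= (cell_mono (ltnW mn) Qy); exact: Qw.
  by move=> /nmin; rewrite leqNgt mn.
Qed.

Lemma open_measurable2 (O : set (R * R)) : open O -> measurable (O : set (mR * mR)).
Proof.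
move=> /open_box_partition /(_ ltr01)[c [s [_ _ ->]]].
by apply: bigcup_measurable => i _; exact: measurable_box.
Qed.

Lemma closed_measurable2 (F : set (R * R)) : closed F -> measurable (F : set (mR * mR)).
Proof.
move=> cF; rewrite -[F]setCK; apply: measurableC.
by apply: open_measurable2; rewrite openC.
Qed.

End PlanarLebesgue.

(** * The area of a disc *)

Section Disc.
Variable R : realType.
Local Notation mR := (measurableTypeR R).
Local Notation lam := (@lebesgue_measure R).
Local Notation leb2 := (@lebesgue_measure R \x @lebesgue_measure R)%E.

Definition disc (c : R * R) (r : R) : set (R * R) :=
  [set z | (z.1 - c.1) ^+ 2 + (z.2 - c.2) ^+ 2 <= r ^+ 2].

(** Substitute x = sin t; the integrand becomes 2 cos^2 t, of which
    t + sin t cos t is a primitive. *)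
Lemma integral_semicircle :
  (\int[lam]_(x in `[(-1)%R, 1%R]) (2 * Num.sqrt (1 - x ^+ 2))%:E)%E = pi%:E :> \bar R.
Proof.
have pi0 : 0 < pi :> R by exact: pi_gt0.
have ab : - (pi / 2) < pi / 2 :> R by rewrite ltrN2 || lra.
have dsin : derive1 (@sin R) = cos by apply/funext => x; rewrite derive1E; exact: derive_val.
have csq : continuous (fun x : R => 2 * Num.sqrt (1 - x ^+ 2)).
  move=> x; apply: cvgM; first exact: cvg_cst.
  apply: (@continuous_comp _ _ _ (fun x : R => 1 - x ^+ 2) Num.sqrt).
    by apply: cvgB; [exact: cvg_cst|exact: exprn_continuous].
  exact: sqrt_continuous.
have S := @integration_by_substitution_increasing R sin (fun x => 2 * Num.sqrt (1 - x ^+ 2))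
  (- (pi / 2)) (pi / 2) (ltW ab).
rewrite sinN sin_pihalf in S; rewrite S; clear S; first last.
- exact: continuous_subspaceT.
- split=> [x _||]; first exact: derivable_sin.
  + by apply: cvg_at_right_filter; exact: continuous_sin.
  + by apply: cvg_at_left_filter; exact: continuous_sin.
- by rewrite dsin; apply/cvg_ex; exists (cos (pi / 2)); apply: cvg_at_left_filter; exact: continuous_cos.
- by rewrite dsin; apply/cvg_ex; exists (cos (- (pi / 2))); apply: cvg_at_right_filter; exact: continuous_cos.
- by move=> x _; rewrite dsin; exact: continuous_cos.
- by move=> x y xI yI; rewrite ltr_sin.
rewrite dsin.
have -> : (\int[lam]_(x in `[(- (pi / 2))%R, (pi / 2)%R])
    ((((fun x => 2 * Num.sqrt (1 - x ^+ 2)) \o sin) * cos)%R x)%:E =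
  \int[lam]_(x in `[(- (pi / 2))%R, (pi / 2)%R]) (2 * cos x ^+ 2)%:E)%E.
  apply: eq_integral => x; rewrite inE /= => xI; congr EFin.
  rewrite /GRing.mul /=  -cos2sin2 sqrtr_sqr ger0_norm ?cos_ge0_pihalf//.
  by rewrite -mulrA -expr2.
pose P x : R := x + sin x * cos x.
have dP (x : R) : is_derive x (1 : R) P (2 * cos x ^+ 2).
  apply: is_derive_eq; rewrite /GRing.scale /=.
  have := cos2Dsin2 x; lra.
rewrite (@continuous_FTC2 _ _ P)//.
- rewrite /P sinN cosN cos_pihalf !mulr0 !addr0 -EFinB; congr EFin; lra.
- apply: continuous_subspaceT => x; apply: cvgM; first exact: cvg_cst.
  by apply: (@continuous_comp _ _ _ cos (fun y => y ^+ 2)); [exact: continuous_cos|exact: exprn_continuous].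
- have cP (x : R) : {for x, continuous P}.
    by apply: differentiable_continuous; apply/derivable1_diffP; apply: ex_derive.
  split=> [x _||]; first exact: ex_derive.
  + by apply: cvg_at_right_filter; exact: cP.
  + by apply: cvg_at_left_filter; exact: cP.
- by move=> x _; rewrite derive1E derive_val.
Qed.

Lemma continuous_sqdist (c : R * R) :
  continuous (fun z : R * R => (z.1 - c.1) ^+ 2 + (z.2 - c.2) ^+ 2).
Proof.
move=> z; apply: cvgD.
- apply: (@continuous_comp _ _ _ (fun z : R * R => z.1 - c.1) (fun y : R => y ^+ 2)).
    by apply: cvgB; [exact: cvg_fst|exact: cvg_cst].
  exact: exprn_continuous.
- apply: (@continuous_comp _ _ _ (fun z : R * R => z.2 - c.2) (fun y : R => y ^+ 2)).
    by apply: cvgB; [exact: cvg_snd|exact: cvg_cst].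
  exact: exprn_continuous.
Qed.

Lemma closed_disc c r : closed (disc c r).
Proof.
apply: (@closed_comp _ _ (fun z : R * R => (z.1 - c.1) ^+ 2 + (z.2 - c.2) ^+ 2)
  [set y | y <= r ^+ 2]); last exact: closed_le.
by move=> z _; exact: continuous_sqdist.
Qed.

Lemma measurable_disc c r : measurable (disc c r : set (mR * mR)).
Proof. by apply: closed_measurable2; exact: closed_disc. Qed.

Lemma leb2_unit_disc : leb2 (disc (0, 0) 1) = pi%:E.
Proof.
rewrite -integral_semicircle [RHS]integral_mkcond; apply: eq_integral => x _.
rewrite /= patchE mem_setE in_itv /=.
have -> : xsection (disc (0, 0) 1) x =
    [set y : R | y ^+ 2 <= 1 - x ^+ 2].
  apply/seteqP; split=> y /=; rewrite /xsection /= inE /disc /= !subr0 expr1n; lra.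
case: ifPn => [/andP[x1 x2]|xn].
  have u0 : 0 <= 1 - x ^+ 2 by nra.
  have s0 := sqrtr_ge0 (1 - x ^+ 2).
  have -> : [set y : R | y ^+ 2 <= 1 - x ^+ 2] =
      `[- Num.sqrt (1 - x ^+ 2), Num.sqrt (1 - x ^+ 2)]%classic.
    apply/seteqP; split=> y /=; rewrite in_itv /= -ler_norml -[_ <= Num.sqrt _]ler_sqr ?nnegrE//;
      by rewrite sqr_sqrtr// real_normK ?num_real.
  rewrite lebesgue_measure_itv /= lte_fin; case: ifPn => [_|].
    by rewrite -EFinB; congr EFin; lra.
  rewrite -leNgt => h; congr EFin; lra.
have -> : [set y : R | y ^+ 2 <= 1 - x ^+ 2] = set0; last by rewrite measure0.
apply/seteqP; split=> // y /= h.
have := sqr_ge0 y; move: xn; rewrite negb_and -!ltNge => /orP[] ?; nra.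
Qed.

Lemma leb2_disc c r : 0 <= r -> leb2 (disc c r) = (pi * r ^+ 2)%:E.
Proof.
rewrite le_eqVlt => /predU1P[<-|r0].
  have -> : disc c 0 = [set c.1] `*` [set c.2].
    apply/seteqP; split=> -[x y] /=; rewrite /disc /=; last first.
      by move=> [-> ->]; rewrite !subrr !expr0n /= addr0.
    move=> h; have := sqr_ge0 (x - c.1); have := sqr_ge0 (y - c.2).
    move: h; rewrite [in X in _ <= X]expr0n /= => h h1 h2.
    have : (x - c.1) ^+ 2 = 0 /\ (y - c.2) ^+ 2 = 0 by split; lra.
    move=> [/eqP + /eqP]; rewrite !sqrf_eq0 => /eqP ? /eqP ?; split; lra.
  by rewrite leb2_setX ?lebesgue_measure_set1 ?mule0 ?expr0n ?mulr0//; exact: measurable_set1.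
have -> : disc c r = affine2 r^-1 (- (c.1 / r)) r^-1 (- (c.2 / r)) @^-1` disc (0, 0) 1.
  apply/seteqP; split=> -[x y]; rewrite /disc /affine2 /affine1 /= !subr0 expr1n => h.
    have -> : (r^-1 * x - c.1 / r) ^+ 2 + (r^-1 * y - c.2 / r) ^+ 2 =
      ((x - c.1) ^+ 2 + (y - c.2) ^+ 2) / r ^+ 2 by field; rewrite gt_eqF.
    by rewrite ler_pdivrMr ?mul1r// exprn_gt0.
  move: h.
  have -> : (r^-1 * x - c.1 / r) ^+ 2 + (r^-1 * y - c.2 / r) ^+ 2 =
      ((x - c.1) ^+ 2 + (y - c.2) ^+ 2) / r ^+ 2 by field; rewrite gt_eqF.
  by rewrite ler_pdivrMr ?mul1r// exprn_gt0.
rewrite leb2_affine ?invr_gt0//; last exact: measurable_disc.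
rewrite leb2_unit_disc -EFinM; congr EFin; field; rewrite gt_eqF//.
Qed.

End Disc.

(** * The isodiametric inequality in the plane *)

Section Isodiametric.
Variable R : realType.
Local Notation mR := (measurableTypeR R).
Local Notation lam := (@lebesgue_measure R).
Local Notation leb2 := (@lebesgue_measure R \x @lebesgue_measure R)%E.

Definition sqdist (z w : R * R) : R := (z.1 - w.1) ^+ 2 + (z.2 - w.2) ^+ 2.

Definition diam_le (S : set (R * R)) (D : R) :=
  forall z w, S z -> S w -> sqdist z w <= D ^+ 2.

(** Steiner symmetrization: each vertical section is replaced by the open
    segment of the same length centred on the horizontal axis. The strict
    inequality makes empty sections stay empty, which diam_le_steiner needs. *)
Definition steiner (S : set (mR * mR)) : set (mR * mR) :=
  [set z | 2 * `|z.2| < fine (lam (xsection S z.1))].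

Lemma measurable_steiner S : measurable S -> measurable (steiner S).
Proof.
move=> mS.
have mf : measurable_fun setT (fun z : mR * mR => 2 * `|z.2| : mR).
  exact: measurableT_comp (mulrl_measurable 2)
    (measurableT_comp (@normr_measurable _ setT) (@measurable_snd _ _ mR mR)).
have mg : measurable_fun setT (fun z : mR * mR => fine (lam (xsection S z.1)) : mR).
  have ml : measurable_fun setT (lam \o xsection S) by exact: measurable_fun_xsection.
  have m1 : measurable_fun setT (fun z : mR * mR => lam (xsection S z.1)).
    exact: measurableT_comp ml measurable_fst.
  exact: measurableT_comp (fine_measurable measurableT) m1.
have := measurable_fun_ltr mf mg measurableT (Y := [set true]).
by rewrite setTI; apply.
Qed.

Lemma diam_le_section S D x : measurable (S : set (mR * mR)) -> diam_le S D -> 0 <= D ->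
  lam (xsection S x) \is a fin_num.
Proof.
move=> mS dS D0.
have mx : measurable (xsection S x) by exact: measurable_xsection.
have [->|/set0P[y]] := eqVneq (xsection S x) set0; first by rewrite measure0.
rewrite /xsection /= inE => Sy.
rewrite ge0_fin_numE ?measure_ge0//.
apply: (@le_lt_trans _ _ (lam `[y - D, y + D]%classic)).
  apply: le_measure; rewrite ?inE//.
  move=> u /=; rewrite /xsection /= inE => Su; rewrite in_itv /=.
  have := dS _ _ Su Sy; rewrite /sqdist /= subrr expr0n /= add0r => h.
  have : `|u - y| <= D by rewrite -ler_sqr ?nnegrE// real_normK ?num_real.
  by rewrite ler_norml => /andP[? ?]; apply/andP; split; lra.
by rewrite lebesgue_measure_itv /=; case: ifP => _; rewrite ?ltry// -EFinB ltry.
Qed.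

Lemma leb2_steiner S D : measurable S -> diam_le S D -> 0 <= D ->
  leb2 (steiner S) = leb2 S.
Proof.
move=> mS dS D0; apply: eq_integral => x _ /=.
have /fineK <- := diam_le_section x mS dS D0.
set l := fine _.
have -> : xsection (steiner S) x = `]- (l / 2), l / 2[%classic.
  apply/seteqP; split => y /=; rewrite /xsection /= inE /steiner /= -/l in_itv /= -ltr_norml; lra.
have l0 : 0 <= l by rewrite fine_ge0// measure_ge0.
rewrite lebesgue_measure_itv /= lte_fin; case: ifPn => [_|].
  by rewrite -EFinB; congr EFin; lra.
rewrite -leNgt => h; congr EFin; lra.
Qed.

Lemma lebesgue_measure_le_hull (A : set mR) (m M : R) : measurable A ->
  A `<=` `[m, M]%classic -> m <= M -> (lam A <= (M - m)%:E)%E.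
Proof.
move=> mA sub mM; apply: (@le_trans _ _ (lam `[m, M]%classic)).
  by apply: le_measure; rewrite ?inE.
rewrite lebesgue_measure_itv /=; case: ifP => _; first by rewrite -EFinB.
by rewrite lee_fin subr_ge0.
Qed.

(** For two vertical sections A, A' at horizontal distance h, every v in A and v'
    in A' satisfy |v - v'| <= T with T^2 = D^2 - h^2. Comparing the suprema and
    infima of A and A' gives |A| + |A'| <= 2 T, and two points of the centred
    segments differ vertically by at most (|A| + |A'|) / 2. *)
Lemma diam_le_steiner S D : measurable S -> diam_le S D -> 0 <= D ->
  diam_le (steiner S) D.
Proof.
move=> mS dS D0 [x y] [x' y'].
rewrite /steiner /sqdist /=; set A := xsection S x; set A' := xsection S x'.
have mA : measurable A by exact: measurable_xsection.
have mA' : measurable A' by exact: measurable_xsection.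
have ne (B : set mR) (u : R) : 2 * `|u| < fine (lam B) -> B !=set0.
  move=> h; apply/set0P/eqP => B0; move: h; rewrite B0 measure0 /=.
  by have := normr_ge0 u; lra.
move=> h h'.
have [u Au] := ne _ _ h; have [u' Au'] := ne _ _ h'.
have AS v : A v -> S (x, v) by rewrite /A /xsection /= inE.
have AS' v : A' v -> S (x', v) by rewrite /A' /xsection /= inE.
set T := Num.sqrt (D ^+ 2 - (x - x') ^+ 2).
have T2 : T ^+ 2 = D ^+ 2 - (x - x') ^+ 2.
  rewrite sqr_sqrtr// subr_ge0.
  have := dS _ _ (AS _ Au) (AS' _ Au'); rewrite /sqdist /=.
  by have := sqr_ge0 (u - u'); lra.
have T0 : 0 <= T by exact: sqrtr_ge0.
have AA' v v' : A v -> A' v' -> `|v - v'| <= T.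
  move=> Av Av'; rewrite -ler_sqr ?nnegrE// real_normK ?num_real// T2.
  by have := dS _ _ (AS _ Av) (AS' _ Av'); rewrite /sqdist /=; lra.
have bnd (B : set R) (b0 b1 : R) : (forall v, B v -> b0 <= v <= b1) -> has_ubound B /\ has_lbound B.
  by move=> Bb; split; [exists b1|exists b0] => v /Bb/andP[].
have [uA lA] : has_ubound A /\ has_lbound A.
  apply: (bnd _ (u' - T) (u' + T)) => v Av.
  by have := AA' _ _ Av Au'; rewrite ler_norml => /andP[? ?]; apply/andP; split; lra.
have [uA' lA'] : has_ubound A' /\ has_lbound A'.
  apply: (bnd _ (u - T) (u + T)) => v Av.
  by have := AA' _ _ Au Av; rewrite ler_norml => /andP[? ?]; apply/andP; split; lra.
have neA : A !=set0 by exists u.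
have neA' : A' !=set0 by exists u'.
have c1 : sup A - T <= inf A'.
  apply: lb_le_inf => // v' Av'; rewrite lerBlDr; apply: ge_sup => // v Av.
  by have := AA' _ _ Av Av'; rewrite ler_norml => /andP[? ?]; lra.
have c2 : sup A' - T <= inf A.
  apply: lb_le_inf => // v Av; rewrite lerBlDr; apply: ge_sup => // v' Av'.
  by have := AA' _ _ Av Av'; rewrite ler_norml => /andP[? ?]; lra.
have len (B : set mR) : measurable B -> B !=set0 -> has_ubound B -> has_lbound B ->
    fine (lam B) <= sup B - inf B.
  move=> mB [b Bb] uB lB.
  have le1 : inf B <= sup B by apply: (@le_trans _ _ b); [exact: ge_inf|exact: ub_le_sup].
  have : (lam B <= (sup B - inf B)%:E)%E.
    apply: lebesgue_measure_le_hull => // v Bv /=; rewrite in_itv /=.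
    by apply/andP; split; [exact: ge_inf|exact: ub_le_sup].
  move=> le2; rewrite -lee_fin fineK// ge0_fin_numE ?measure_ge0//.
  by rewrite (le_lt_trans le2)// ltry.
have l1 := len _ mA neA uA lA; have l2 := len _ mA' neA' uA' lA'.
have : `|y - y'| <= T by have := ler_normB y y'; lra.
rewrite -ler_sqr ?nnegrE// real_normK ?num_real// T2; lra.
Qed.

(** After a symmetrization in each variable the set is symmetric about the
    origin; a symmetric set in which distances are at most D lies in the disc
    of radius D / 2. *)
Lemma isodiametric (S : set (R * R)) (D : R) : measurable (S : set (mR * mR)) ->
  diam_le S D -> 0 <= D -> (leb2 S <= (pi / 4 * D ^+ 2)%:E)%E.
Proof.
move=> mS dS D0.
have mS1 := measurable_steiner mS.
have dS1 := diam_le_steiner mS dS D0.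
pose S2 := @flip mR @^-1` steiner S.
have mS2 : measurable S2.
  by rewrite -[X in measurable X]setTI; exact: measurable_flip.
have dS2 : diam_le S2 D.
  by move=> z w Sz Sw; have := dS1 _ _ Sz Sw; rewrite /sqdist /flip /= addrC.
have mS3 := measurable_steiner mS2.
have dS3 := diam_le_steiner mS2 dS2 D0.
have sym3 z : steiner S2 z -> steiner S2 (- z.1, - z.2).
  rewrite /steiner /= normrN.
  suff -> : xsection S2 (- z.1) = xsection S2 z.1 by [].
  apply/seteqP; split => y; rewrite /xsection /= !inE /S2 /steiner /= ?normrN //.
have -> : leb2 S = leb2 (steiner S2).
  by rewrite (leb2_steiner mS2 dS2 D0) leb2_flip// (leb2_steiner mS dS D0).
have -> : pi / 4 * D ^+ 2 = pi * (D / 2) ^+ 2 by field.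
rewrite -(leb2_disc (0, 0)); last by rewrite divr_ge0.
apply: le_measure; rewrite ?inE//; first exact: measurable_disc.
move=> z Sz; have := dS3 _ _ Sz (sym3 _ Sz).
rewrite /sqdist /disc /= !subr0; lra.
Qed.

End Isodiametric.

(** * Covering an open set by small discs of nearly the same area *)

Section DiscCover.
Variable R : realType.
Local Notation mR := (measurableTypeR R).
Local Notation leb2 := (@lebesgue_measure R \x @lebesgue_measure R)%E.

(** O has a countable cover by discs of radius at most e and total area at most
    m. *)
Definition disc_cover (O : set (R * R)) (e m : R) :=
  exists (c : nat -> R * R) (r : nat -> R),
    [/\ forall n, 0 <= r n <= e, O `<=` \bigcup_n disc (c n) (r n) &
        (\sum_(0 <= n <oo) (pi * r n ^+ 2)%:E <= m%:E)%E].

Lemma disc_cover_le O e m m' : m <= m' -> disc_cover O e m -> disc_cover O e m'.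
Proof.
move=> mm [c [r [? ? h]]]; exists c, r; split=> //.
by rewrite (le_trans h)// lee_fin.
Qed.

Lemma leb2_bigcup_box (c : nat -> R * R) (s : nat -> R) : (forall n, 0 <= s n) ->
  trivIset setT (fun n => box (c n) (s n)) ->
  (leb2 (\bigcup_n box (c n) (s n)) = \sum_(0 <= n <oo) (s n ^+ 2)%:E)%E.
Proof.
move=> s0 tF; rewrite measure_semi_bigcup//; last 2 first.
- by move=> n; exact: measurable_box.
- by apply: bigcup_measurable => n _; exact: measurable_box.
by apply: eq_eseriesr => n _; exact: leb2_box.
Qed.

Lemma box_sub_disc (c : R * R) (s : R) : box c s `<=` disc (c.1 + s / 2, c.2 + s / 2) s.
Proof.
move=> [x y] [] /=; rewrite !in_itv /= => /andP[h1 h2] /andP[h3 h4].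
rewrite /disc /=.
have a1 : `|x - (c.1 + s / 2)| <= s / 2 by rewrite ler_norml; apply/andP; split; lra.
have a2 : `|y - (c.2 + s / 2)| <= s / 2 by rewrite ler_norml; apply/andP; split; lra.
have s0 : 0 <= s / 2 by exact: le_trans (normr_ge0 _) a1.
move: a1 a2; rewrite -ler_sqr ?nnegrE// real_normK ?num_real//.
move=> a1; rewrite -ler_sqr ?nnegrE// real_normK ?num_real//; nra.
Qed.

(** A first crude cover: replace each box of a partition by a disc of radius
    its side, at the cost of a factor pi. *)
Lemma disc_cover_pi O e a : open O -> 0 < e -> (leb2 O <= a%:E)%E ->
  disc_cover O e (pi * a).
Proof.
move=> oO e0 Oa; have [c [s [se tF OE]]] := open_box_partition oO e0.
exists (fun n => ((c n).1 + s n / 2, (c n).2 + s n / 2)), s; split=> //.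
  by rewrite OE => z [n _ Bz]; exists n => //; exact: box_sub_disc.
rewrite EFinM; under eq_eseriesr do rewrite EFinM.
rewrite nneseriesZl; last by move=> n _; rewrite lee_fin sqr_ge0.
rewrite lee_pmul2l// ?lte_fin ?pi_gt0//.
rewrite -(@leb2_bigcup_box c s)//; first by rewrite -OE.
by move=> n; have /andP[] := se n.
Qed.

Lemma inner_disc_sub_box (c : R * R) (s : R) : 0 < s ->
  disc (c.1 + s / 2, c.2 + s / 2) (9 / 20 * s) `<=` box c s.
Proof.
move=> s0 [x y]; rewrite /disc /= => h.
have s9 : 0 <= 9 / 20 * s by rewrite mulr_ge0// ltW.
have aux u v : u ^+ 2 + v ^+ 2 <= (9 / 20 * s) ^+ 2 -> `|u| <= 9 / 20 * s.
  move=> uv; rewrite -ler_sqr ?nnegrE// real_normK ?num_real//.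
  by have := sqr_ge0 v; lra.
have := aux _ _ h; rewrite addrC in h; have := aux _ _ h.
rewrite !ler_norml => /andP[? ?] /andP[? ?].
by split; rewrite /= in_itv /=; apply/andP; split; lra.
Qed.

Lemma nneseries_ltP (u : nat -> R) (b : R) : (forall n, 0 <= u n) ->
  (b%:E < \sum_(0 <= n <oo) (u n)%:E)%E -> exists N, b < \sum_(i < N) u i.
Proof.
move=> u0 h; apply: contrapT => /forallNP H.
move: h; rewrite ltNge => /negP; apply.
apply: lime_le; first by apply: is_cvg_nneseries => n _ _; rewrite lee_fin.
by apply: nearW => n; rewrite big_mkord sumEFin lee_fin leNgt; apply/negP/H.
Qed.

(** If every open set has covers that waste a factor K, pack into the boxes of a
    partition of O finitely many disjoint discs of total area S >= |O| / 4 and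
    cover the remaining open set with waste K. The total area is at most
    S + K (|O| - S) <= (3 K + 1) / 4 |O|. *)
Lemma disc_cover_step (K e : R) : 1 <= K ->
  (forall O a, open O -> (leb2 O <= a%:E)%E -> disc_cover O e (K * a)) -> 0 < e ->
  forall O a, open O -> (leb2 O <= a%:E)%E -> disc_cover O e ((3 * K + 1) / 4 * a).
Proof.
move=> K1 IH e0 O a' oO Oa'.
have mO := open_measurable2 oO.
have Ofin : leb2 O \is a fin_num.
  by rewrite ge0_fin_numE ?measure_ge0// (le_lt_trans Oa')// ltry.
set a := fine (leb2 O); have Oa : leb2 O = a%:E by rewrite fineK.
have a0 : 0 <= a by rewrite fine_ge0// measure_ge0.
have aa' : a <= a' by rewrite -lee_fin -Oa.
apply: (@disc_cover_le _ _ ((3 * K + 1) / 4 * a)).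
  by rewrite ler_pM2l//; lra.
clear a' Oa' aa'.
have [c [s [se tF OE]]] := open_box_partition oO e0.
have s0 n : 0 <= s n by have /andP[] := se n.
pose cc n := ((c n).1 + s n / 2, (c n).2 + s n / 2).
pose D n := disc (cc n) (9 / 20 * s n).
pose E n := if 0 < s n then D n else set0.
have mE n : measurable (E n : set (mR * mR)).
  by rewrite /E; case: ifP => // _; exact: measurable_disc.
have EB n : E n `<=` box (c n) (s n).
  by rewrite /E; case: ifPn => // sn0; exact: inner_disc_sub_box.
have tE : trivIset setT E.
  move=> i j _ _ [z [Ei Ej]]; apply: tF => //; exists z; split; exact: EB.
have lE n : leb2 (E n) = (pi * (9 / 20 * s n) ^+ 2)%:E.
  rewrite /E; case: ifPn => [sn0|]; first by rewrite leb2_disc// mulr_ge0.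
  rewrite -leNgt => sn0; have -> : s n = 0 by apply/le_anti; rewrite sn0 s0.
  by rewrite measure0 !mulr0 expr0n mulr0.
(* each inscribed disc fills the proportion 81 pi / 400 > 1 / 4 of its box *)
have [N N4] : exists N, a / 4 <= \sum_(i < N) (pi * (9 / 20 * s i) ^+ 2).
  have := a0; rewrite le_eqVlt => /predU1P[<-|agt0].
    by exists 0%N; rewrite big_ord0 mul0r.
  have [||N h] := @nneseries_ltP (fun i => pi * (9 / 20 * s i) ^+ 2) (a / 4).
  - by move=> n; rewrite mulr_ge0 ?pi_ge0 ?sqr_ge0.
  - have -> : (\sum_(0 <= n <oo) (pi * (9 / 20 * s n) ^+ 2)%:E =
        \sum_(0 <= n <oo) ((pi * (81 / 400))%:E * (s n ^+ 2)%:E))%E.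
      by apply: eq_eseriesr => n _; rewrite -EFinM; congr EFin; field.
    rewrite nneseriesZl; last by move=> n _; rewrite lee_fin sqr_ge0.
    rewrite -(@leb2_bigcup_box c s)// -OE Oa -EFinM lte_fin.
    by have := pi_ge2 R; nra.
  - by exists N; exact: ltW.
set S := \sum_(i < N) _ in N4.
pose F := \big[setU/set0]_(i < N) E i.
have mF : measurable (F : set (mR * mR)) by apply: bigsetU_measurable => i _; exact: mE.
have FO : F `<=` O.
  rewrite OE /F => z; rewrite -bigcup_mkord => -[i _ Ei].
  by exists i => //; exact: EB.
have lF : leb2 F = S%:E.
  transitivity (\sum_(i < N) leb2 (E i))%E; first exact: measure_bigsetU.
  by under eq_bigr do rewrite lE; rewrite sumEFin.
pose O' := O `\` \big[setU/set0]_(i < N) D i.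
have oO' : open O'.
  rewrite /O' setDE; apply: openI => //; rewrite openC.
  rewrite -bigcup_mkord; apply: closed_bigcup => // i _; exact: closed_disc.
have O'a : (leb2 O' <= (a - S)%:E)%E.
  have -> : ((a - S)%:E = leb2 (O `\` F))%E.
    have -> : leb2 (O `\` F) = (leb2 O - leb2 (O `&` F))%E.
      by apply: measureD => //; rewrite -ge0_fin_numE ?measure_ge0.
    by rewrite (setIidr FO) lF Oa.
  apply: le_measure; rewrite ?inE//; [exact: open_measurable2|exact: measurableD|].
  apply: setDS; rewrite /F -!bigcup_mkord; apply: subset_bigcup => i _.
  by rewrite /E; case: ifP => _ //; exact: sub0set.
have [c' [r' [re' O'c sumr']]] := IH _ _ oO' O'a.
exists (fun n => if (n < N)%N then cc n else c' (n - N)%N).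
exists (fun n => if (n < N)%N then 9 / 20 * s n else r' (n - N)%N); split.
- move=> n; case: ifP => // _; have /andP[h1 h2] := se n.
  by apply/andP; split; lra.
- move=> z Oz; have [|nD] := pselect ((\big[setU/set0]_(i < N) D i) z).
    rewrite -bigcup_mkord => -[i /= iN Di]; exists i => //=.
    by rewrite iN.
  have [n _ dn] := O'c z (conj Oz nD); exists (n + N)%N => //=.
  by rewrite ltnNge leq_addl /= addnK.
- rewrite (nneseries_split 0 N); last first.
    by move=> k _; rewrite lee_fin mulr_ge0 ?pi_ge0 ?sqr_ge0.
  rewrite add0n -nneseries_addn; last first.
    by move=> k; rewrite lee_fin mulr_ge0 ?pi_ge0 ?sqr_ge0.
  have -> : (\sum_(0 <= i <oo) (pi * (if (i + N < N)%N then 9 / 20 * s (i + N)%N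
      else r' (i + N - N)%N) ^+ 2)%:E = \sum_(0 <= n <oo) (pi * r' n ^+ 2)%:E)%E.
    by apply: eq_eseriesr => n _; rewrite ltnNge leq_addl /= addnK.
  have -> : (\sum_(0 <= k < N) (pi * (if (k < N)%N then 9 / 20 * s k
      else r' (k - N)%N) ^+ 2)%:E = S%:E)%E.
    rewrite big_mkord sumEFin; congr EFin; apply: eq_bigr => i _.
    by rewrite ltn_ord.
  apply: (@le_trans _ _ (S%:E + (K * (a - S))%:E)%E); first exact: leeD2l.
  rewrite -EFinD lee_fin; nra.
Qed.

(** Iterating disc_cover_step from K = pi makes the waste factor tend to 1,
    since K - 1 is multiplied by 3 / 4 at each step. *)
Lemma disc_cover_open (O : set (R * R)) (e a eps : R) : open O -> 0 < e -> 0 < eps ->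
  (leb2 O <= a%:E)%E -> disc_cover O e (a + eps).
Proof.
move=> oO e0 eps0 Oa.
have pi1 : 1 <= pi :> R by have := pi_ge2 R; lra.
have IT n : forall O a, open O -> (leb2 O <= a%:E)%E ->
    disc_cover O e ((1 + (pi - 1) * (3 / 4) ^+ n) * a).
  elim: n => [|n IH] P b oP Pb.
    by rewrite expr0 mulr1 addrC subrK; exact: disc_cover_pi.
  have -> : 1 + (pi - 1) * (3 / 4) ^+ n.+1 =
      (3 * (1 + (pi - 1) * (3 / 4) ^+ n) + 1) / 4 :> R.
    by rewrite exprS; field.
  apply: disc_cover_step => //.
  by rewrite lerDl mulr_ge0// ?exprn_ge0 ?subr_ge0.
have a0 : 0 <= a by rewrite -lee_fin (le_trans _ Oa)// measure_ge0.
have [n hn] : exists n, (3 / 4) ^+ n < eps / ((pi - 1) * a + 1) :> R.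
  have q1 : `|3 / 4 : R| < 1 by rewrite ger0_norm; lra.
  have /cvgrPdist_lt /(_ (eps / ((pi - 1) * a + 1))) := cvg_expr q1.
  case=> [|n _ /(_ n (leqnn n)) /=].
    by rewrite divr_gt0// ltr_wpDl// mulr_ge0// subr_ge0.
  rewrite sub0r normrN ger0_norm ?exprn_ge0// => h.
  by exists n.
apply: disc_cover_le (IT n O a oO Oa).
rewrite mulrDl mul1r lerD2l mulrAC.
have h0 : 0 <= (pi - 1) * a by rewrite mulr_ge0// subr_ge0.
move: hn; rewrite ltr_pdivlMr; last by rewrite ltr_wpDl.
have : 0 <= (3 / 4 : R) ^+ n by rewrite exprn_ge0.
nra.
Qed.

End DiscCover.

(** * The 2-dimensional Hausdorff measure of an isometrically embedded plane *)

Section HausdorffPlane.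
Variable R : realType.
Local Notation mR := (measurableTypeR R).
Local Notation leb2 := (@lebesgue_measure R \x @lebesgue_measure R)%E.
Variable d : engel R -> engel R -> R.
Variables alpha beta : R.
Hypotheses (alpha0 : 0 < alpha) (beta0 : 0 < beta).
Variable iota : R * R -> engel R.
Hypothesis dE : forall z w, d (iota z) (iota w) =
  Num.sqrt (sqdist (alpha * z.1, beta * z.2) (alpha * w.1, beta * w.2)).

Lemma continuous_scale2 (a b : R) :
  continuous (fun z : R * R => (a * z.1, b * z.2)).
Proof.
move=> y.
have h1 : a * z.1 @[z --> y] --> a * y.1 by apply: cvgM; [exact: cvg_cst|exact: cvg_fst].
have h2 : b * z.2 @[z --> y] --> b * y.2 by apply: cvgM; [exact: cvg_cst|exact: cvg_snd].
exact: (cvg_pair h1 h2).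
Qed.

Lemma diam_ge0 S : (0 <= diam d S)%E.
Proof. by apply: ereal_sup_ubound; left. Qed.

Lemma diam_ub S x y : S x -> S y -> ((d x y)%:E <= diam d S)%E.
Proof. by move=> Sx Sy; apply: ereal_sup_ubound; right; exists (x, y). Qed.

Lemma sqdist_ge0 (z w : R * R) : 0 <= sqdist z w.
Proof. by rewrite /sqdist addr_ge0 ?sqr_ge0. Qed.

Lemma diam_le_closure (A : set (R * R)) D : diam_le A D -> diam_le (closure A) D.
Proof.
move=> dA.
have cl w : closed [set z | sqdist z w <= D ^+ 2].
  apply: (@closed_comp _ _ (fun z : R * R => sqdist z w) [set y | y <= D ^+ 2]).
    by move=> z _; exact: continuous_sqdist.
  exact: closed_le.
have sym (z w : R * R) : sqdist z w = sqdist w z by rewrite /sqdist; ring.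
have h1 z w : closure A z -> A w -> sqdist z w <= D ^+ 2.
  move=> Az Aw; have /closure_id E := cl w.
  have : closure A `<=` [set z | sqdist z w <= D ^+ 2].
    by rewrite E; apply: closure_subset => v Av; exact: dA.
  exact.
move=> z w Az Aw; have /closure_id E := cl z.
have : closure A `<=` [set w | sqdist w z <= D ^+ 2].
  by rewrite E; apply: closure_subset => v Av /=; rewrite sym; exact: h1.
by rewrite sym; apply.
Qed.

Lemma hausdorff_size2 (S : set (engel R)) (D : R) : S !=set0 -> diam d S = D%:E ->
  hausdorff_size d 2 S = (pi / 4 * D ^+ 2)%:E.
Proof.
move=> /set0P/negbTE S0 SD; rewrite /hausdorff_size S0 SD -EFin_expe -EFinM.
by congr EFin; rewrite /=; field.
Qed.

(** The isodiametric inequality, applied in isometric coordinates. A covering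
    set is arbitrary: taking the closure of its preimage gives a measurable set
    without increasing the diameter. *)
Lemma leb2_section_le (F : set (engel R)) : (diam d F < +oo)%E ->
  ((alpha * beta)%:E * leb2 (closure (iota @^-1` F)) <= hausdorff_size d 2 F)%E.
Proof.
move=> Foo.
have Ffin : diam d F \is a fin_num by rewrite ge0_fin_numE ?diam_ge0.
have [F0|/set0P Fn0] := eqVneq F set0.
  by rewrite F0 preimage_set0 closure0 measure0 mule0 /hausdorff_size eqxx.
set D := fine (diam d F); have FD : diam d F = D%:E by rewrite fineK.
have D0 : 0 <= D by rewrite fine_ge0// diam_ge0.
rewrite (hausdorff_size2 Fn0 FD).
set T := closure _.
have mT : measurable (T : set (mR * mR)).
  by apply: closed_measurable2; exact: closed_closure.
have ab0 : 0 < alpha * beta by rewrite mulr_gt0.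
pose sc := @affine2 R alpha^-1 0 beta^-1 0.
have scE z : sc z = (z.1 / alpha, z.2 / beta).
  by rewrite /sc /affine2 /affine1 !addr0 ![_^-1 * _]mulrC.
have -> : ((alpha * beta)%:E * leb2 T = leb2 (sc @^-1` T))%E.
  by rewrite leb2_affine ?invr_gt0// -invfM invrK.
apply: isodiametric => //.
  by rewrite -[X in measurable X]setTI; exact: measurable_affine2.
pose A := [set z : R * R | F (iota (z.1 / alpha, z.2 / beta))].
have dA : diam_le A D.
  move=> z w Az Aw; have := diam_ub Az Aw.
  rewrite FD lee_fin dE /= ![alpha * _]mulrC ![beta * _]mulrC !divfK ?gt_eqF//.
  rewrite -[_ <= D]ler_sqr ?nnegrE ?sqrtr_ge0// sqr_sqrtr ?sqdist_ge0//.
suff sub : sc @^-1` T `<=` closure A.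
  by move=> z w Tz Tw; apply: (diam_le_closure dA); exact: sub.
move=> z Tz B Bz.
have csc : continuous (fun z : R * R => (alpha * z.1, beta * z.2)).
  exact: continuous_scale2.
have zE : z = (alpha * (sc z).1, beta * (sc z).2).
  by rewrite scE /= ![alpha * _]mulrC ![beta * _]mulrC !divfK ?gt_eqF//; case: (z).
rewrite zE in Bz.
have [y [Fy By]] := Tz _ (csc (sc z) _ Bz).
exists (alpha * y.1, beta * y.2); split => //.
by rewrite /A /= ![alpha * _]mulrC ![beta * _]mulrC !mulfK ?gt_eqF//; case: (y) Fy.
Qed.

Lemma hausdorff_measure_plane_ge (S : set (R * R)) : measurable (S : set (mR * mR)) ->
  ((alpha * beta)%:E * leb2 S <= hausdorff_measure d 2 (iota @` S))%E.
Proof.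
move=> mS; have ab0 : 0 < alpha * beta by rewrite mulr_gt0.
apply: (@le_trans _ _ (ereal_inf [set (\sum_(0 <= n <oo) hausdorff_size d 2 (F n))%E |
      F in [set F : nat -> set (engel R) | iota @` S `<=` \bigcup_n F n /\
                                      forall n, (diam d (F n) <= 1%:E)%E]])); last first.
  by apply: ereal_sup_ubound; exists 1 => //=.
apply: le_ereal_inf_tmp => _ [F [SF Fd] <-].
pose T n := closure (iota @^-1` F n).
have mT n : measurable (T n : set (mR * mR)).
  by apply: closed_measurable2; exact: closed_closure.
apply: (@le_trans _ _ (\sum_(0 <= n <oo) ((alpha * beta)%:E * leb2 (T n)))%E).
  rewrite nneseriesZl; last by move=> n _; exact: measure_ge0.
  rewrite lee_pmul2l ?lte_fin//.
  apply: measure_sigma_subadditive => // z Sz.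
  have [n _ Fz] := SF _ (imageP iota Sz).
  by exists n => //; apply: subset_closure.
apply: lee_nneseries => [n _ _|n _].
  by rewrite mule_ge0 ?measure_ge0// lee_fin ltW.
apply: leb2_section_le.
by rewrite (le_lt_trans (Fd n))// ltry.
Qed.

(** A disc of radius r in the isometric coordinates pulls back to a set of
    diameter at most 2 r, hence of size at most pi r^2; covers of O by discs of
    nearly the same area give the bound. *)
Lemma hausdorff_measure_plane_le (S O : set (R * R)) (a : R) : open O -> S `<=` O ->
  (leb2 O <= a%:E)%E ->
  (hausdorff_measure d 2 (iota @` S) <= (alpha * beta * a)%:E)%E.
Proof.
move=> oO SO Oa; have ab0 : 0 < alpha * beta by rewrite mulr_gt0.
apply: ge_ereal_sup => _ [delta /= delta0 <-].
apply/lee_addgt0Pr => eps eps0.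
pose sc := @affine2 R alpha^-1 0 beta^-1 0.
have scE z : sc z = (alpha^-1 * z.1, beta^-1 * z.2).
  by rewrite /sc /affine2 /affine1 !addr0.
have oO' : open (sc @^-1` O).
  apply: open_comp => // z _.
  have -> : sc = (fun z => (alpha^-1 * z.1, beta^-1 * z.2)) by apply/funext => y; rewrite scE.
  exact: continuous_scale2.
have O'a : (leb2 (sc @^-1` O) <= (alpha * beta * a)%:E)%E.
  rewrite leb2_affine ?invr_gt0//; last exact: open_measurable2.
  by rewrite -invfM invrK (EFinM _ a) lee_pmul2l ?lte_fin.
have delta20 : 0 < delta / 2 by rewrite divr_gt0.
have [c [r [re cov sumr]]] := disc_cover_open oO' delta20 eps0 O'a.
pose F n : set (engel R) := iota @` [set z | disc (c n) (r n) (alpha * z.1, beta * z.2)].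
have r0 n : 0 <= r n by have /andP[] := re n.
have dF n : (diam d (F n) <= (2 * r n)%:E)%E.
  apply: ge_ereal_sup => t [->|]; first by rewrite lee_fin mulr_ge0.
  move=> [[x0 y0] [/= [z /= Dz <-] [w /= Dw <-]] <-]; rewrite lee_fin /= dE.
  have r20 : 0 <= 2 * r n by rewrite mulr_ge0.
  rewrite -[_ <= _ * _]ler_sqr ?nnegrE ?sqrtr_ge0// sqr_sqrtr ?sqdist_ge0//.
  move: Dz Dw; rewrite /disc /sqdist /=.
  set x := alpha * z.1; set y := beta * z.2; set u := alpha * w.1; set v := beta * w.2.
  move=> h1 h2.
  have := sqr_ge0 (x - (c n).1 + (u - (c n).1)).
  have := sqr_ge0 (y - (c n).2 + (v - (c n).2)).
  nra.
apply: (@le_trans _ _ (\sum_(0 <= n <oo) hausdorff_size d 2 (F n))%E).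
  apply: ereal_inf_lbound; exists F => //; split.
    move=> _ [z Sz <-].
    have [|n _ Dn] := cov (alpha * z.1, beta * z.2).
      rewrite /= scE /= !mulKf ?gt_eqF//.
      by apply: SO; case: (z) Sz.
    by exists n => //; exists z.
  move=> n; rewrite (le_trans (dF n))// lee_fin.
  by have /andP[_] := re n; lra.
rewrite -EFinD (le_trans _ sumr)//; apply: lee_nneseries => [n _ _|n _].
  by rewrite /hausdorff_size; case: ifP => // _; rewrite mule_ge0 ?expe_ge0 ?diam_ge0// lee_fin /= divr_ge0// ?mulr_ge0 ?pi_ge0.
have [F0|/set0P Fn0] := eqVneq (F n) set0.
  by rewrite F0 /hausdorff_size eqxx lee_fin mulr_ge0 ?pi_ge0 ?sqr_ge0.
have fD : diam d (F n) \is a fin_num.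
  by rewrite ge0_fin_numE ?diam_ge0// (le_lt_trans (dF n))// ltry.
rewrite (hausdorff_size2 Fn0 (esym (fineK fD))) lee_fin.
have := dF n; rewrite -{1}(fineK fD) lee_fin => le.
have D0 : 0 <= fine (diam d (F n)) by rewrite fine_ge0// diam_ge0.
rewrite -[leRHS](_ : pi / 4 * (2 * r n) ^+ 2 = _); last by field.
by rewrite ler_pM2l ?divr_gt0 ?pi_gt0// ler_sqr ?nnegrE// mulr_ge0.
Qed.

End HausdorffPlane.

(** * Coordinates on the Engel group *)

Section EngelAlgebra.
Variable R : realType.
Implicit Types x y z p : engel R.

(** Coordinates are numbered from 0 as in deg, so co k has degree 1, 1, 2, 3 for
    k = 0, 1, 2, 3. *)
Definition co (k : nat) x : R := x 0 (inord k).

Definition mk (a b c w : R) : engel R := \row_(i < 4) nth 0 [:: a; b; c; w] i.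

Lemma ord4P (i : 'I_4) : [\/ i = inord 0, i = inord 1, i = inord 2 | i = inord 3].
Proof.
case: i => [[|[|[|[|//]]]]] h.
- by constructor 1; apply: val_inj; rewrite /= inordK.
- by constructor 2; apply: val_inj; rewrite /= inordK.
- by constructor 3; apply: val_inj; rewrite /= inordK.
- by constructor 4; apply: val_inj; rewrite /= inordK.
Qed.

Lemma engelP x y : co 0 x = co 0 y -> co 1 x = co 1 y -> co 2 x = co 2 y ->
  co 3 x = co 3 y -> x = y.
Proof. by move=> ? ? ? ?; apply/rowP => i; case: (ord4P i) => ->. Qed.

Lemma co0_mk a b c w : co 0 (mk a b c w) = a. Proof. by rewrite /co mxE inordK. Qed.
Lemma co1_mk a b c w : co 1 (mk a b c w) = b. Proof. by rewrite /co mxE inordK. Qed.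
Lemma co2_mk a b c w : co 2 (mk a b c w) = c. Proof. by rewrite /co mxE inordK. Qed.
Lemma co3_mk a b c w : co 3 (mk a b c w) = w. Proof. by rewrite /co mxE inordK. Qed.
Definition co_mk := (co0_mk, co1_mk, co2_mk, co3_mk).

Lemma co_case (P : R -> Prop) x : P (co 0 x) -> P (co 1 x) -> P (co 2 x) ->
  P (co 3 x) -> forall k, P (co k x).
Proof.
by move=> ? ? ? ? k; rewrite /co; case: (ord4P (inord k)) => ->.
Qed.

Lemma coD k x y : co k (x + y) = co k x + co k y. Proof. by rewrite /co mxE. Qed.
Lemma coN k x : co k (- x) = - co k x. Proof. by rewrite /co mxE. Qed.
Lemma coZ k a x : co k (a *: x) = a * co k x. Proof. by rewrite /co mxE. Qed.
Lemma co0 k : co k 0 = 0. Proof. by rewrite /co mxE. Qed.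

Lemma bracketE x y : bracket x y =
  mk 0 0 (co 0 x * co 1 y - co 1 x * co 0 y) (co 0 x * co 2 y - co 2 x * co 0 y).
Proof. by apply/rowP => i; rewrite !mxE. Qed.

Lemma emulE x y : emul x y =
  mk (co 0 x + co 0 y) (co 1 x + co 1 y)
     (co 2 x + co 2 y + (co 0 x * co 1 y - co 1 x * co 0 y) / 2)
     (co 3 x + co 3 y + (co 0 x * co 2 y - co 2 x * co 0 y) / 2
      + (co 0 x - co 0 y) * (co 0 x * co 1 y - co 1 x * co 0 y) / 12).
Proof.
by apply: engelP; rewrite /emul !bracketE !(coD, coZ, co_mk); field.
Qed.

Lemma dilationE r x : dilation r x =
  mk (r * co 0 x) (r * co 1 x) (r ^+ 2 * co 2 x) (r ^+ 3 * co 3 x).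
Proof.
by apply: engelP; rewrite co_mk {1}/co mxE /deg inordK.
Qed.

Lemma emulA x y z : emul x (emul y z) = emul (emul x y) z.
Proof. by apply: engelP; rewrite !emulE !co_mk; field. Qed.

Lemma emulNx x : emul (- x) x = 0.
Proof. by apply: engelP; rewrite !emulE !co_mk !coN !co0; field. Qed.

Lemma emulxN x : emul x (- x) = 0.
Proof. by apply: engelP; rewrite !emulE !co_mk !coN !co0; field. Qed.

Lemma emul0x x : emul 0 x = x.
Proof. by apply: engelP; rewrite !emulE !co_mk !co0; field. Qed.

Lemma emulx0 x : emul x 0 = x.
Proof. by apply: engelP; rewrite !emulE !co_mk !co0; field. Qed.

Lemma dilation_comp r s x : dilation r (dilation s x) = dilation (r * s) x.
Proof. by apply: engelP; rewrite !dilationE !co_mk; ring. Qed.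

Lemma dilation1 x : dilation 1 x = x.
Proof. by apply: engelP; rewrite !dilationE !co_mk; ring. Qed.

Lemma dilation0 r : dilation r 0 = 0 :> engel R.
Proof. by apply: engelP; rewrite !dilationE !co_mk co0; ring. Qed.

Lemma dilation0x x : dilation 0 x = 0.
Proof. by apply: engelP; rewrite !dilationE !co_mk co0; ring. Qed.

Lemma norm_le x C : 0 <= C -> (forall k, `|co k x| <= C) -> `|x| <= C.
Proof.
move=> C0 h; rewrite [`|x|]mx_normrE; apply: bigmax_le => // -[i j] _ /=.
rewrite (ord1 i); have := h j; rewrite /co.
by have -> : inord j = j by rewrite inord_val.
Qed.

Lemma co_norm k x : `|co k x| <= `|x|.
Proof.
rewrite [`|x|]mx_normrE /co.
exact: (le_bigmax _ (fun i : 'I_1 * 'I_4 => `|x i.1 i.2|) (0, inord k)).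
Qed.

Lemma continuous_mk (T : topologicalType) (a b c w : T -> R) (t : T) :
  {for t, continuous a} -> {for t, continuous b} -> {for t, continuous c} ->
  {for t, continuous w} -> {for t, continuous (fun s => mk (a s) (b s) (c s) (w s))}.
Proof.
move=> ca cb cc cw; apply/cvgrPdist_le => e e0.
move/cvgrPdist_le/(_ e e0) : ca => ca; move/cvgrPdist_le/(_ e e0) : cb => cb.
move/cvgrPdist_le/(_ e e0) : cc => cc; move/cvgrPdist_le/(_ e e0) : cw => cw.
near=> s.
rewrite [`|_|]mx_normrE; apply: bigmax_le => [|[i j] _ /=]; first exact: ltW.
rewrite (ord1 i) !mxE; case: (ord4P j) => ->; rewrite inordK//=; near: s.
all: by [exact: ca|exact: cb|exact: cc|exact: cw].
Unshelve. all: by end_near. Qed.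

Lemma continuous_co k : continuous (co k).
Proof. exact: coord_continuous. Qed.

End EngelAlgebra.

(** * Homogeneous distances *)

Lemma continuous_pair1 (T U V : topologicalType) (f : T * U -> V) (u : T) :
 continuous f -> continuous (fun y => f (u, y)).
Proof.
move=> h y.
have h1 : (fun _ : U => u) @ y --> u by apply: cvg_cst.
exact: cvg_comp (cvg_pair h1 (@cvg_id _ (nbhs y))) (h (u, y)).
Qed.

Section HomogeneousDistance.
Variable R : realType.
Variable d : engel R -> engel R -> R.
Hypothesis hd : homogeneous_distance d.
Implicit Types x y z u p : engel R.

Lemma hdist_xx x : d x x = 0. Proof. by have [h _ _ _ _] := hd; apply/h. Qed.

Lemma hdist_sym x y : d x y = d y x. Proof. by have [_ h _ _ _] := hd. Qed.

Lemma hdist_triangle y x z : d x z <= d x y + d y z.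
Proof. by have [_ _ h _ _] := hd. Qed.

Lemma hdist_ge0 x y : 0 <= d x y.
Proof. by have := hdist_triangle y x x; rewrite hdist_xx (hdist_sym y x); lra. Qed.

Lemma hdist_emul p x y : d (emul p x) (emul p y) = d x y.
Proof. by have [_ _ _ _ [h _]] := hd. Qed.

Lemma hdist_dilation r x y : 0 < r -> d (dilation r x) (dilation r y) = r * d x y.
Proof. by have [_ _ _ _ [_ h]] := hd; exact: h. Qed.

Lemma hdist_neq0 x : x != 0 -> 0 < d 0 x.
Proof.
move=> /eqP x0; rewrite lt_neqAle hdist_ge0 andbT; apply/eqP => /esym.
by have [h _ _ _ _] := hd; move=> /h/esym.
Qed.

Lemma hdist_left_quotient x y : d x y = d 0 (emul (- x) y).
Proof. by rewrite -(hdist_emul (- x)) emulNx. Qed.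

Lemma continuous_hdist u : continuous (d u).
Proof.
by have [_ _ _ h _] := hd; have h2 := @continuous_pair1 _ _ _ _ u h; exact: h2.
Qed.

(** Continuity of d at the unit element: smallness of the coordinates controls
    the distance. *)
Lemma hdist_small e : 0 < e -> exists2 delta, 0 < delta &
  forall x, (forall k, `|co k x| <= delta) -> d 0 x < e.
Proof.
move=> e0; have := @continuous_hdist 0 0; rewrite /continuous_at hdist_xx.
move=> /cvgrPdist_lt/(_ e e0) /nbhs_ballP[delta /= delta0 h].
exists (delta / 2); first by rewrite divr_gt0.
move=> x xd; have x2 : `|x| <= delta / 2 by apply: norm_le => //; rewrite ltW// divr_gt0.
have /h /= : ball (0 : engel R) delta x.
  by rewrite mx_norm_ball /ball_ /= sub0r normrN (le_lt_trans x2)//; lra.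
by rewrite sub0r normrN ger0_norm ?hdist_ge0.
Qed.

(** On the Euclidean unit sphere d 0 has a positive minimum m. A point outside
    the unit ball is brought back to the sphere by some dilation with factor
    t <= 1, so its distance to 0 is at least m; hence the ball of radius m / 2
    is bounded, and so is the unit ball by homogeneity. *)
Lemma hdist_bounded : exists2 C, 0 < C & forall x, d 0 x <= 1 -> forall k, `|co k x| <= C.
Proof.
pose S := [set x : engel R | `|x| = 1].
have cS : compact S.
  apply: bounded_closed_compact.
    by exists 1; split=> // r r1 x /= ->; exact: ltW.
  apply: (@closed_comp _ _ (fun x : engel R => `|x|) [set y | y = 1]); last exact: closed_eq.
  by move=> x _; exact: norm_continuous.
have S0 : S !=set0.
  exists (mk 1 0 0 0); rewrite /S /=; apply/le_anti/andP; split.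
    by apply: norm_le => //; apply: (@co_case R (fun t => `|t| <= 1)); rewrite co_mk ?normr0 ?normr1.
  by have := co_norm 0 (mk 1 0 0 0 : engel R); rewrite co0_mk normr1.
have [|s0 Ss0 smin] := @EVT_min_rV R 4 (d 0) S S0 cS.
  exact/continuous_subspaceT/continuous_hdist.
rewrite inE /S /= in Ss0; set m := d 0 s0.
have m0 : 0 < m.
  by apply: hdist_neq0; apply/eqP => s00; move: Ss0; rewrite s00 normr0 => /esym/eqP; rewrite oner_eq0.
have key x : d 0 x <= m / 2 -> `|x| <= 1.
  move=> dx; rewrite leNgt; apply/negP => x1.
  pose f t : R := `|dilation t x|.
  have cf : continuous f.
    move=> t; apply: (@continuous_comp _ _ _ (fun t => dilation t x) (fun y => `|y|)); last exact: norm_continuous.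
    have -> : (fun t : R => dilation t x) = (fun t => mk (t * co 0 x) (t * co 1 x) (t ^+ 2 * co 2 x) (t ^+ 3 * co 3 x)).
      by apply/funext => s; rewrite dilationE.
    apply: continuous_mk.
    + by apply: cvgM; [exact: cvg_id|exact: cvg_cst].
    + by apply: cvgM; [exact: cvg_id|exact: cvg_cst].
    + by apply: cvgM; [exact: exprn_continuous|exact: cvg_cst].
    + by apply: cvgM; [exact: exprn_continuous|exact: cvg_cst].
  have [||t] := @IVT R f 0 1 1 ler01.
  - exact: continuous_subspaceT.
  - rewrite /f dilation0x dilation1 normr0 ge_min le_max ler01 (ltW x1) orbT//.
  rewrite in_itv /= => /andP[t0 t1] ft.
  have t0' : 0 < t.
    rewrite lt_neqAle t0 andbT; apply/eqP => t00.
    by move: ft; rewrite /f -t00 dilation0x normr0 => /esym/eqP; rewrite oner_eq0.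
  have : m <= d 0 (dilation t x) by apply: smin; rewrite inE.
  rewrite -{1}(dilation0 t) hdist_dilation//; have := hdist_ge0 0 x; nra.
pose C := Num.max (2 / m) ((2 / m) ^+ 3) + (2 / m) ^+ 2.
have q0 : 0 < 2 / m by rewrite divr_gt0.
have C0 : 0 < C by rewrite /C ltr_pwDr ?exprn_gt0// le_max ltW.
exists C => // x dx.
have : `|dilation (m / 2) x| <= 1.
  apply: key; rewrite -{1}(dilation0 (m / 2)) hdist_dilation ?divr_gt0//.
  by rewrite ler_piMr// ltW// divr_gt0.
move=> nx; have nk k := le_trans (co_norm k _) nx.
have mi : 2 / m = (m / 2)^-1 by rewrite invf_div.
have m20 : 0 < m / 2 by rewrite divr_gt0.
have aux n a : `|(m / 2) ^+ n * a| <= 1 -> `|a| <= (2 / m) ^+ n.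
  rewrite normrM gtr0_norm ?exprn_gt0// => h.
  by rewrite mi exprVn -[leRHS]mul1r ler_pdivlMr ?exprn_gt0// mulrC.
have q1 : 0 < (2 / m) ^+ 2 by rewrite exprn_gt0.
have [qa qb] : 2 / m <= Num.max (2 / m) ((2 / m) ^+ 3) /\
    (2 / m) ^+ 3 <= Num.max (2 / m) ((2 / m) ^+ 3).
  by rewrite !le_max !lexx orbT.
have C1 : (2 / m) ^+ 1 <= C by rewrite /C expr1; lra.
have C2 : (2 / m) ^+ 2 <= C by rewrite /C; lra.
have C3 : (2 / m) ^+ 3 <= C by rewrite /C; lra.
apply: (@co_case R (fun t => `|t| <= C)).
- by apply: le_trans C1; apply: aux; have := nk 0%N; rewrite dilationE co_mk expr1.
- by apply: le_trans C1; apply: aux; have := nk 1%N; rewrite dilationE co_mk expr1.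
- by apply: le_trans C2; apply: aux; have := nk 2%N; rewrite dilationE co_mk.
- by apply: le_trans C3; apply: aux; have := nk 3%N; rewrite dilationE co_mk.
Qed.

Lemma closed_cball_hdist x r : closed (cball d x r).
Proof.
apply: (@closed_comp _ _ (d x) [set y | y <= r]); last exact: closed_le.
by move=> y _; exact: continuous_hdist.
Qed.

(** The triangle inequality gives the upper bound. It is attained at x v^-1 and
    x v, with v on the one-parameter group of X_1: there the square of v is the
    dilation of v by 2. *)
Lemma diam_cball x r : 0 < r -> diam d (cball d x r) = (2 * r)%:E.
Proof.
move=> r0; apply/le_anti/andP; split.
  apply: ge_ereal_sup => t [->|].
    by rewrite lee_fin mulr_ge0// ltW.
  move=> [[y z] [/= xy xz] <-]; rewrite lee_fin /=.
  rewrite /cball /= in xy xz.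
  by have := hdist_triangle x y z; rewrite (hdist_sym y x); lra.
pose v := mk (r / d 0 (mk 1 0 0 0)) 0 0 0 : engel R.
have e0 : 0 < d 0 (mk 1 0 0 0).
  apply: hdist_neq0; apply/eqP => /(congr1 (@co R 0)); rewrite co0_mk co0 => /eqP.
  by rewrite oner_eq0.
have vE : v = dilation (r / d 0 (mk 1 0 0 0)) (mk 1 0 0 0).
  by apply: engelP; rewrite dilationE !co_mk; ring.
have dv : d 0 v = r.
  rewrite vE -{1}(dilation0 (r / d 0 (mk 1 0 0 0))) hdist_dilation ?divr_gt0//.
  by rewrite divfK ?gt_eqF.
have dNv : d 0 (- v) = r.
  by rewrite -dv hdist_sym hdist_left_quotient emulx0 opprK.
have dvv : d (- v) v = 2 * r.
  rewrite hdist_left_quotient opprK -dv.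
  have -> : emul v v = dilation 2 v.
    by apply: engelP; rewrite emulE dilationE !co_mk; field; rewrite ?gt_eqF.
  by rewrite -{1}(dilation0 2) hdist_dilation.
rewrite -dvv -(hdist_emul x); apply: ereal_sup_ubound; right.
exists (emul x (- v), emul x v) => //=; rewrite /cball /=.
by rewrite -{1 3}(emulx0 x) !hdist_emul dv dNv.
Qed.

End HomogeneousDistance.

(** * Differentials and local inversion in the plane *)

Section DiffEps.
Variables (R : realType) (V W : normedModType R).

(** The definition of differentiability with a little-o, in epsilon form. *)
Lemma is_diff_eps (f : V -> W) (df : {linear V -> W}) (x : V) : continuous df ->
  (forall e, 0 < e -> exists2 r, 0 < r &
     forall v, `|v| < r -> `|f (x + v) - f x - df v| <= e * `|v|) ->
  is_diff x f df.
Proof.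
move=> cdf h.
have E : f \o shift x = cst (f x) + df +o_ 0 id.
  apply/eqaddoP => e e0; have [r r0 hr] := h e e0.
  near=> v; rewrite /= !fctE /= opprD addrA [v + x]addrC; apply: hr.
  near: v; apply/nbhs_normP; exists r => // v /=.
  by rewrite sub0r normrN.
have dE := diff_unique cdf E.
split=> //; apply/diff_locallyP; rewrite dE; split => //.
Unshelve. all: by end_near. Qed.

Lemma differentiable_eps (f : V -> W) (x : V) : differentiable f x ->
  forall e, 0 < e -> exists2 r, 0 < r &
     forall v, `|v| < r -> `|f (x + v) - f x - 'd f x v| <= e * `|v|.
Proof.
move=> /diff_locallyP[_ /eqaddoP h] e e0.
have /nbhs_normP[r /= r0 hr] := h e e0.
exists r => // v vr.
have := hr v; rewrite /= sub0r normrN => /(_ vr).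
by rewrite /= !fctE /= opprD addrA [v + x]addrC.
Qed.

Lemma is_diffE (f df : V -> W) (x w : V) : is_diff x f df -> 'd f x w = df w.
Proof. by case=> _ ->. Qed.

Lemma is_diff_near_eq (f g : V -> W) (df : V -> W) (x : V) :
  (\forall y \near x, f y = g y) -> is_diff x f df -> is_diff x g df.
Proof.
move=> fg [dfx <-]; apply: is_diff_eps; first exact: diff_continuous.
move=> e e0; have [r r0 hr] := differentiable_eps dfx e0.
have /nbhs_normP[s /= s0 hs] := fg.
exists (Num.min r s); first by rewrite lt_min r0.
move=> v; rewrite lt_min => /andP[vr vs].
have E1 : f (x + v) = g (x + v) by apply: hs; rewrite /= opprD addrA subrr sub0r normrN.
have E2 : f x = g x by apply: hs; rewrite /= subrr normr0.
have := hr v vr; by rewrite E1 E2.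
Qed.

End DiffEps.

Lemma continuous_near_eq (T U : topologicalType) (f g : T -> U) (x : T) :
  (\forall y \near x, f y = g y) -> {for x, continuous g} -> {for x, continuous f}.
Proof.
move=> fg cg; have fgx : f x = g x by exact: nbhs_singleton fg.
rewrite /prop_for /continuous_at fgx; apply: cvg_trans cg.
by apply: near_eq_cvg; apply: filterS fg => y /esym.
Qed.

Section Plane.
Variable R : realType.
Implicit Types z w : R * R.

Lemma norm_pair_le z (c : R) : (`|z| <= c) = (`|z.1| <= c) && (`|z.2| <= c).
Proof. by case: z => x y; rewrite prod_normE /= ge_max. Qed.

Lemma norm_fst z : `|z.1| <= `|z|.
Proof. by have := lexx `|z|; rewrite norm_pair_le => /andP[]. Qed.

Lemma norm_snd z : `|z.2| <= `|z|.
Proof. by have := lexx `|z|; rewrite norm_pair_le => /andP[]. Qed.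

Lemma linear2E (W : lmodType R) (T : {linear (R * R)%type -> W}) w :
  T w = w.1 *: T (1, 0) + w.2 *: T (0, 1).
Proof.
rewrite -!linearZ -linearD; congr (T _); case: w => x y.
by congr pair; rewrite /= /GRing.scale /= ?mulr1 ?mulr0 ?addr0 ?add0r.
Qed.

Lemma linear2_norm_le (W : normedModType R) (T : {linear (R * R)%type -> W}) w :
  `|T w| <= (`|T (1, 0)| + `|T (0, 1)|) * `|w|.
Proof.
rewrite linear2E mulrDl (le_trans (ler_normD _ _))//.
by rewrite !normrZ lerD// mulrC ler_wpM2l// ?norm_fst ?norm_snd.
Qed.

Definition mat2 (a b c e : R) w : R * R := (a * w.1 + b * w.2, c * w.1 + e * w.2).

Fact mat2_is_linear a b c e : linear (mat2 a b c e).
Proof.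
move=> k x y; congr pair; rewrite /= /GRing.scale /=; ring.
Qed.

HB.instance Definition _ a b c e :=
  GRing.isLinear.Build R (R * R)%type (R * R)%type _ (mat2 a b c e) (mat2_is_linear a b c e).

Lemma continuous_mat2 a b c e : continuous (mat2 a b c e).
Proof.
move=> y.
have h (u v : R) : u * z.1 + v * z.2 @[z --> y] --> u * y.1 + v * y.2.
  by apply: cvgD; (apply: cvgM; [exact: cvg_cst|exact: cvg_fst || exact: cvg_snd]).
exact: cvg_pair (h a b) (h c e).
Qed.

Definition det2 (T : R * R -> R * R) : R :=
  (T (1, 0)).1 * (T (0, 1)).2 - (T (0, 1)).1 * (T (1, 0)).2.

(** Cramer's formula for the inverse of T. *)
Definition inv2 (T : R * R -> R * R) : R * R -> R * R :=
  mat2 ((T (0, 1)).2 / det2 T) (- (T (0, 1)).1 / det2 T)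
       (- (T (1, 0)).2 / det2 T) ((T (1, 0)).1 / det2 T).

Lemma linear2_fst (T : {linear (R * R)%type -> (R * R)%type}) w :
  (T w).1 = w.1 * (T (1, 0)).1 + w.2 * (T (0, 1)).1.
Proof. by have /(congr1 fst) := linear2E T w. Qed.

Lemma linear2_snd (T : {linear (R * R)%type -> (R * R)%type}) w :
  (T w).2 = w.1 * (T (1, 0)).2 + w.2 * (T (0, 1)).2.
Proof. by have /(congr1 snd) := linear2E T w. Qed.

Lemma inv2K (T : {linear (R * R)%type -> (R * R)%type}) : det2 T != 0 -> cancel T (inv2 T).
Proof.
move=> D0 w; rewrite /inv2 /mat2 (linear2_fst T w) (linear2_snd T w).
move: D0; rewrite /det2; move: (T (1, 0)) (T (0, 1)) => p q D0.
by case: w => x y /=; congr pair; field.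
Qed.

Lemma inv2KV (T : {linear (R * R)%type -> (R * R)%type}) : det2 T != 0 -> cancel (inv2 T) T.
Proof.
move=> D0 w; rewrite [LHS]surjective_pairing (linear2_fst T (inv2 T w)) (linear2_snd T (inv2 T w)) /inv2 /mat2.
move: D0; rewrite /det2; move: (T (1, 0)) (T (0, 1)) => p q D0.
by case: w => x y /=; congr pair; field.
Qed.

Lemma det2_neq0 (T : {linear (R * R)%type -> (R * R)%type}) : injective T -> det2 T != 0.
Proof.
move=> injT; apply/eqP => D0.
have T0 w : T w = 0 -> w = 0 by rewrite -[in RHS](linear0 T); exact: injT.
have f1 w := linear2_fst T w; have f2 w := linear2_snd T w.
case Ep : (T (1, 0)) D0 f1 f2 => [p1 p2]; case Eq : (T (0, 1)) => [q1 q2].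
rewrite /det2 Ep Eq /= => D0 f1 f2.
have /T0[_ p20] : T (q2, - p2) = 0.
  by rewrite [LHS]surjective_pairing f1 f2 /=; congr pair; move: D0; lra.
have /T0[_ p10] : T (q1, - p1) = 0.
  by rewrite [LHS]surjective_pairing f1 f2 /=; congr pair; move: D0; lra.
have /T0[/eqP] : T (1, 0) = 0 by rewrite Ep; congr pair; lra.
by rewrite oner_eq0.
Qed.

(** The one-variable mean value theorem along the segment from z' to z, which
    stays in the ball. *)
Lemma mvt_ball (f : R * R -> R) z0 (rho : R) :
  (forall z, `|z - z0| < rho -> differentiable f z) ->
  forall z z', `|z - z0| < rho -> `|z' - z0| < rho ->
  exists t, [/\ 0 <= t <= 1, `|z' + t *: (z - z') - z0| < rho &
    f z - f z' = 'd f (z' + t *: (z - z')) (z - z')].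
Proof.
move=> h z z' hz hz'.
pose gam (t : R) : R * R := z' + t *: (z - z').
have gin t : 0 <= t <= 1 -> `|gam t - z0| < rho.
  move=> /andP[t0 t1].
  have aux (a b c : R * R) : b + t *: (a - b) - c = (1 - t) *: (b - c) + t *: (a - c).
    by case: a b c => [? ?] [? ?] [? ?]; congr pair; rewrite /= /GRing.scale /=; ring.
  rewrite /gam aux.
  rewrite (le_lt_trans (ler_normD _ _))// !normrZ (ger0_norm t0) ger0_norm ?subr_ge0//.
  have : `|z' - z0| <= Num.max `|z' - z0| `|z - z0| by rewrite le_max lexx.
  have : `|z - z0| <= Num.max `|z' - z0| `|z - z0| by rewrite le_max lexx orbT.
  have : Num.max `|z' - z0| `|z - z0| < rho by rewrite gt_max hz hz'.
  nra.
have dgam (t : R) : is_diff t gam (fun s => s *: (z - z')).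
  apply: is_diff_eq.
  by apply/funext => s; congr pair; exact: add0r.
have dg (t : R) : 0 <= t <= 1 -> is_derive t (1 : R) (f \o gam) ('d f (gam t) (z - z')).
  move=> /gin/h df.
  have dfg : differentiable (f \o gam) t by exact: differentiable_comp.
  have := deriveE (1 : R) dfg; rewrite diff_comp//= diff_val scale1r => E.
  by rewrite -E; apply: derivableP; exact: diff_derivable.
have [||c] := @MVT R (f \o gam) (fun t => 'd f (gam t) (z - z')) 0 1 ltr01.
- by move=> t; rewrite in_itv /= => /andP[t0 t1]; apply: dg; rewrite !ltW.
- apply: derivable_within_continuous => t; rewrite in_itv /= => /dg [d _]; exact: d.
rewrite in_itv /= => /andP[c0 c1] E.
have {}E : f z - f z' = 'd f (gam c) (z - z').
  move: E; rewrite /gam /= scale1r scale0r addr0 subr0 mulr1 => <-.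
  by congr (f _ - _); rewrite addrC subrK.
by exists c; rewrite !ltW//; split=> //; apply: gin; rewrite !ltW.
Qed.

Lemma lip_of_diff (f : R * R -> R) z0 (rho K : R) :
  (forall z, `|z - z0| < rho -> differentiable f z /\ forall w, `|'d f z w| <= K * `|w|) ->
  forall z z', `|z - z0| < rho -> `|z' - z0| < rho -> `|f z - f z'| <= K * `|z - z'|.
Proof.
move=> h z z' hz hz'.
have [t [_ ht E]] := mvt_ball (fun z hz => (h z hz).1) hz hz'.
by rewrite E; exact: (h _ ht).2.
Qed.

End Plane.
Lemma is_diff_linear (R : realType) (V W : normedModType R) (f : {linear V -> W}) (x : V) :
  continuous f -> is_diff x f f.
Proof.
by move=> cf; split; [exact: linear_differentiable|exact: diff_lin].
Qed.

Section InverseFunction.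
Variable R : realType.
Implicit Types z w : R * R.

Lemma compact_box (z0 : R * R) (r : R) : compact [set z | `|z - z0| <= r].
Proof.
have -> : [set z : R * R | `|z - z0| <= r] =
    `[z0.1 - r, z0.1 + r]%classic `*` `[z0.2 - r, z0.2 + r]%classic.
  apply/seteqP; split=> z /=; rewrite norm_pair_le /= !in_itv /= !ler_norml.
    by move=> /andP[/andP[? ?] /andP[? ?]]; split; apply/andP; split; lra.
  by move=> [/andP[? ?] /andP[? ?]]; apply/andP; split; apply/andP; split; lra.
by apply: compact_setX; exact: segment_compact.
Qed.

(** The regularity required of the charts of a surface. *)
Definition C1on (W : normedModType R) (U : set (R * R)) (f : R * R -> W) :=
  (forall z, U z -> differentiable f z) /\
  (forall w z, U z -> {for z, continuous (fun z => 'd f z w)}).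

(** A solution of h z = y is a fixed point of Q z = z - L (h z - y), where L is the
    inverse of the differential at z0: the differential of Q vanishes at z0, so Q
    is a contraction near z0, uniformly in y. *)
Lemma inverse_function2 (U : set (R * R)) (h : R * R -> R * R) z0 :
  open U -> U z0 -> C1on U h -> injective ('d h z0) ->
  exists (W V : set (R * R)) (k : R * R -> R * R),
  [/\ [/\ open W, W z0 & W `<=` U], open V,
      (forall z, W z -> V (h z) /\ k (h z) = z),
      (forall y, V y -> W (k y) /\ h (k y) = y) &
      (forall y, V y -> det2 ('d h (k y)) != 0 /\ is_diff y k (inv2 ('d h (k y))))].
Proof.
move=> oU Uz0 [dh ch] inj0.
have D0 := det2_neq0 inj0.
have [L [cL LK KL]] : exists L : {linear (R * R)%type -> (R * R)%type},
    [/\ continuous L, cancel ('d h z0) L & cancel L ('d h z0)].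
  exists (inv2 ('d h z0)); split; [exact: continuous_mat2|exact: inv2K|exact: inv2KV].
have LB (x y : R * R) : L (x - y) = L x - L y by exact: linearB.
have L0 : L 0 = 0 by exact: linear0.
pose q (z : R * R) : R * R := z - L (h z).
have dq z : U z -> is_diff z q (fun w => w - L ('d h z w)).
  move=> Uz; have dhz := dh z Uz.
  have dLh : is_diff z (L \o h) (L \o 'd h z).
    have dL : is_diff (h z) L L by exact: is_diff_linear.
    exact: is_diff_comp.
  have -> : q = id - (L \o h) by [].
  exact: (is_diff_eq (is_diffB (is_diff_id z) dLh)).
(* near z0 the differential of q is small *)
have [rho rho0 hrho] : exists2 rho, 0 < rho & forall z, `|z - z0| < rho ->
    U z /\ forall w, `|w - L ('d h z w)| <= 2^-1 * `|w|.
  have cc w : L ('d h z w) @[z --> z0] --> w.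
    have cLh : {for z0, continuous (fun z => L ('d h z w))}.
      by apply: continuous_comp; [exact: ch|exact: cL].
    exact: (eq_ind _ (fun u : R * R => L ('d h z w) @[z --> z0] --> u) cLh _ (LK w)).
  have e4 : 0 < 4^-1 :> R by rewrite invr_gt0.
  have /cvgrPdist_lt /(_ _ e4) c1 := cc (1, 0).
  have /cvgrPdist_lt /(_ _ e4) c2 := cc (0, 1).
  have c3 : nbhs z0 U by exact: oU.
  have c4 : \forall z \near z0, [/\ U z,
      `|(1, 0) - L ('d h z (1, 0))| < 4^-1 &
      `|(0, 1) - L ('d h z (0, 1))| < 4^-1].
    by near=> z; split; near: z.
  have /nbhs_normP[rho /= rho0 hr] := c4.
  exists rho => // z zr; have := hr z; rewrite /= distrC => /(_ zr)[Uz].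
  move=> h1 h2; split=> // w.
  pose T : {linear (R * R)%type -> (R * R)%type} := idfun \- (L \o 'd h z).
  apply: (le_trans (linear2_norm_le T w)); rewrite ler_wpM2r// /T /=; lra.
have lipq z z' : `|z - z0| < rho -> `|z' - z0| < rho -> `|q z - q z'| <= 2^-1 * `|z - z'|.
  move=> hz hz'; rewrite norm_pair_le; apply/andP; split.
  - apply: (@lip_of_diff R (fst \o q) z0 rho) => // y /hrho[Uy hy].
    have dp : is_diff (q y) (@fst R R) fst by apply: is_diff_linear => ?; exact: cvg_fst.
    have dpq := is_diff_comp (dq _ Uy) dp.
    split; first exact: ex_diff.
    by move=> w; rewrite diff_val; exact: le_trans (norm_fst _) (hy w).
  - apply: (@lip_of_diff R (snd \o q) z0 rho) => // y /hrho[Uy hy].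
    have dp : is_diff (q y) (@snd R R) snd by apply: is_diff_linear => ?; exact: cvg_snd.
    have dpq := is_diff_comp (dq _ Uy) dp.
    split; first exact: ex_diff.
    by move=> w; rewrite diff_val; exact: le_trans (norm_snd _) (hy w).
pose B := [set z | `|z - z0| < rho / 2].
have Brho z : `|z - z0| <= rho / 2 -> `|z - z0| < rho by move=> h0; lra.
have oB : open B.
  rewrite (_ : B = ball z0 (rho / 2)); first exact: ball_open.
  by apply/seteqP; split => z; rewrite /B -ball_normE /= distrC.
have expand z z' : `|z - z0| < rho -> `|z' - z0| < rho ->
    `|z - z'| <= 2 * `|L (h z - h z')|.
  move=> hz hz'; have := lipq _ _ hz hz'.
  have -> : z - z' = (q z - q z') + L (h z - h z').
    by rewrite LB /q; case: (z) (z') (L (h z)) (L (h z')) => [? ?] [? ?] [? ?] [? ?];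
       congr pair; rewrite /=; ring.
  have := ler_normD (q z - q z') (L (h z - h z')); lra.
pose V := [set y : R * R | `|L (y - h z0)| < rho / 4].
have oV : open V.
  have -> : V = (fun y => `|L (y - h z0)|) @^-1` [set t | t < rho / 4] by [].
  have cn : continuous (fun y : R * R => `|L (y - h z0)|).
    move=> y; apply: cvg_norm.
    have cb : {for y, continuous (fun y : R * R => y - h z0)}.
      by apply: cvgB; [exact: cvg_id|exact: cvg_cst].
    exact: (continuous_comp cb (cL _)).
  by apply: open_comp => [y _|]; [exact: cn|exact: open_lt].
have surj y : V y -> exists z, B z /\ h z = y.
  move=> Vy; pose Q (z : R * R) : R * R := q z + L y.
  have Qin z : `|z - z0| <= rho / 2 -> `|Q z - z0| < rho / 2.
    move=> hz; have := lipq _ _ (Brho _ hz) (Brho z0 _); rewrite subrr normr0.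
    move=> /(_ (ltW (divr_gt0 rho0 (ltr0n _ 2)))) hq.
    have -> : Q z - z0 = (q z - q z0) + L (y - h z0).
      by rewrite LB /Q /q; case: (z) (z0) (L (h z)) (L (h z0)) (L y) => [? ?] [? ?] [? ?] [? ?] [? ?];
       congr pair; rewrite /=; ring.
    by have := ler_normD (q z - q z0) (L (y - h z0)); move: Vy; rewrite /V /=; lra.
  (* a point of the box moved least by the contraction Q is a fixed point,
     because Q moves Q z at most half as much as z *)
  have [|||z Kz zmin] := @compact_EVT_min _ R (fun z => `|z - Q z|) [set z | `|z - z0| <= rho / 2].
  - by exists z0; rewrite /= subrr normr0 ltW// divr_gt0.
  - exact: compact_box.
  - apply: continuous_in_subspaceT => z; rewrite inE /= => /Brho/hrho[Uz _].
    have dqz := dq _ Uz.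
    apply: (@continuous_comp _ _ _ (fun z => z - Q z) (fun t => `|t|)); last exact: norm_continuous.
    apply: cvgB; first exact: cvg_id.
    apply: cvgD; last exact: cvg_cst.
    exact: differentiable_continuous.
  rewrite inE /= in Kz.
  have Qz := Qin _ Kz.
  have := zmin (Q z); rewrite inE /= => /(_ (ltW Qz)) le1.
  have le2 := lipq _ _ (Brho _ Kz) (Brho _ (ltW Qz)).
  have E2 : Q z - Q (Q z) = q z - q (Q z) by rewrite /Q opprD addrACA subrr addr0.
  rewrite E2 in le1.
  have /eqP : `|z - Q z| = 0 by apply/le_anti; rewrite normr_ge0 andbT; lra.
  rewrite normr_eq0 subr_eq0 => /eqP zQ.
  exists z; split; first by rewrite /B /= {1}zQ.
  have : L (h z) = L y.
    by move: zQ; rewrite /Q /q -addrA => /eqP; rewrite -subr_eq0 opprD addrA subrr add0r oppr_eq0 addrC subr_eq0 => /eqP.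
  by move=> /(congr1 ('d h z0)); rewrite !KL.
pose k y := get [set z | B z /\ h z = y].
have kP y : V y -> B (k y) /\ h (k y) = y by move=> /surj; exact: getPex.
have ltBrho z : B z -> `|z - z0| < rho by move=> /ltW/Brho.
have Buniq z z' : B z -> B z' -> h z = h z' -> z = z'.
  move=> Bz Bz' hh; have := expand _ _ (ltBrho _ Bz) (ltBrho _ Bz').
  by rewrite hh subrr L0 normr0 mulr0 normr_le0 subr_eq0 => /eqP.
have hc z : U z -> {for z, continuous h}.
  by move=> Uz; apply: differentiable_continuous; exact: dh.
exists (B `&` h @^-1` V), V, k; split; [|exact: oV| | |].
- split.
  + rewrite openE => z [Bz Vz].
    have [Uz _] := hrho _ (ltBrho _ Bz).
    have n1 : nbhs z B by exact: oB.
    have n2 : nbhs z (h @^-1` V) by apply: (hc _ Uz); exact: oV.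
    exact: filterI n1 n2.
  + by split; rewrite /B /V /= ?subrr ?L0 normr0 divr_gt0.
  + by move=> z [Bz _]; have [] := hrho _ (ltBrho _ Bz).
- move=> z [Bz Vz]; split=> //; have [? ?] := kP _ Vz; exact: Buniq.
- by move=> y Vy; have [? hky] := kP _ Vy; split=> //; split => //=; rewrite hky.
- move=> y Vy; have [Bk hk] := kP _ Vy.
  have [Uk small] := hrho _ (ltBrho _ Bk).
  have injk : injective ('d h (k y)).
    move=> w w' ww; apply/eqP; rewrite -subr_eq0 -normr_le0.
    have := small (w - w'); rewrite linearB ww subrr L0 subr0.
    by have := normr_ge0 (w - w'); lra.
  have Dk := det2_neq0 injk; split => //.
  set S := inv2 ('d h (k y)).
  have [C [C0 LC]] : exists C, 0 < C /\ forall w, `|L w| <= C * `|w|.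
    exists (`|L (1, 0)| + `|L (0, 1)| + 1); split; first by rewrite ltr_wpDl ?addr_ge0.
    move=> w; rewrite (le_trans (linear2_norm_le _ _))// ler_wpM2r// ler_wpDr//.
  have [CS [CS0 SC]] : exists C, 0 < C /\ forall w, `|S w| <= C * `|w|.
    exists (`|S (1, 0)| + `|S (0, 1)| + 1); split; first by rewrite ltr_wpDl ?addr_ge0.
    move=> w; rewrite (le_trans (linear2_norm_le _ _))// ler_wpM2r// ler_wpDr//.
  have klip v : V (y + v) -> `|k (y + v) - k y| <= 2 * C * `|v|.
    move=> Vv; have [Bv hv] := kP _ Vv.
    have := expand _ _ (ltBrho _ Bv) (ltBrho _ Bk); rewrite hv hk addrAC subrr add0r.
    by move=> /le_trans; apply; rewrite -mulrA ler_pM2l ?LC.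
  apply: is_diff_eps; first exact: continuous_mat2.
  move=> e e0.
  pose e' := e / (2 * C * CS).
  have e'0 : 0 < e' by rewrite divr_gt0// !mulr_gt0.
  have [r r0 hr] := differentiable_eps (dh _ Uk) e'0.
  have /nbhs_normP[r1 /= r10 hr1] : nbhs y V by exact: oV.
  exists (Num.min r1 (r / (2 * C))); first by rewrite lt_min r10 divr_gt0// mulr_gt0.
  move=> v; rewrite lt_min => /andP[v1 v2].
  have Vv : V (y + v) by apply: hr1; rewrite /= opprD addrA subrr sub0r normrN.
  have kl := klip _ Vv; have [Bv hv] := kP _ Vv.
  set dx := k (y + v) - k y in kl.
  have dxr : `|dx| < r.
    by rewrite (le_lt_trans kl)// mulrC -ltr_pdivlMr// mulr_gt0.
  have E1 : k y + dx = k (y + v) by rewrite /dx addrC subrK.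
  have E2 : y + v - y = v by rewrite addrAC subrr add0r.
  have := hr _ dxr; rewrite E1 hv hk E2 => hh.
  have -> : dx - S v = - S (v - 'd h (k y) dx).
    have SB (a b : R * R) : S (a - b) = S a - S b by exact: linearB.
    have SK : S ('d h (k y) dx) = dx by exact: inv2K.
    by rewrite SB SK opprB.
  rewrite normrN (le_trans (SC _))//.
  have E : e * `|v| = CS * (e' * (2 * C * `|v|)).
    by rewrite /e'; field; rewrite !gt_eqF.
  rewrite E ler_pM2l// (le_trans hh)// ler_pM2l//.
Unshelve. all: by end_near. Qed.

End InverseFunction.

(** * Charts and tangent planes of a surface *)

Section Charts.
Variable R : realType.
Implicit Types (Sigma : set (engel R)) (U V : set (R * R)) (phi psi G : R * R -> engel R).

(** A linear map on the plane is determined by its values on the canonical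
    basis, so pointwise continuity of A implies joint continuity. *)
Lemma continuous_diff_app (W : normedModType R) (T : topologicalType)
  (A : T -> {linear (R * R)%type -> W}) (v : T -> R * R) (t : T) :
  (forall w, {for t, continuous (fun s => A s w)}) -> {for t, continuous v} ->
  {for t, continuous (fun s => A s (v s))}.
Proof.
move=> cA cv.
have -> : (fun s => A s (v s)) = (fun s => (v s).1 *: A s (1, 0) + (v s).2 *: A s (0, 1)).
  by apply/funext => s; rewrite [LHS]linear2E.
have c1 : {for t, continuous (fun s => (v s).1)}.
  by apply: (continuous_comp cv); exact: cvg_fst.
have c2 : {for t, continuous (fun s => (v s).2)}.
  by apply: (continuous_comp cv); exact: cvg_snd.
by apply: cvgD; apply: cvgZ => //; exact: cA.
Qed.

(** If H restricts to local coordinates on the surface near phi z0, then these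
    coordinates can be taken as the parameters of a new chart: compose phi with
    a local inverse of H \o phi. *)
Lemma reparam_chart Sigma U phi (H : engel R -> R * R) z0 :
  surface_chart Sigma U phi -> U z0 -> C1on U (H \o phi) ->
  injective ('d (H \o phi) z0) ->
  exists V G k, [/\ surface_chart Sigma V G, V (H (phi z0)), k (H (phi z0)) = z0,
    (forall y, V y -> H (G y) = y) &
    [/\ (forall y, V y -> U (k y) /\ G y = phi (k y)),
        (forall y, V y -> differentiable k y) &
        (forall y w, V y -> 'd G y w = 'd phi (k y) ('d k y w))]].
Proof.
move=> [oU dphi cphi injphi [phiI phiS phio]] Uz0 C1H inj0.
have [W [V [k [[oW Wz0 WU] oV Wh Vk dk]]]] := inverse_function2 oU Uz0 C1H inj0.
have [dH cH] := C1H.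
have Uk y : V y -> U (k y) by move=> /Vk[/WU].
have diffk y : V y -> differentiable k y by move=> /dk[_ d]; exact: ex_diff.
have diffG y : V y -> differentiable (phi \o k) y.
  by move=> Vy; apply: differentiable_comp; [exact: diffk|exact/dphi/Uk].
have dG y w : V y -> 'd (phi \o k) y w = 'd phi (k y) ('d k y w).
  move=> Vy; have E := diff_comp (diffk _ Vy) (dphi _ (Uk _ Vy)).
  exact: (congr1 (fun f => f w) E).
have dkE y w : V y -> 'd k y w = inv2 ('d (H \o phi) (k y)) w.
  by move=> /dk[_ d]; exact: is_diffE.
have ck y : V y -> {for y, continuous k} by move=> /diffk; exact: differentiable_continuous.
have nearV y : V y -> \forall y' \near y, V y' by move=> Vy; exact: oV.
have cdk w y : V y -> {for y, continuous (fun y => 'd k y w)}.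
  move=> Vy.
  have cT u : {for y, continuous (fun y => 'd (H \o phi) (k y) u)}.
    exact: (@continuous_comp _ _ _ k (fun z => 'd (H \o phi) z u) y (ck _ Vy) (cH u _ (Uk _ Vy))).
  have cT1 u : {for y, continuous (fun y => ('d (H \o phi) (k y) u).1)}.
    by apply: (continuous_comp (cT u)); exact: cvg_fst.
  have cT2 u : {for y, continuous (fun y => ('d (H \o phi) (k y) u).2)}.
    by apply: (continuous_comp (cT u)); exact: cvg_snd.
  have cD : {for y, continuous (fun y => (det2 ('d (H \o phi) (k y)))^-1)}.
    have [D0 _] := dk _ Vy.
    have cD0 : {for y, continuous (fun y => det2 ('d (H \o phi) (k y)))}.
      exact: (cvgB (cvgM (cT1 (1, 0)) (cT2 (0, 1))) (cvgM (cT1 (0, 1)) (cT2 (1, 0)))).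
    exact: cvgV D0 cD0.
  suff cE : {for y, continuous (fun y => inv2 ('d (H \o phi) (k y)) w)}.
    apply: continuous_near_eq cE.
    by apply: filterS (nearV _ Vy) => y' Vy'; exact: dkE.
  rewrite /inv2 /mat2.
  have h1 : {for y, continuous (fun y => ('d (H \o phi) (k y) (0, 1)).2 / det2 ('d (H \o phi) (k y)) * w.1
     + - ('d (H \o phi) (k y) (0, 1)).1 / det2 ('d (H \o phi) (k y)) * w.2)}.
    apply: cvgD; (apply: cvgM; last exact: cvg_cst); apply: cvgM => //; first exact: cT2.
    by apply: cvgN; exact: cT1.
  have h2 : {for y, continuous (fun y => - ('d (H \o phi) (k y) (1, 0)).2 / det2 ('d (H \o phi) (k y)) * w.1
     + ('d (H \o phi) (k y) (1, 0)).1 / det2 ('d (H \o phi) (k y)) * w.2)}.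
    apply: cvgD; (apply: cvgM; last exact: cvg_cst); apply: cvgM => //; last exact: cT1.
    by apply: cvgN; exact: cT2.
  exact: cvg_pair h1 h2.
have [VH kH] := Wh _ Wz0.
have injG y : V y -> injective ('d (phi \o k) y).
  move=> Vy w w' e.
  have e1 := eq_trans (esym (dG y w Vy)) (eq_trans e (dG y w' Vy)).
  have e2 := injphi _ (Uk _ Vy) _ _ e1.
  have e3 := eq_trans (esym (dkE y w Vy)) (eq_trans e2 (dkE y w' Vy)).
  by have [D0 _] := dk _ Vy; exact: (can_inj (inv2KV D0)) e3.
have cG w y : V y -> {for y, continuous (fun y => 'd (phi \o k) y w)}.
  move=> Vy.
  suff cE : {for y, continuous (fun y => 'd phi (k y) ('d k y w))}.
    apply: continuous_near_eq cE.
    by apply: filterS (nearV _ Vy) => y' Vy'; exact: dG.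
  apply: (@continuous_diff_app (engel R) _ (fun y => 'd phi (k y)) (fun y => 'd k y w)).
    by move=> u; exact: (@continuous_comp _ _ _ k (fun z => 'd phi z u) y (ck _ Vy) (cphi u _ (Uk _ Vy))).
  exact: cdk.
exists V, (phi \o k), k; split; [|exact: VH|exact: kH| |]; last 2 first.
- by move=> y /Vk[].
- split; [|exact: diffk|exact: dG].
  by move=> y Vy; split; [exact: Uk|].
split; [exact: oV|exact: diffG|exact: cG|exact: injG|].
- split.
  + move=> y y' /set_mem Vy /set_mem Vy' e.
    by have [_ <-] := Vk _ Vy; have [_ <-] := Vk _ Vy'; rewrite /= in e *; rewrite e.
  + by move=> _ [y Vy <-]; apply: phiS; exists (k y) => //; exact: Uk.
  + move=> V' oV' V'V.
    have ok : open (W `&` (H \o phi) @^-1` V').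
      rewrite openE => z [Wz V'z].
      have n1 : nbhs z W by exact: oW.
      have n2 : nbhs z ((H \o phi) @^-1` V').
        by apply: (differentiable_continuous (dH _ (WU _ Wz))); exact: oV'.
      exact: filterI n1 n2.
    have [|O oO OE] := phio _ ok; first by move=> z [/WU].
    exists O => //; rewrite -OE; apply/seteqP; split.
      move=> _ [y V'y <-]; have [Wk hk] := Vk _ (V'V _ V'y).
      by exists (k y) => //; split => //=; rewrite /= in hk; rewrite hk.
    move=> _ [z [Wz V'z] <-]; exists (H (phi z)) => //=.
    by have [_ ->] := Wh _ Wz.
Unshelve. all: by end_near. Qed.

Definition pairco (i j : 'I_4) (x : engel R) : R * R := (x 0 i, x 0 j).

Fact pairco_is_linear i j : linear (pairco i j).
Proof. by move=> k x y; congr pair; rewrite !mxE. Qed.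

HB.instance Definition _ i j :=
  GRing.isLinear.Build R (engel R) (R * R)%type _ (pairco i j) (pairco_is_linear i j).

Lemma continuous_pairco i j : continuous (pairco i j).
Proof.
move=> x; have c k : {for x, continuous (fun y : engel R => y 0 k)} by exact: coord_continuous.
exact: cvg_pair (c i) (c j).
Qed.

Lemma is_diff_pairco i j phi z : differentiable phi z ->
  is_diff z (pairco i j \o phi) (pairco i j \o 'd phi z).
Proof.
move=> dz; have dP := is_diff_linear (phi z) (@continuous_pairco i j).
exact: is_diff_comp (differentiableP dz) dP.
Qed.

Lemma C1on_pairco i j U phi : open U -> C1on U phi -> C1on U (pairco i j \o phi).
Proof.
move=> oU [dphi cphi]; split=> [z Uz|w z Uz].
  by have d := is_diff_pairco i j (dphi _ Uz); exact: ex_diff.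
have nU : \forall z' \near z, U z' by exact: oU.
have cE : {for z, continuous (fun z' => pairco i j ('d phi z' w))}.
  exact: (@continuous_comp _ _ _ (fun z' => 'd phi z' w) (pairco i j) z
    (cphi w _ Uz) (@continuous_pairco i j _)).
apply: continuous_near_eq cE; apply: filterS nU => z' Uz'.
have d := is_diff_pairco i j (dphi _ Uz'); exact: (is_diffE w d).
Qed.

(** Some 2 x 2 minor of an injective linear map from the plane is nonzero. *)
Lemma injective_pairco (T : {linear (R * R)%type -> engel R}) : injective T ->
  exists i j, injective (pairco i j \o T).
Proof.
move=> injT.
have T0 w : T w = 0 -> w = 0 by move=> e; apply: injT; rewrite e linear0.
have TE w k : T w 0 k = w.1 * T (1, 0) 0 k + w.2 * T (0, 1) 0 k.
  by have /(congr1 (fun x : engel R => x 0 k)) := linear2E T w; rewrite !mxE.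
have [i Ti] : exists i, T (1, 0) 0 i != 0.
  apply: contrapT => /forallNP H.
  have /T0 [/eqP] : T (1, 0) = 0.
    by apply/rowP => k; rewrite mxE; have /negP/negPn/eqP := H k.
  by rewrite oner_eq0.
have [j Dj] : exists j, T (1, 0) 0 i * T (0, 1) 0 j - T (0, 1) 0 i * T (1, 0) 0 j != 0.
  apply: contrapT => /forallNP H.
  have /T0 [_ /eqP] : T (- T (0, 1) 0 i, T (1, 0) 0 i) = 0.
    apply/rowP => k; rewrite mxE TE /=.
    by have /negP/negPn/eqP := H k; lra.
  by rewrite (negbTE Ti).
exists i, j => w w' /= [e1 e2].
apply/eqP; rewrite -subr_eq0; apply/eqP.
set v := w - w'.
have v1 : T v 0 i = 0 by rewrite /v linearB !mxE e1 subrr.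
have v2 : T v 0 j = 0 by rewrite /v linearB !mxE e2 subrr.
rewrite TE in v1; rewrite TE in v2.
have z1 : v.1 = 0.
  apply: (mulIf Dj); rewrite mul0r.
  have : (v.1 * T (1, 0) 0 i + v.2 * T (0, 1) 0 i) * T (0, 1) 0 j
    - (v.1 * T (1, 0) 0 j + v.2 * T (0, 1) 0 j) * T (0, 1) 0 i = 0.
    by rewrite v1 v2 !mul0r subrr.
  by move=> h0; rewrite -[RHS]h0; ring.
have z2 : v.2 = 0.
  apply: (mulIf Dj); rewrite mul0r.
  have : (v.1 * T (1, 0) 0 j + v.2 * T (0, 1) 0 j) * T (1, 0) 0 i
    - (v.1 * T (1, 0) 0 i + v.2 * T (0, 1) 0 i) * T (1, 0) 0 j = 0.
    by rewrite v1 v2 !mul0r subrr.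
  by move=> h0; rewrite -[RHS]h0; ring.
by rewrite [v]surjective_pairing z1 z2.
Qed.

(** Two coordinates of the ambient space parametrize the surface near the point,
    by a chart G. Being open onto the surface, G reaches every nearby point of
    the second chart, so psi = G \o (H \o psi) near w, and the differential of
    psi factors through that of phi. *)
Lemma tangent_sub Sigma U phi z U' psi w v :
  surface_chart Sigma U phi -> U z -> surface_chart Sigma U' psi -> U' w ->
  phi z = psi w -> exists v', 'd psi w v = 'd phi z v'.
Proof.
move=> sphi Uz spsi U'w e.
have [oU dphi cphi injphi _] := sphi.
have [i [j inj0]] := injective_pairco (injphi _ Uz).
pose H := pairco i j.
have CH : C1on U (H \o phi) by apply: C1on_pairco => //; split.
have injH : injective ('d (H \o phi) z).
  have d := is_diff_pairco i j (dphi _ Uz).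
  move=> a b ab; apply: inj0.
  exact: eq_trans (esym (is_diffE a d)) (eq_trans ab (is_diffE b d)).
have [V [G [k [sG VH kH HG [VG dk dG]]]]] := reparam_chart sphi Uz CH injH.
have [oV dGV _ _ [_ _ Go]] := sG.
have [W oW GW] := Go V oV (@subset_refl _ V).
have [oU' dpsi _ _ [_ psiS _]] := spsi.
have dpw := dpsi _ U'w.
have Gz : G (H (phi z)) = phi z by have [_ ->] := VG _ VH; rewrite kH.
have Ww : W (psi w).
  have : (G @` V) (psi w) by exists (H (phi z)) => //; rewrite Gz.
  by rewrite GW => -[].
have nW : \forall y \near w, W (psi y).
  by apply: (differentiable_continuous dpw); exact: oW.
have nU' : \forall y \near w, U' y by exact: oU'.
have nE : \forall y \near w, (G \o (H \o psi)) y = psi y.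
  near=> y; have : (G @` V) (psi y).
    rewrite GW; split; last by near: y.
    by apply: psiS; exists y => //; near: y.
  move=> [x Vx Gx]; change (G (H (psi y)) = psi y).
  by rewrite -Gx; exact: (congr1 G (HG x Vx)).
have dHpsi := is_diff_pairco i j dpw.
have VHpsi : V ((H \o psi) w) by rewrite /= -e.
have dcomp := is_diff_comp dHpsi (differentiableP (dGV _ VHpsi)).
have dfin := is_diff_near_eq nE dcomp.
exists ('d k ((H \o psi) w) ((pairco i j \o 'd psi w) v)).
have E1 := is_diffE v dfin.
have E2 := dG _ ((pairco i j \o 'd psi w) v) VHpsi.
have kz : k ((H \o psi) w) = z by rewrite /= -e.
rewrite kz in E2; exact: eq_trans E1 E2.
Unshelve. all: by end_near. Qed.

Lemma tangentP Sigma U phi z v : surface_chart Sigma U phi -> U z ->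
  tangent Sigma (phi z) v <-> exists w, v = 'd phi z w.
Proof.
move=> sphi Uz; split=> [[U' [psi [w [u [spsi U'w e ->]]]]]|[w ->]].
  have [v' E] := tangent_sub u sphi Uz spsi U'w (esym e).
  by exists v'; exact: E.
by exists U, phi, z, w; split.
Qed.

Lemma wedge_linear (T : {linear (R * R)%type -> engel R}) a b :
  wedge (T a) (T b) = (a.1 * b.2 - a.2 * b.1) *: wedge (T (1, 0)) (T (0, 1)).
Proof.
have TE w k : T w 0 k = w.1 * T (1, 0) 0 k + w.2 * T (0, 1) 0 k.
  by have /(congr1 (fun x : engel R => x 0 k)) := linear2E T w; rewrite !mxE.
apply/matrixP => i j; rewrite !(mxE, big_ord_recl, big_ord0) /= !(TE a) !(TE b); ring.
Qed.

Lemma free2P (v w : engel R) :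
  free [:: v; w] <-> forall a b, a *: v + b *: w = 0 -> a = 0 /\ b = 0.
Proof.
split=> [/freeP h a b e|h].
  have := h (fun i => [:: a; b]`_i); rewrite !big_ord_recl big_ord0 /= addr0 => /(_ e) h2.
  by split; [exact: (h2 ord0)|exact: (h2 (lift ord0 ord0))].
apply/freeP => k; rewrite !big_ord_recl big_ord0 /= addr0 => /h[h1 h2] i.
case: i => [[|[|//]]] hi; [rewrite -h1|rewrite -h2]; congr (k _); exact: val_inj.
Qed.

(** The tangent 2-vector is chosen arbitrarily, but all choices lie on the line
    spanned by the wedge of the partial derivatives of any chart. *)
Lemma tau_chart Sigma U phi z : surface_chart Sigma U phi -> U z ->
  exists2 l, l != 0 & tau Sigma (phi z) = l *: wedge ('d phi z (1, 0)) ('d phi z (0, 1)).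
Proof.
move=> sphi Uz.
have [_ _ _ injphi _] := sphi; have inj0 := injphi _ Uz.
have fr : free [:: 'd phi z (1, 0); 'd phi z (0, 1)].
  apply/free2P => a b; rewrite -!linearZ -linearD => e.
  have := inj0 _ 0; rewrite linear0 => /(_ _ e)[].
  by rewrite /= /GRing.scale /= !mulr1 !mulr0 addr0 add0r.
have ne : tangent2s Sigma (phi z) (wedge ('d phi z (1, 0)) ('d phi z (0, 1))).
  exists ('d phi z (1, 0), 'd phi z (0, 1)) => //=; split => //.
  - by apply/(tangentP _ sphi Uz); exists (1, 0).
  - by apply/(tangentP _ sphi Uz); exists (0, 1).
have : tangent2s Sigma (phi z) (tau Sigma (phi z)) by exact: getPex (ex_intro _ _ ne).
move=> [[t1 t2] /= [/(tangentP _ sphi Uz)[a ->] /(tangentP _ sphi Uz)[b ->] f2] <-].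
exists (a.1 * b.2 - a.2 * b.1); last exact: wedge_linear.
apply/eqP => D0; move/free2P : f2 => f2.
have Lin c e : c *: 'd phi z a + e *: 'd phi z b = 'd phi z (c *: a + e *: b).
  by rewrite linearD !linearZ.
have h1 : b.2 = 0 /\ - a.2 = 0.
  apply: f2; rewrite Lin; rewrite -[RHS](linear0 ('d phi z)); congr ('d phi z _).
  by congr pair; rewrite /= /GRing.scale /=; move: D0; lra.
have h2 : b.1 = 0 /\ - a.1 = 0.
  apply: f2; rewrite Lin; rewrite -[RHS](linear0 ('d phi z)); congr ('d phi z _).
  by congr pair; rewrite /= /GRing.scale /=; move: D0; lra.
have := f2 1 1; rewrite Lin.
have -> : 1 *: a + 1 *: b = 0.
  by congr pair; rewrite /= /GRing.scale /=; case: h1 h2 => ? ? [? ?]; lra.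
by rewrite linear0 => /(_ erefl)[/eqP]; rewrite oner_eq0.
Qed.

End Charts.

(** * 2-vectors: degree, norm, annihilator *)

Section TwoVectors.
Variable R : realType.
Implicit Types (Y G A xi : 'M[R]_4) (v w : engel R).

Definition skew xi := xi^T = - xi.

Lemma skewE xi i j : skew xi -> xi j i = - xi i j.
Proof. by move=> /matrixP/(_ i j); rewrite !mxE. Qed.

Lemma wedgeE v w i j : wedge v w i j = v 0 i * w 0 j - w 0 i * v 0 j.
Proof. by rewrite !(mxE, big_ord_recl, big_ord0) !addr0. Qed.

Lemma skew_wedge v w : skew (wedge v w).
Proof. by rewrite /skew /wedge linearB /= !trmx_mul !trmxK opprB. Qed.

Lemma skewZ a xi : skew xi -> skew (a *: xi).
Proof. by rewrite /skew linearZ /= => ->; rewrite scalerN. Qed.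

Lemma skew_push2 A xi : skew xi -> skew (push2 A xi).
Proof.
by rewrite /skew /push2 !trmx_mul trmxK => ->; rewrite mulNmx mulmxN mulmxA.
Qed.

Lemma push2_wedge A v w : push2 A (wedge v w) = wedge (v *m A) (w *m A).
Proof.
by rewrite /push2 /wedge mulmxBr mulmxBl !trmx_mul !mulmxA.
Qed.

Lemma push2Z A a xi : push2 A (a *: xi) = a *: push2 A xi.
Proof. by rewrite /push2 -scalemxAr -scalemxAl. Qed.

(** The part of degree M in the basis X_i /\ X_j of the Lie algebra. *)
Definition mask (M : nat) xi : 'M[R]_4 :=
  \matrix_(i, j) if (deg i + deg j == M)%N then xi i j else 0.

(** A graded basis is block diagonal with respect to the degrees, so the
    degree-M part of a 2-vector is the same in all graded bases. *)
Lemma part2E Y M xi : graded_basis Y -> skew xi -> part2 Y M xi = mask M xi.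
Proof.
move=> [uY gY] sk; apply/matrixP => k l; rewrite mxE.
have wE i j : wedge (row i Y) (row j Y) k l = Y i k * Y j l - Y j k * Y i l.
  by rewrite !(mxE, big_ord_recl, big_ord0) !addr0.
have w0 i j : (deg i + deg j != deg k + deg l)%N -> wedge (row i Y) (row j Y) k l = 0.
  move=> dij; rewrite wE.
  have H a b c e : (deg a + deg b != deg c + deg e)%N -> Y a c * Y b e = 0.
    move=> h; have [ac|/gY ->] := eqVneq (deg a) (deg c); last by rewrite mul0r.
    by rewrite (gY b e) ?mulr0//; apply: contra h => /eqP ->; rewrite ac.
  by rewrite (H i j k l)// (H j i k l) ?subrr// (addnC (deg j)).
rewrite {2}(coef2E uY sk) /part2 !summxE.
case: ifPn => [/eqP dM|dM].
  apply: eq_bigr => i _; rewrite !summxE [RHS](bigID (fun j => (deg i + deg j == M)%N)) /=.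
  rewrite [X in _ = _ + X]big1 ?addr0// => j /andP[_ h].
  by rewrite mxE w0 ?mulr0// dM.
apply: big1 => i _; rewrite summxE big1// => j /andP[_ /eqP h].
by rewrite mxE w0 ?mulr0// h eq_sym.
Qed.

Lemma graded_invmx Y : graded_basis Y -> graded_basis (invmx Y).
Proof.
move=> [uY gY]; split; first by rewrite unitmx_inv.
pose D : 'M[R]_4 := diag_mx (\row_i (deg i)%:R).
have DY : D *m Y = Y *m D.
  apply/matrixP => i j; rewrite mul_diag_mx mul_mx_diag !mxE mulrC.
  by have [->//|/gY ->] := eqVneq (deg i) (deg j); rewrite !mul0r.
have DV : D *m invmx Y = invmx Y *m D.
  by rewrite -[LHS]mul1mx -(mulVmx uY) -!mulmxA (mulmxA Y) -DY -!mulmxA mulmxV// mulmx1.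
move=> i j dij; move/matrixP : DV => /(_ i j).
rewrite mul_diag_mx mul_mx_diag !mxE mulrC => /eqP.
rewrite -subr_eq0 -mulrBr mulf_eq0 => /orP[/eqP//|].
by rewrite subr_eq0 eqr_nat (negbTE dij).
Qed.

Lemma coef2_0 Y xi M i j : graded_basis Y ->
  (forall k l, (deg k + deg l == M)%N -> xi k l = 0) -> (deg i + deg j == M)%N ->
  coef2 Y xi i j = 0.
Proof.
move=> /graded_invmx[_ gY] h dij; rewrite /coef2 mxE big1// => l _.
have [dlj|/gY ->] := eqVneq (deg l) (deg j); last by rewrite mulr0.
rewrite mxE big1 ?mul0r// => k _; rewrite mxE.
have [dki|/gY ->] := eqVneq (deg k) (deg i); last by rewrite mul0r.
by rewrite h ?mulr0// dki dlj.
Qed.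

Lemma degree2_leP Y xi N : (degree2 Y xi <= N)%N <->
  (forall i j : 'I_4, (i < j)%N -> coef2 Y xi i j != 0 -> (deg i + deg j <= N)%N).
Proof.
rewrite /degree2; split=> [/bigmax_leqP h i j ij c|h].
  by have /bigmax_leqP := h i isT; apply; rewrite ij.
by apply/bigmax_leqP => i _; apply/bigmax_leqP => j /andP[ij c]; exact: h.
Qed.

Lemma degree2_entry0 Y xi N k l : graded_basis Y -> skew xi ->
  (degree2 Y xi <= N)%N -> (N < deg k + deg l)%N -> xi k l = 0.
Proof.
move=> gY sk /degree2_leP h kl.
have := part2E (deg k + deg l) gY sk => /matrixP/(_ k l); rewrite [RHS]mxE eqxx => <-.
rewrite /part2 summxE big1// => i _; rewrite summxE big1// => j /andP[ij /eqP dij].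
rewrite mxE; have [->|/(h i j ij)] := eqVneq (coef2 Y xi i j) 0; first by rewrite mul0r.
by rewrite dij leqNgt kl.
Qed.

Lemma degree2_neq0 Y xi N : graded_basis Y -> degree2 Y xi = N.+1 ->
  exists k l, (deg k + deg l == N.+1)%N /\ xi k l != 0.
Proof.
move=> gY dN; apply: contrapT => H.
have h k l : (deg k + deg l == N.+1)%N -> xi k l = 0.
  move=> kl; have [//|n0] := eqVneq (xi k l) 0.
  by exfalso; apply: H; exists k, l.
suff : (degree2 Y xi <= N)%N by rewrite dN ltnn.
apply/degree2_leP => i j ij c.
have : (deg i + deg j <= N.+1)%N.
  have : (degree2 Y xi <= N.+1)%N by rewrite dN.
  by move/degree2_leP; apply.
rewrite leq_eqVlt => /predU1P[dij|//].
by move: c; rewrite (coef2_0 gY h) ?dij ?eqxx.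
Qed.

Definition gram G v w : R := (v *m G *m w^T) 0 0.

Lemma sum_lt4 (F : 'I_4 -> 'I_4 -> R) :
  (forall i j, F i j = F j i) -> (forall i, F i i = 0) ->
  \sum_i \sum_j F i j = 2 * \sum_(i < 4) \sum_(j < 4 | (i < j)%N) F i j.
Proof.
move=> sF F0.
rewrite !(big_ord_recl, big_ord0) /= !(big_mkcond (fun j : 'I_4 => _ < j)%N) /=.
rewrite !(big_ord_recl, big_ord0) /= /bump /= !F0.
set a0 : 'I_4 := ord0; set a1 := lift _ _; set a2 := lift _ _; set a3 := lift _ _.
rewrite (sF a1 a0) (sF a2 a0) (sF a3 a0) (sF a2 a1) (sF a3 a1) (sF a3 a2); ring.
Qed.

(** Writing the norm as a trace turns its behaviour under linear maps into
    matrix algebra. *)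
Lemma norm2E G xi : skew xi ->
  norm2 G xi = Num.sqrt (2^-1 * \tr (xi *m G *m xi^T *m G^T)).
Proof.
move=> sk; rewrite /norm2; congr Num.sqrt.
pose f i j k l := xi i j * xi k l * (G i k * G j l - G i l * G j k).
have x0 i : xi i i = 0 by have := skewE i i sk; lra.
have E1 : \sum_i \sum_j \sum_k \sum_l f i j k l = 4 *
   \sum_(i < 4) \sum_(j < 4 | (i < j)%N) \sum_(k < 4) \sum_(l < 4 | (k < l)%N) f i j k l.
  rewrite (sum_lt4 (F := fun i j => \sum_k \sum_l f i j k l)).
  - have E4 : 4 = 2 * 2 :> R by rewrite -natrM.
    rewrite E4 -mulrA; congr (_ * _).
    rewrite mulr_sumr; apply: eq_bigr => i _; rewrite mulr_sumr; apply: eq_bigr => j _.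
    apply: sum_lt4 => [k l|k]; rewrite /f; last by rewrite x0; ring.
    by rewrite (skewE k l sk); ring.
  - move=> i j; apply: eq_bigr => k _; apply: eq_bigr => l _.
    by rewrite /f (skewE i j sk); ring.
  - by move=> i; apply: big1 => k _; apply: big1 => l _; rewrite /f x0; ring.
have E2 : \sum_i \sum_j \sum_k \sum_l f i j k l =
   2 * \sum_i \sum_j \sum_k \sum_l (xi i j * xi k l * (G i k * G j l)).
  have -> : \sum_i \sum_j \sum_k \sum_l f i j k l =
    \sum_i \sum_j \sum_k \sum_l (xi i j * xi k l * (G i k * G j l)) -
    \sum_i \sum_j \sum_k \sum_l (xi i j * xi k l * (G i l * G j k)).
    rewrite -sumrB; apply: eq_bigr => i _; rewrite -sumrB; apply: eq_bigr => j _.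
    rewrite -sumrB; apply: eq_bigr => k _; rewrite -sumrB; apply: eq_bigr => l _.
    by rewrite /f mulrBr.
  rewrite mulr_natl mulr2n; congr (_ + _); rewrite -sumrN; apply: eq_bigr => i _.
  rewrite -sumrN; apply: eq_bigr => j _; rewrite exchange_big /= -sumrN.
  apply: eq_bigr => k _; rewrite -sumrN; apply: eq_bigr => l _.
  by rewrite (skewE k l sk); ring.
have E3 : \tr (xi *m G *m xi^T *m G^T) =
   \sum_i \sum_j \sum_k \sum_l (xi i j * xi k l * (G i k * G j l)).
  rewrite /mxtrace; apply: eq_bigr => i _; rewrite mxE.
  transitivity (\sum_k \sum_l \sum_j (xi i j * xi k l * (G i k * G j l))).
    apply: eq_bigr => k _; rewrite mxE mulr_suml; apply: eq_bigr => l _.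
    rewrite mxE !mulr_suml; apply: eq_bigr => j _; rewrite !mxE; ring.
  rewrite [RHS]exchange_big /=; apply: eq_bigr => k _; exact: exchange_big.
by rewrite E3; move: E1; rewrite E2 /f; lra.
Qed.

Lemma norm2_push2 G A xi : skew xi ->
  norm2 G (push2 A xi) = norm2 (A *m G *m A^T) xi.
Proof.
move=> sk; rewrite !norm2E//; last exact: skew_push2.
congr (Num.sqrt (_ * _)); rewrite /push2 !trmx_mul !trmxK.
by rewrite -!mulmxA mxtrace_mulC !mulmxA.
Qed.

Lemma norm2Z G a xi : skew xi -> norm2 G (a *: xi) = `|a| * norm2 G xi.
Proof.
move=> sk; rewrite !norm2E//; last exact: skewZ.
have -> : (a *: xi) *m G *m (a *: xi)^T *m G^T = (a ^+ 2) *: (xi *m G *m xi^T *m G^T).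
  by rewrite linearZ /= -!scalemxAl -scalemxAr -!scalemxAl scalerA expr2.
rewrite mxtraceZ -sqrtr_sqr -sqrtrM ?sqr_ge0//; congr Num.sqrt; ring.
Qed.

Lemma gram_sym G v w : G^T = G -> gram G v w = gram G w v.
Proof.
move=> sG; rewrite /gram -[v *m G *m w^T]trmxK mxE.
by rewrite !trmx_mul trmxK sG mulmxA.
Qed.

Lemma gramDl G u v w : gram G (u + v) w = gram G u w + gram G v w.
Proof. by rewrite /gram !mulmxDl mxE. Qed.
Lemma gramDr G u v w : gram G w (u + v) = gram G w u + gram G w v.
Proof. by rewrite /gram linearD /= mulmxDr mxE. Qed.
Lemma gramZl G a v w : gram G (a *: v) w = a * gram G v w.
Proof. by rewrite /gram -!scalemxAl mxE. Qed.
Lemma gramZr G a v w : gram G w (a *: v) = a * gram G w v.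
Proof. by rewrite /gram linearZ /= -!scalemxAr mxE. Qed.

(** The Gram determinant. *)
Lemma norm2_wedge G v w : G^T = G ->
  norm2 G (wedge v w) = Num.sqrt (gram G v v * gram G w w - gram G v w ^+ 2).
Proof.
move=> sG; rewrite norm2E; last exact: skew_wedge.
congr Num.sqrt; rewrite /wedge linearB /= !trmx_mul !trmxK sG.
have T a b c e : \tr (a^T *m b *m G *m (c^T *m e) *m G) = gram G b c * gram G e a.
  have -> : a^T *m b *m G *m (c^T *m e) *m G = a^T *m ((b *m G *m c^T) *m (e *m G)).
    by rewrite !mulmxA.
  rewrite (mx11_scalar (b *m G *m c^T)) mul_scalar_mx -scalemxAr mxtraceZ.
  by rewrite mxtrace_mulC (mx11_scalar (e *m G *m a^T)) mxtrace_scalar mulr1n.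
have qB (A B C E : 'M[R]_4) : \tr ((A - B) *m G *m (C - E) *m G) =
    \tr (A *m G *m C *m G) - \tr (A *m G *m E *m G)
    - \tr (B *m G *m C *m G) + \tr (B *m G *m E *m G).
  rewrite !mulmxBl mulmxBr mulmxBr !mulmxBl.
  rewrite !raddfB /=; ring.
by rewrite qB !T (gram_sym w v sG); field.
Qed.

(** The strict Cauchy-Schwarz inequality: evaluate the positive form on the
    component of w orthogonal to v. *)
Lemma norm2_wedge_gt0 G v w : G^T = G ->
  (forall u : engel R, u != 0 -> 0 < gram G u u) ->
  (forall a b, a *: v + b *: w = 0 -> a = 0 /\ b = 0) ->
  0 < norm2 G (wedge v w).
Proof.
move=> sG pG f; rewrite norm2_wedge// sqrtr_gt0.
have v0 : v != 0.
  apply/eqP => v0; have := f 1 0; rewrite v0 scaler0 scale0r addr0 => /(_ erefl)[/eqP].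
  by rewrite oner_eq0.
have vv := pG _ v0.
pose u := w - (gram G v w / gram G v v) *: v.
have u0 : u != 0.
  apply/eqP => u0; have := f (- (gram G v w / gram G v v)) 1.
  by rewrite scale1r scaleNr addrC -/u u0 => /(_ erefl)[_ /eqP]; rewrite oner_eq0.
have := pG _ u0; rewrite /u -scaleNr !(gramDl, gramDr, gramZl, gramZr) (gram_sym w v sG).
set x := gram G v w; set y := gram G w w; move: vv; set z := gram G v v => vv.
have -> : y + - (x / z) * x + (- (x / z) * x + - (x / z) * (- (x / z) * z)) = (z * y - x ^+ 2) / z.
  by field; rewrite gt_eqF.
by rewrite pmulr_lgt0 ?invr_gt0.
Qed.

Definition e2 : engel R := mk 0 1 0 0.
Definition e3 : engel R := mk 0 0 1 0.

(** X is annihilated by the wedge of e2 and e3 exactly when it lies in their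
    span. *)
Lemma mem_annihilator c x : c != 0 ->
  x \in annihilator (c *: wedge e2 e3) <-> co 0 x = 0 /\ co 3 x = 0.
Proof.
move=> c0; rewrite /annihilator memv_ker lfunE /=.
have wE i j : (c *: wedge e2 e3) i j = c * (e2 0 i * e3 0 j - e2 0 j * e3 0 i).
  by rewrite mxE wedgeE (mulrC (e3 0 i)).
split=> [/eqP/ffunP h|[x0 x3]].
  split.
  - have := h (inord 0, inord 1, inord 2); rewrite !ffunE /= !wE -!/(co _ _) !co_mk.
    by rewrite !(mulr0, mul0r, mulr1, subr0, subrr, addr0) => /eqP; rewrite mulf_eq0 (negbTE c0) orbF => /eqP.
  - have := h (inord 3, inord 1, inord 2); rewrite !ffunE /= !wE -!/(co _ _) !co_mk.
    by rewrite !(mulr0, mul0r, mulr1, subr0, subrr, addr0) => /eqP; rewrite mulf_eq0 (negbTE c0) orbF => /eqP.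
apply/eqP/ffunP => t; rewrite !ffunE !wE.
have xE i : x 0 i = co 1 x * e2 0 i + co 2 x * e3 0 i.
  case: (ord4P i) => ->; rewrite -!/(co _ _) !co_mk ?x0 ?x3; ring.
by rewrite !xE; ring.
Qed.

Lemma dim_annihilator c : c != 0 -> \dim (annihilator (c *: wedge e2 e3)) = 2%N.
Proof.
move=> c0.
have -> : annihilator (c *: wedge e2 e3) = <<[:: e2; e3]>>%VS.
  apply/vspaceP => x; apply/idP/idP.
    move=> /(mem_annihilator _ c0)[x0 x3].
    have -> : x = co 1 x *: e2 + co 2 x *: e3.
      by apply: engelP; rewrite coD !coZ !co_mk ?x0 ?x3; ring.
    by apply: memvD; apply: memvZ; apply: memv_span; rewrite !inE eqxx ?orbT.
  apply: subvP; apply/span_subvP => y; rewrite !inE => /orP[]/eqP ->;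
    by apply/(mem_annihilator _ c0); rewrite !co_mk.
have : free [:: e2; e3].
  apply/freeP => k; rewrite !big_ord_recl big_ord0 /= addr0 => h.
  have h1 := congr1 (@co R 1) h; have h2 := congr1 (@co R 2) h.
  move: h1 h2; rewrite !coD !coZ !co_mk !co0 => h1 h2 i.
  case: i => [[|[|//]]] hi.
    by rewrite (_ : Ordinal hi = ord0); [lra|exact: val_inj].
  by rewrite (_ : Ordinal hi = lift ord0 ord0); [lra|exact: val_inj].
by move=> /eqP.
Qed.

End TwoVectors.

(** * The left invariant coframe and C1 functions *)

Section EngelCalculus.
Variable R : realType.

Fact co_is_linear k : linear (@co R k).
Proof. by move=> a x y; rewrite coD coZ. Qed.

HB.instance Definition _ k :=
  GRing.isLinear.Build R (engel R) R _ (@co R k) (co_is_linear k).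

Lemma is_diff_co k (x : engel R) : is_diff x (@co R k) (@co R k).
Proof. by apply: is_diff_linear; exact: continuous_co. Qed.

(** Differentiability into the group is checked coordinatewise. *)
Lemma is_diff_mk (V : normedModType R) (a b c w da db dc dw : V -> R) (z : V) :
  is_diff z a da -> is_diff z b db -> is_diff z c dc -> is_diff z w dw ->
  is_diff z (fun y => mk (a y) (b y) (c y) (w y)) (fun v => mk (da v) (db v) (dc v) (dw v)).
Proof.
move=> [ha <-] [hb <-] [hc <-] [hw <-].
pose D v : engel R := mk ('d a z v) ('d b z v) ('d c z v) ('d w z v).
have linD : linear D.
  by move=> k u v; apply: engelP; rewrite coD coZ /D !co_mk linearP.
pose DM := GRing.isLinear.Build _ _ _ _ D linD.
pose DL : {linear V -> engel R} := HB.pack D DM.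
have cD : continuous DL by move=> v; apply: continuous_mk; exact: diff_continuous.
apply: (@is_diff_eps _ _ _ _ DL) => // e e0.
have [ra ra0 hra] := differentiable_eps ha e0.
have [rb rb0 hrb] := differentiable_eps hb e0.
have [rc rc0 hrc] := differentiable_eps hc e0.
have [rw rw0 hrw] := differentiable_eps hw e0.
exists (Num.min (Num.min ra rb) (Num.min rc rw)).
  by rewrite !lt_min ra0 rb0 rc0.
move=> v; rewrite !lt_min => /andP[/andP[va vb] /andP[vc vw]].
apply: norm_le; first by rewrite mulr_ge0// ltW.
apply: (@co_case R (fun t => `|t| <= _)); rewrite !coD !coN /D !co_mk.
- exact: hra.
- exact: hrb.
- exact: hrc.
- exact: hrw.
Qed.

Lemma fct0E (T : Type) (V : nmodType) (x : T) : (0 : T -> V) x = 0.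
Proof. by []. Qed.

(** The differential at x of the left translation by p, applied to v. *)
Definition demul (p x v : engel R) : engel R :=
  mk (co 0 v) (co 1 v) (co 2 v + (co 0 p * co 1 v - co 1 p * co 0 v) / 2)
     (co 3 v + (co 0 p * co 2 v - co 2 p * co 0 v) / 2
      + ((co 0 p - co 0 x) * (co 0 p * co 1 v - co 1 p * co 0 v)
         - co 0 v * (co 0 p * co 1 x - co 1 p * co 0 x)) / 12).

Lemma is_diff_emul p x : is_diff x (emul p) (demul p x).
Proof.
have d0 := is_diff_co 0 x; have d1 := is_diff_co 1 x.
have d2 := is_diff_co 2 x; have d3 := is_diff_co 3 x.
have -> : emul p = (fun x => mk (co 0 p + co 0 x) (co 1 p + co 1 x)
     (co 2 p + co 2 x + (co 0 p * co 1 x - co 1 p * co 0 x) / 2)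
     (co 3 p + co 3 x + (co 0 p * co 2 x - co 2 p * co 0 x) / 2
      + (co 0 p - co 0 x) * (co 0 p * co 1 x - co 1 p * co 0 x) / 12)).
  by apply/funext => y; rewrite emulE.
apply: is_diff_mk.
- by apply: is_diff_eq; apply/funext => v; rewrite /= !fctE /= fct0E add0r.
- by apply: is_diff_eq; apply/funext => v; rewrite /= !fctE /= fct0E add0r.
- apply: is_diff_eq; apply/funext => v; rewrite /= !fctE /= !fct0E /GRing.scale /=. ring.
- apply: is_diff_eq; apply/funext => v; rewrite /= !fctE /= !fct0E /GRing.scale /=. ring.
Qed.

(** The left invariant coframe at x: the value at 0 of the left invariant field
    that takes the value v at x. *)
Definition theta (x v : engel R) : engel R :=
  mk (co 0 v) (co 1 v) (co 2 v - (co 0 x * co 1 v - co 1 x * co 0 v) / 2)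
     (co 3 v - (co 0 x * co 2 v - co 2 x * co 0 v) / 2
      + co 0 x * (co 0 x * co 1 v - co 1 x * co 0 v) / 6).

Lemma mulmx_dL (p q v : engel R) : v *m dL p q = demul p q v.
Proof. by rewrite /dL /jacobian mul_rV_lin1; have d := is_diff_emul p q; exact: is_diffE. Qed.

Lemma theta_dL (q v : engel R) : v *m dL (einv q) q = theta q v.
Proof.
by rewrite mulmx_dL /einv; apply: engelP; rewrite !co_mk ?coN; field.
Qed.

Lemma theta_demul (p x v : engel R) : theta (emul p x) (demul p x v) = theta x v.
Proof. by rewrite emulE; apply: engelP; rewrite /theta /demul !co_mk; field. Qed.

Lemma theta_linear x : linear (theta x).
Proof. by move=> a v w; apply: engelP; rewrite coD coZ !co_mk !coD !coZ; field. Qed.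

HB.instance Definition _ x :=
  GRing.isLinear.Build R (engel R) (engel R) _ (theta x) (theta_linear x).

Lemma theta_inj x : injective (theta x).
Proof.
move=> v w e.
have e0 := congr1 (@co R 0) e; have e1 := congr1 (@co R 1) e.
have e2 := congr1 (@co R 2) e; have e3 := congr1 (@co R 3) e.
move: e0 e1 e2 e3; rewrite /theta !co_mk => e0 e1; rewrite e0 e1 => e2.
have {}e2 : co 2 v = co 2 w by lra.
rewrite e2 => e3; have {}e3 : co 3 v = co 3 w by lra.
exact: engelP.
Qed.

Lemma left_trivialize_wedge (q v w : engel R) :
  left_trivialize q (wedge v w) = wedge (theta q v) (theta q w).
Proof. by rewrite /left_trivialize push2_wedge !theta_dL. Qed.

Lemma left_trivializeZ (q : engel R) a xi :
  left_trivialize q (a *: xi) = a *: left_trivialize q xi.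
Proof. exact: push2Z. Qed.

(** A left invariant metric gives a left invariant 2-vector field constant norm. *)
Lemma norm2_left_field (g : engel R -> 'M[R]_4) xi q : left_invariant g -> skew xi ->
  norm2 (g q) (left_field2 xi q) = norm2 (g 0) xi.
Proof.
move=> lg sk; rewrite /left_field2 norm2_push2//.
by have := lg q 0; rewrite emulx0 => ->.
Qed.

Section C1functions.
Variables (U : set (R * R)) (oU : open U).
Implicit Types f g : R * R -> R.

Lemma nearU z : U z -> \forall z' \near z, U z'.
Proof. by move=> Uz; exact: oU. Qed.

Lemma C1on_cst (c : R) : C1on U (cst c).
Proof.
split=> [z _|w z Uz]; first exact: differentiable_cst.
have cE : {for z, continuous (@cst (R * R) R 0)} by exact: cst_continuous.
apply: continuous_near_eq cE; apply: filterS (nearU Uz) => z' _.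
by have d := is_diff_cst c z'; exact: (is_diffE w d).
Qed.

Lemma C1on_eq (f g : R * R -> R) : (forall z, U z -> f z = g z) -> C1on U f -> C1on U g.
Proof.
move=> fg [df cf].
have d z : U z -> is_diff z g ('d f z).
  move=> Uz; apply: (@is_diff_near_eq _ _ _ f); last exact: (differentiableP (df _ Uz)).
  by apply: filterS (nearU Uz) => z'; exact: fg.
split=> [z Uz|w z Uz]; first by have h := d z Uz; exact: ex_diff.
apply: continuous_near_eq (cf w z Uz).
by apply: filterS (nearU Uz) => z' Uz'; exact: (is_diffE w (d z' Uz')).
Qed.

Lemma C1on_add f g : C1on U f -> C1on U g -> C1on U (fun z => f z + g z).
Proof.
move=> [df cf] [dg cg].
have d z : U z -> is_diff z (fun z => f z + g z) (fun w => 'd f z w + 'd g z w).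
  by move=> Uz; exact: (is_diffD (differentiableP (df _ Uz)) (differentiableP (dg _ Uz))).
split=> [z Uz|w z Uz]; first by have h := d z Uz; exact: ex_diff.
have cE : {for z, continuous (fun z' => 'd f z' w + 'd g z' w)}.
  exact: cvgD (cf w z Uz) (cg w z Uz).
apply: continuous_near_eq cE.
by apply: filterS (nearU Uz) => z' Uz'; exact: (is_diffE w (d z' Uz')).
Qed.

Lemma C1on_mul f g : C1on U f -> C1on U g -> C1on U (fun z => f z * g z).
Proof.
move=> [df cf] [dg cg].
have d z : U z -> is_diff z (fun z => f z * g z) (fun w => f z * 'd g z w + g z * 'd f z w).
  by move=> Uz; exact: (is_diffM (differentiableP (df _ Uz)) (differentiableP (dg _ Uz))).
split=> [z Uz|w z Uz]; first by have h := d z Uz; exact: ex_diff.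
have cf0 : {for z, continuous f} by exact: differentiable_continuous (df _ Uz).
have cg0 : {for z, continuous g} by exact: differentiable_continuous (dg _ Uz).
have cE : {for z, continuous (fun z' => f z' * 'd g z' w + g z' * 'd f z' w)}.
  exact: cvgD (cvgM cf0 (cg w z Uz)) (cvgM cg0 (cf w z Uz)).
apply: continuous_near_eq cE.
by apply: filterS (nearU Uz) => z' Uz'; exact: (is_diffE w (d z' Uz')).
Qed.

Lemma C1on_pair f g : C1on U f -> C1on U g -> C1on U (fun z => (f z, g z)).
Proof.
move=> [df cf] [dg cg].
have d z : U z -> is_diff z (fun z => (f z, g z)) (fun w => ('d f z w, 'd g z w)).
  by move=> Uz; exact: (is_diff_pair (differentiableP (df _ Uz)) (differentiableP (dg _ Uz))).
split=> [z Uz|w z Uz]; first by have h := d z Uz; exact: ex_diff.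
have cE : {for z, continuous (fun z' => ('d f z' w, 'd g z' w))}.
  exact: cvg_pair (cf w z Uz) (cg w z Uz).
apply: continuous_near_eq cE.
by apply: filterS (nearU Uz) => z' Uz'; exact: (is_diffE w (d z' Uz')).
Qed.

Lemma C1on_co k (phi : R * R -> engel R) : C1on U phi -> C1on U (fun z => co k (phi z)).
Proof.
move=> [dphi cphi].
have d z : U z -> is_diff z (fun z => co k (phi z)) (fun w => co k ('d phi z w)).
  by move=> Uz; exact: (is_diff_comp (differentiableP (dphi _ Uz)) (is_diff_co k (phi z))).
split=> [z Uz|w z Uz]; first by have h := d z Uz; exact: ex_diff.
have cE : {for z, continuous (fun z' => co k ('d phi z' w))}.
  exact: (@continuous_comp _ _ _ (fun z' => 'd phi z' w) (@co R k) z (cphi w z Uz) (@continuous_co R k _)).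
apply: continuous_near_eq cE.
by apply: filterS (nearU Uz) => z' Uz'; exact: (is_diffE w (d z' Uz')).
Qed.

End C1functions.

End EngelCalculus.

(** * Coordinates of the second kind *)

Section SecondKind.
Variable R : realType.
Variable p : engel R.

(** The coordinates (a, b, c, w) of the second kind, those for which
    x = exp (c X_3 + w X_4) exp (a X_1) exp (b X_2). They make the left invariant
    coframe equal to da, db, dc + b da, dw - a dc (thetaE). *)
Definition sk (k : nat) (x : engel R) : R :=
  nth 0 [:: co 0 x; co 1 x; co 2 x - co 0 x * co 1 x / 2;
    co 3 x + co 0 x * co 2 x / 2 - co 0 x ^+ 2 * co 1 x / 3] k.

Definition of_sk (a b c w : R) : engel R :=
  mk a b (c + a * b / 2) (w - a * c / 2 + a ^+ 2 * b / 12).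

Lemma of_skK x : of_sk (sk 0 x) (sk 1 x) (sk 2 x) (sk 3 x) = x.
Proof. by apply: engelP; rewrite !co_mk /sk /=; field. Qed.

Definition dsk (k : nat) (x v : engel R) : R :=
  nth 0 [:: co 0 v; co 1 v; co 2 v - (co 0 x * co 1 v + co 1 x * co 0 v) / 2;
    co 3 v + (co 0 x * co 2 v + co 2 x * co 0 v) / 2
    - (2 * co 0 x * co 1 x * co 0 v + co 0 x ^+ 2 * co 1 v) / 3] k.

Definition skcoord (k : nat) (phi : R * R -> engel R) (z : R * R) : R :=
  sk k (emul (- p) (phi z)).

Lemma is_diff_sk k x : (k < 4)%N -> is_diff x (sk k) (dsk k x).
Proof.
have d0 := is_diff_co 0 x; have d1 := is_diff_co 1 x.
have d2 := is_diff_co 2 x; have d3 := is_diff_co 3 x.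
case: k => [|[|[|[|//]]]] _; rewrite /sk /dsk /=.
- exact: d0.
- exact: d1.
- by apply: is_diff_eq; apply/funext => v; rewrite /= !fctE /= ?fct0E /GRing.scale /=; ring.
- by apply: is_diff_eq; apply/funext => v; rewrite /= !fctE /= ?fct0E /GRing.scale /=; field.
Qed.

Lemma is_diff_skcoord k (phi : R * R -> engel R) z : (k < 4)%N -> differentiable phi z ->
  is_diff z (skcoord k phi) (fun w => dsk k (emul (- p) (phi z)) (demul (- p) (phi z) ('d phi z w))).
Proof.
move=> k4 dz.
have h := is_diff_comp (is_diff_comp (differentiableP dz) (is_diff_emul (- p) (phi z)))
  (is_diff_sk (emul (- p) (phi z)) k4).
exact: h.
Qed.

Lemma thetaE (x v : engel R) : theta x v =
  mk (dsk 0 x v) (dsk 1 x v) (dsk 2 x v + sk 1 x * dsk 0 x v) (dsk 3 x v - sk 0 x * dsk 2 x v).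
Proof. by apply: engelP; rewrite !co_mk /dsk /sk /=; field. Qed.

Lemma theta_skcoord (phi : R * R -> engel R) z w : differentiable phi z ->
  theta (phi z) ('d phi z w) =
  mk ('d (skcoord 0 phi) z w) ('d (skcoord 1 phi) z w)
     ('d (skcoord 2 phi) z w + skcoord 1 phi z * 'd (skcoord 0 phi) z w)
     ('d (skcoord 3 phi) z w - skcoord 0 phi z * 'd (skcoord 2 phi) z w).
Proof.
move=> dz; have E k (k4 : (k < 4)%N) := esym (is_diffE w (is_diff_skcoord k4 dz)).
rewrite -(theta_demul (- p)) thetaE.
exact: (f_equal4 (@mk R) (E 0%N isT) (E 1%N isT)
  (f_equal2 +%R (E 2%N isT) (f_equal ( *%R (skcoord 1 phi z)) (E 0%N isT)))
  (f_equal2 (fun a b => a - skcoord 0 phi z * b) (E 3%N isT) (E 2%N isT))).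
Qed.

Lemma C1on_skcoord (U : set (R * R)) phi k : open U -> C1on U phi -> (k < 4)%N -> C1on U (skcoord k phi).
Proof.
move=> oU cphi; have c j := C1on_co oU j cphi.
have A := @C1on_add R U oU; have M := @C1on_mul R U oU; have K := @C1on_cst R U oU.
have X0 : C1on U (fun z => co 0 (emul (- p) (phi z))).
  apply: (@C1on_eq _ _ oU (fun z => co 0 (- p) + co 0 (phi z))).
    by move=> z _; rewrite emulE !co_mk.
  exact: A _ _ (K _) (c 0%N).
have X1 : C1on U (fun z => co 1 (emul (- p) (phi z))).
  apply: (@C1on_eq _ _ oU (fun z => co 1 (- p) + co 1 (phi z))).
    by move=> z _; rewrite emulE !co_mk.
  exact: A _ _ (K _) (c 1%N).
have X2 : C1on U (fun z => co 2 (emul (- p) (phi z))).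
  apply: (@C1on_eq _ _ oU (fun z => co 2 (- p) + co 2 (phi z) +
    (co 0 (- p) / 2 * co 1 (phi z) + (- co 1 (- p)) / 2 * co 0 (phi z)))).
    by move=> z _; rewrite emulE !co_mk; field.
  exact: (A _ _ (A _ _ (K _) (c 2%N)) (A _ _ (M _ _ (K _) (c 1%N)) (M _ _ (K _) (c 0%N)))).
have X3 : C1on U (fun z => co 3 (emul (- p) (phi z))).
  apply: (@C1on_eq _ _ oU (fun z => co 3 (- p) + co 3 (phi z) +
    (co 0 (- p) / 2 * co 2 (phi z) + (- co 2 (- p)) / 2 * co 0 (phi z)) +
    (co 0 (- p) / 12 + (- 12^-1) * co 0 (phi z)) *
    (co 0 (- p) * co 1 (phi z) + (- co 1 (- p)) * co 0 (phi z)))).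
    by move=> z _; rewrite emulE !co_mk; field.
  exact: (A _ _ (A _ _ (A _ _ (K _) (c 3%N)) (A _ _ (M _ _ (K _) (c 2%N)) (M _ _ (K _) (c 0%N))))
    (M _ _ (A _ _ (K _) (M _ _ (K _) (c 0%N))) (A _ _ (M _ _ (K _) (c 1%N)) (M _ _ (K _) (c 0%N))))).
case: k => [_|[_|[_|[_|k k4]]]]; last by exfalso; move: k4.
- exact: X0.
- exact: X1.
- apply: (@C1on_eq _ _ oU (fun z => co 2 (emul (- p) (phi z)) +
    (- 2^-1) * co 0 (emul (- p) (phi z)) * co 1 (emul (- p) (phi z)))).
    by move=> z _; rewrite /skcoord /sk /=; field.
  exact: (A _ _ X2 (M _ _ (M _ _ (K _) X0) X1)).
- apply: (@C1on_eq _ _ oU (fun z => co 3 (emul (- p) (phi z)) +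
    2^-1 * co 0 (emul (- p) (phi z)) * co 2 (emul (- p) (phi z)) +
    (- 3^-1) * co 0 (emul (- p) (phi z)) * co 0 (emul (- p) (phi z)) * co 1 (emul (- p) (phi z)))).
    by move=> z _; rewrite /skcoord /sk /=; field.
  exact: (A _ _ (A _ _ X3 (M _ _ (M _ _ (K _) X0) X2)) (M _ _ (M _ _ (M _ _ (K _) X0) X0) X1)).
Qed.

End SecondKind.

(** * The surface near a point of degree 3 *)

Section Structure.
Variable R : realType.
Variables (Y : 'M[R]_4) (gY : graded_basis Y).
Variable Sigma : set (engel R).
Hypothesis deg3 : forall q, Sigma q -> (point_degree Y Sigma q <= 3)%N.
Variable p : engel R.
Implicit Types phi G : R * R -> engel R.

Lemma xi_chart U phi z : surface_chart Sigma U phi -> U z ->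
  exists2 l, l != 0 & xi_ Sigma (phi z) =
    l *: wedge (theta (phi z) ('d phi z (1, 0))) (theta (phi z) ('d phi z (0, 1))).
Proof.
move=> sphi Uz; have [l l0 E] := tau_chart sphi Uz.
by exists l => //; rewrite /xi_ E left_trivializeZ left_trivialize_wedge.
Qed.

Lemma chart_in U phi z : surface_chart Sigma U phi -> U z -> Sigma (phi z).
Proof. by move=> [_ _ _ _ [_ sub _]] Uz; apply: sub; exists z. Qed.

(** All the 2-vectors X_i /\ X_4 have degree at least 4, so the tangent 2-vector
    has no component on them; being simple and nonzero, its plane lies in the
    kernel of the form dual to X_4. *)
Lemma contact U phi z w : surface_chart Sigma U phi -> U z ->
  co 3 (theta (phi z) ('d phi z w)) = 0.
Proof.
move=> sphi Uz.
have [l l0 E] := xi_chart sphi Uz.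
set t1 := theta (phi z) ('d phi z (1, 0)) in E.
set t2 := theta (phi z) ('d phi z (0, 1)) in E.
have sk : skew (xi_ Sigma (phi z)) by rewrite E; apply/skewZ/skew_wedge.
have z3 (k : 'I_4) : t1 0 k * co 3 t2 - t2 0 k * co 3 t1 = 0.
  have : xi_ Sigma (phi z) k (inord 3) = 0.
    apply: (degree2_entry0 gY sk (deg3 (chart_in sphi Uz))).
    rewrite {2}/deg inordK//= addnC; case: (ord4P k) => ->; rewrite /deg inordK//.
  rewrite E mxE wedgeE => /eqP; rewrite mulf_eq0 (negbTE l0) /= => /eqP.
  by rewrite /co.
have lin : co 3 t2 *: t1 - co 3 t1 *: t2 = 0.
  have gen (u v : engel R) (a b : R) :
      (forall k, u 0 k * b - v 0 k * a = 0) -> b *: u - a *: v = 0.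
    by move=> h'; apply/rowP => k; rewrite !mxE mulrC (mulrC a); exact: h'.
  exact: gen.
have inj : injective ('d phi z) by have [_ _ _ i _] := sphi; exact: i.
pose T : {linear (R * R)%type -> engel R} := theta (phi z) \o 'd phi z.
have L12 v : theta (phi z) ('d phi z v) = v.1 *: t1 + v.2 *: t2 := linear2E T v.
have T0 : theta (phi z) ('d phi z (co 3 t2, - co 3 t1)) = theta (phi z) ('d phi z 0).
  by rewrite (L12 (_, _)) (L12 0) /= scaleNr lin !scale0r addr0.
have e0 : (co 3 t2, - co 3 t1) = 0 := inj _ _ (theta_inj T0).
have [e1 e2'] : co 3 t2 = 0 /\ co 3 t1 = 0.
  by move: e0 => [-> /eqP]; rewrite oppr_eq0 => /eqP ->.
by rewrite (L12 w) coD !coZ e1 e2' !mulr0 addr0.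
Qed.

(** In coordinates of the second kind, contact says dw = a dc on the surface. *)
Lemma dS3 U phi z w : surface_chart Sigma U phi -> U z ->
  'd (skcoord p 3 phi) z w = skcoord p 0 phi z * 'd (skcoord p 2 phi) z w.
Proof.
move=> sphi Uz; have := contact w sphi Uz.
have [_ dphi _ _ _] := sphi.
by rewrite (theta_skcoord p w (dphi _ Uz)) co3_mk => /eqP; rewrite subr_eq0 => /eqP.
Qed.

(** The form x dy is not closed. As F is only differentiable, Stokes' formula on a
    square is replaced by the mean value theorem on its sides. *)
Lemma no_x_dy (F : R * R -> R) (y0 : R * R) (r : R) : 0 < r ->
  (forall y, `|y - y0| < r -> differentiable F y) ->
  (forall y w, `|y - y0| < r -> 'd F y w = y.1 * w.2) -> False.
Proof.
move=> r0 dF E; case: y0 dF E => a b dF E.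
have inb (s t : R) : `|s| <= r / 2 -> `|t| <= r / 2 -> `|(a + s, b + t) - (a, b)| < r.
  move=> hs ht; have : `|(a + s, b + t) - (a, b)| <= r / 2.
    rewrite norm_pair_le /=; have -> : a + s - a = s by ring.
    by have -> : b + t - b = t; [ring|rewrite hs ht].
  by move=> h; lra.
have z0 : `|0 : R| <= r / 2 by rewrite normr0 divr_ge0 ?ltW.
have h0 : `|r / 2| <= r / 2 by rewrite ger0_norm// divr_ge0 ?ltW.
(* F is constant along the horizontal sides of a square, and its variations along
   the two vertical sides are their different abscissae times the side *)
have key s t s' t' : `|s| <= r / 2 -> `|t| <= r / 2 -> `|s'| <= r / 2 -> `|t'| <= r / 2 ->
   exists2 u, 0 <= u <= 1 & F (a + s, b + t) - F (a + s', b + t') =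
    (a + s' + u * (s - s')) * (t - t').
  move=> hs ht hs' ht'.
  have [u [hu hin ->]] := mvt_ball dF (inb _ _ hs ht) (inb _ _ hs' ht').
  by exists u => //; rewrite (E _ _ hin) /= /GRing.scale /=; ring.
have [u1 _ e1] := key _ _ _ _ h0 h0 h0 z0.
have [u2 _ e2] := key _ _ _ _ h0 z0 z0 z0.
have [u3 _ e3] := key _ _ _ _ h0 h0 z0 h0.
have [u4 _ e4] := key _ _ _ _ z0 h0 z0 z0.
move: e1 e2 e3 e4; set F1 := F _; set F2 := F _; set F3 := F _; set F4 := F _.
move=> e1 e2 e3 e4.
have : (r / 2) * (r / 2) = 0 by move: e1 e2 e3 e4; lra.
by move/eqP; rewrite mulf_eq0 orbb => /eqP; lra.
Qed.

Definition wdet (i j : nat) phi (z : R * R) : R :=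
  'd (skcoord p i phi) z (1, 0) * 'd (skcoord p j phi) z (0, 1)
  - 'd (skcoord p i phi) z (0, 1) * 'd (skcoord p j phi) z (1, 0).

Lemma sk_chart U phi z0 i j : (i < 4)%N -> (j < 4)%N ->
  surface_chart Sigma U phi -> U z0 -> wdet i j phi z0 != 0 ->
  exists V G, [/\ surface_chart Sigma V G, V (skcoord p i phi z0, skcoord p j phi z0),
    G (skcoord p i phi z0, skcoord p j phi z0) = phi z0 &
    forall y, V y -> (skcoord p i G y, skcoord p j G y) = y].
Proof.
move=> i4 j4 sphi Uz0 w0.
have [oU dphi cphi _ _] := sphi.
have cphi1 : C1on U phi by split.
have Ci := C1on_skcoord p oU cphi1 i4; have Cj := C1on_skcoord p oU cphi1 j4.
pose H q : R * R := (sk i (emul (- p) q), sk j (emul (- p) q)).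
have CH : C1on U (H \o phi) := C1on_pair oU Ci Cj.
have dH w : 'd (H \o phi) z0 w = ('d (skcoord p i phi) z0 w, 'd (skcoord p j phi) z0 w).
  have d := is_diff_pair (differentiableP (Ci.1 _ Uz0)) (differentiableP (Cj.1 _ Uz0)).
  exact: (is_diffE w d).
have D0 : det2 ('d (H \o phi) z0) != 0.
  rewrite /det2; have E1 := dH (1, 0); have E2 := dH (0, 1).
  apply: contra w0 => /eqP D; apply/eqP; rewrite /wdet.
  by move: D; rewrite E1 E2.
have inj : injective ('d (H \o phi) z0) := can_inj (inv2K D0).
have [V [G [k [sG VH kH HG [VG _ _]]]]] := reparam_chart sphi Uz0 CH inj.
exists V, G; split; [exact: sG|exact: VH| |exact: HG].
by have [_ E] := VG _ VH; rewrite [LHS]E kH.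
Qed.

(** Otherwise a and c would be parameters of the surface, and dw = a dc would
    contradict no_x_dy. *)
Lemma wdet02 U phi z0 : surface_chart Sigma U phi -> U z0 -> wdet 0 2 phi z0 = 0.
Proof.
move=> sphi Uz0; have [//|w0] := eqVneq (wdet 0 2 phi z0) 0.
have [V [G [sG Vy0 Gy0 HG]]] := sk_chart (isT : (0 < 4)%N) (isT : (2 < 4)%N) sphi Uz0 w0.
exfalso; have [oV dG cG _ _] := sG.
have C1G : C1on V G by split.
have /nbhs_normP[r /= r0 hr] : nbhs (skcoord p 0 phi z0, skcoord p 2 phi z0) V by exact: oV.
have Vr (y : R * R) : `|y - (skcoord p 0 phi z0, skcoord p 2 phi z0)| < r -> V y.
  by move=> h; apply: hr; rewrite /= distrC.
have C3 := C1on_skcoord p oV C1G (isT : (3 < 4)%N).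
apply: (@no_x_dy (skcoord p 3 G) _ r r0) => [y /Vr Vy|y w /Vr Vy]; first exact: C3.1.
rewrite (dS3 w sG Vy).
have E0 : skcoord p 0 G y = y.1 by have /(congr1 fst) := HG y Vy.
have d2 : is_diff y (skcoord p 2 G) (@snd R R).
  apply: (@is_diff_near_eq _ _ _ (@snd R R)); last by apply: is_diff_linear => ?; exact: cvg_snd.
  by apply: filterS (oV y Vy) => y' Vy'; have /(congr1 snd) /= -> := HG y' Vy'.
have E2 := is_diffE w d2.
exact: (f_equal2 (fun a b : R => a * b) E0 E2).
Qed.

Lemma surface_chart_sub U V G : surface_chart Sigma U G -> open V -> V `<=` U ->
  surface_chart Sigma V G.
Proof.
move=> [oU dG cG iG [injG subG opG]] oV VU; split.
- exact: oV.
- by move=> z /VU; exact: dG.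
- by move=> w z /VU; exact: cG.
- by move=> z /VU; exact: iG.
split.
- by move=> x y /set_mem/VU Ux /set_mem/VU Uy; apply: injG; exact: mem_set.
- by move=> _ [z /VU Uz <-]; apply: subG; exists z.
- by move=> W oW WV; apply: opG => //; exact: subset_trans WV VU.
Qed.

Lemma sk0 k : sk k (0 : engel R) = 0.
Proof.
by case: k => [|[|[|[|k]]]]; rewrite /sk /= ?nth_nil ?co0//; field.
Qed.

Lemma skcoord_p k phi z : phi z = p -> skcoord p k phi z = 0.
Proof. by move=> e; rewrite /skcoord e emulNx sk0. Qed.

Lemma degE : (deg (inord 0) = 1 /\ deg (inord 1) = 1 /\ deg (inord 2) = 2 /\ deg (inord 3) = 3)%N.
Proof. by rewrite /deg !inordK. Qed.

(** Two vectors with vanishing last coordinate have a wedge whose degree-3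
    components are its minors on (X_1, X_3) and (X_2, X_3). *)
Lemma wedge_degree3 (a0 a1 a2 b0 b1 b2 : R) (k m : 'I_4) : (deg k + deg m == 3)%N ->
  a0 * b2 - b0 * a2 = 0 -> a1 * b2 - b1 * a2 = 0 ->
  wedge (mk a0 a1 a2 0) (mk b0 b1 b2 0) k m = 0.
Proof.
have [g0 [g1 [g2 g3]]] := degE.
move=> + h0 h1; rewrite wedgeE.
case: (ord4P k) => ->; case: (ord4P m) => ->; rewrite ?g0 ?g1 ?g2 ?g3 // => _;
  rewrite -!/(co _ _) !co_mk; lra.
Qed.

Lemma mask_wedge (m u v : R) :
  mask 3 (wedge (e2 R) (mk m 0 u 0)) = u *: wedge (e2 R) (e3 R).
Proof.
have [g0 [g1 [g2 g3]]] := degE.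
apply/matrixP => k l; rewrite mxE [RHS]mxE !wedgeE.
case: (ord4P k) => ->; case: (ord4P l) => ->; rewrite ?g0 ?g1 ?g2 ?g3 /= -!/(co _ _) !co_mk; ring.
Qed.

(** The 2-vector at p has a component of degree 3, and the one on X_1 /\ X_3
    vanishes by wdet02. *)
Lemma wdet12 U phi z0 : surface_chart Sigma U phi -> U z0 -> phi z0 = p ->
  point_degree Y Sigma p = 3%N -> wdet 1 2 phi z0 != 0.
Proof.
move=> sphi Uz0 e d3.
have [l l0 E] := xi_chart sphi Uz0.
have [_ dphi _ _ _] := sphi.
have T w : theta (phi z0) ('d phi z0 w) =
    mk ('d (skcoord p 0 phi) z0 w) ('d (skcoord p 1 phi) z0 w) ('d (skcoord p 2 phi) z0 w) 0.
  have c3 := contact w sphi Uz0.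
  have tS := theta_skcoord p w (dphi _ Uz0).
  apply: engelP; rewrite ?[in RHS]co3_mk ?c3// tS !co_mk//.
  by rewrite (skcoord_p 1 e) mul0r addr0.
have [k [m [dkm]]] : exists k m, (deg k + deg m == 3)%N /\ xi_ Sigma p k m != 0.
  exact: (degree2_neq0 gY d3).
rewrite -e E mxE (T (1, 0)) (T (0, 1)).
have z02 := wdet02 sphi Uz0; rewrite /wdet in z02.
apply: contra => /eqP z12; rewrite /wdet in z12.
apply/eqP; exact: eq_trans (f_equal ( *%R l) (wedge_degree3 dkm z02 z12)) (mulr0 l).
Qed.

(** Near p the coordinates b, c are parameters, by wdet12. Since dw = a dc, w is
    a function of c alone and a is its derivative, hence also a function of c;
    both vanish at c = 0, so a = O(c) and w = O(c^2). The tangent 2-vector is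
    then computed by theta_skcoord: X_2 /\ (a' X_1 + (1 + b a') X_3), with
    a' = da/dc, whose degree-3 part has coefficient j = 1 + b a'. *)
Lemma adapted_chart : Sigma p -> C1_surface Sigma -> point_degree Y Sigma p = 3%N ->
  exists (delta K : R) (G : R * R -> engel R) (j : R * R -> R),
  [/\ 0 < delta, 0 <= K, surface_chart Sigma [set y | `|y| < delta] G, G 0 = p &
   [/\ (forall y, `|y| < delta -> exists a w, [/\ emul (- p) (G y) = of_sk a y.1 y.2 w,
          `|a| <= K * `|y.2| & `|w| <= K * `|y.2| ^+ 2]),
       (forall y, `|y| < delta ->
         mask 3 (left_trivialize (G y) (wedge ('d G y (1, 0)) ('d G y (0, 1)))) = j y *: wedge (e2 R) (e3 R)),
       {for 0, continuous j} & j 0 = 1]].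
Proof.
move=> Sp C1S d3; have [U [phi [sphi [z0 Uz0 e]]]] := C1S _ Sp.
have w12 := wdet12 sphi Uz0 e d3.
have [V [G [sG Vy0 Gy0 HG]]] := sk_chart (isT : (1 < 4)%N) (isT : (2 < 4)%N) sphi Uz0 w12.
rewrite (skcoord_p 1 e) (skcoord_p 2 e) in Vy0 Gy0; rewrite e in Gy0.
have [oV dG cG _ _] := sG.
have C1G : C1on V G by split.
pose f4 := skcoord p 3 G; pose f1 := skcoord p 0 G.
have C4 : C1on V f4 := C1on_skcoord p oV C1G (isT : (3 < 4)%N).
have C1 : C1on V f1 := C1on_skcoord p oV C1G (isT : (0 < 4)%N).
pose m y := 'd f1 y (0, 1).
have cm : {for (0 : R * R), continuous m} := C1.2 (0, 1) _ Vy0.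
have [r r0 hr] : exists2 r, 0 < r & forall y, `|y| < r -> V y /\ `|m y| <= `|m 0| + 1.
  have n1 : \forall y \near (0 : R * R), V y by exact: oV.
  have n2 : \forall y \near (0 : R * R), `|m 0 - m y| < 1.
    by move/cvgrPdist_lt: cm; apply.
  have n3 : \forall y \near (0 : R * R), V y /\ `|m 0 - m y| < 1.
    by near=> y; split; near: y.
  have /nbhs_normP[r /= r0 h] := n3.
  exists r => // y yr; have := h y; rewrite /= sub0r normrN => /(_ yr)[Vy my].
  split=> //; have -> : m y = m 0 - (m 0 - m y) by rewrite opprB addrC subrK.
  by rewrite (le_trans (ler_normB _ _))// lerD2l ltW.
have Vr (y : R * R) : `|y| < r -> V y by move=> /hr[].
have d1 y w : V y -> 'd (skcoord p 1 G) y w = w.1.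
  move=> Vy; have d : is_diff y (skcoord p 1 G) (@fst R R).
    apply: (@is_diff_near_eq _ _ _ (@fst R R)); last by apply: is_diff_linear => ?; exact: cvg_fst.
    by apply: filterS (oV y Vy) => y' Vy'; have /(congr1 fst) /= -> := HG y' Vy'.
  exact: (is_diffE w d).
have d2 y w : V y -> 'd (skcoord p 2 G) y w = w.2.
  move=> Vy; have d : is_diff y (skcoord p 2 G) (@snd R R).
    apply: (@is_diff_near_eq _ _ _ (@snd R R)); last by apply: is_diff_linear => ?; exact: cvg_snd.
    by apply: filterS (oV y Vy) => y' Vy'; have /(congr1 snd) /= -> := HG y' Vy'.
  exact: (is_diffE w d).
have d4 y w : V y -> 'd f4 y w = f1 y * w.2.
  move=> Vy; exact: eq_trans (dS3 w sG Vy) (f_equal ( *%R (f1 y)) (d2 y w Vy)).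
have f10 : f1 0 = 0 by exact: skcoord_p.
have f40 : f4 0 = 0 by exact: skcoord_p.
pose pr (y : R * R) : R * R := (0, y.2).
have prr (y : R * R) : `|y| < r -> `|pr y| < r.
  by apply: le_lt_trans; rewrite norm_pair_le /= normr0 normr_ge0 norm_snd.
have sub0 (y : R * R) : `|y| < r -> `|y - 0| < r by rewrite subr0.
have diff4 (y : R * R) : `|y - 0| < r -> differentiable f4 y.
  by rewrite subr0 => /Vr; exact: C4.1.
have diff1 (y : R * R) : `|y - 0| < r -> differentiable f1 y.
  by rewrite subr0 => /Vr; exact: C1.1.
(* f4 does not depend on the first variable, hence neither does f1 *)
have f4pr (y : R * R) : `|y| < r -> f4 y = f4 (pr y).
  move=> yr; apply/eqP; rewrite -subr_eq0; apply/eqP.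
  have [t [_ ht ->]] := mvt_ball diff4 (sub0 _ yr) (sub0 _ (prr _ yr)).
  rewrite subr0 in ht; have E := d4 _ (y - pr y) (Vr _ ht).
  by apply: (eq_trans E); rewrite /= subrr mulr0.
have dpr y : is_diff y pr (fun w => (0, w.2)).
  have d0 : is_diff y (@snd R R) (@snd R R) by apply: is_diff_linear => ?; exact: cvg_snd.
  exact: (is_diff_pair (is_diff_cst (0 : R) y) d0).
have nearr (y : R * R) : `|y| < r -> \forall y' \near y, `|y'| < r.
  move=> yr; have : open (ball (0 : R * R) r) by exact: ball_open.
  move=> /(_ y); rewrite -ball_normE /= sub0r normrN => /(_ yr).
  by apply: filterS => y'; rewrite /= sub0r normrN.
have f1pr (y : R * R) : `|y| < r -> f1 y = f1 (pr y).
  move=> yr.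
  have dc := is_diff_comp (dpr y) (differentiableP (C4.1 _ (Vr _ (prr _ yr)))).
  have dc' : is_diff y f4 ('d f4 (pr y) \o (fun w : R * R => (0, w.2))).
    apply: (is_diff_near_eq _ dc).
    by apply: filterS (nearr y yr) => y' y'r; rewrite f4pr.
  have E := is_diffE ((0, 1) : R * R) dc'.
  have E1 := d4 y (0, 1) (Vr _ yr).
  have E2 := d4 (pr y) (0, 1) (Vr _ (prr _ yr)).
  by move: (eq_trans (esym E1) (eq_trans E E2)); rewrite /= !mulr1.
have df1 (y : R * R) : `|y| < r -> 'd f1 y (1, 0) = 0.
  move=> yr.
  have dc := is_diff_comp (dpr y) (differentiableP (C1.1 _ (Vr _ (prr _ yr)))).
  have dc' : is_diff y f1 ('d f1 (pr y) \o (fun w : R * R => (0, w.2))).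
    apply: (is_diff_near_eq _ dc).
    by apply: filterS (nearr y yr) => y' y'r; rewrite f1pr.
  have E := is_diffE ((1, 0) : R * R) dc'.
  exact: eq_trans E (linear0 ('d f1 (pr y))).
pose K := `|m 0| + 1.
have K0 : 0 <= K by rewrite addr_ge0.
have bound1 (y : R * R) : `|y| < r -> `|f1 y| <= K * `|y.2|.
  move=> yr; rewrite f1pr//.
  have r00 : `|0 - 0 : R * R| < r by rewrite subr0 normr0.
  have [t [_ ht E]] := mvt_ball diff1 (sub0 _ (prr _ yr)) r00.
  rewrite subr0 in ht; rewrite f10 subr0 in E.
  set xi := 0 + t *: _ in ht E.
  have E2 : 'd f1 xi (pr y - 0) = y.2 * m xi.
    have e' : pr y - 0 = (0, y.2) := subr0 _.
    have L : 'd f1 xi (0, y.2) = 0 * 'd f1 xi (1, 0) + y.2 * m xi :=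
      linear2E ('d f1 xi) (0, y.2).
    have L' : 0 * 'd f1 xi (1, 0) + y.2 * m xi = y.2 * m xi by rewrite mul0r add0r.
    exact: eq_trans (f_equal ('d f1 xi) e') (eq_trans L L').
  by rewrite E E2 normrM mulrC ler_wpM2r//; have [] := hr _ ht.
have bound4 (y : R * R) : `|y| < r -> `|f4 y| <= K * `|y.2| ^+ 2.
  move=> yr; rewrite f4pr//.
  have r00 : `|0 - 0 : R * R| < r by rewrite subr0 normr0.
  have [t [/andP[t0 t1] ht E]] := mvt_ball diff4 (sub0 _ (prr _ yr)) r00.
  rewrite subr0 in ht; rewrite f40 subr0 in E.
  set xi := 0 + t *: _ in ht E.
  have E2 := d4 xi (pr y - 0) (Vr _ ht).
  rewrite E E2 normrM /= subr0 expr2 mulrA ler_wpM2r//.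
  rewrite (le_trans (bound1 _ ht))// ler_wpM2l//.
  by rewrite /xi /= add0r subr0 /GRing.scale /= normrM ler_piMl// ger0_norm.
exists r, K, G, (fun y => 1 + y.1 * m y); split=> //.
- apply: (surface_chart_sub sG); last by move=> y /Vr.
  rewrite (_ : [set y : R * R | _] = ball (0 : R * R) r); first exact: ball_open.
  by apply/seteqP; split => y; rewrite -ball_normE /= sub0r normrN.
split.
- move=> y yr; exists (f1 y), (f4 y); split; [|exact: bound1|exact: bound4].
  have /(congr1 fst) /= E1 := HG y (Vr _ yr); have /(congr1 snd) /= E2 := HG y (Vr _ yr).
  by rewrite -[LHS]of_skK -[in RHS]E1 -[in RHS]E2.
- move=> y yr; have Vy := Vr _ yr; rewrite left_trivialize_wedge.
  have /(congr1 fst) /= E1 := HG y Vy.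
  have T w : theta (G y) ('d G y w) = mk ('d f1 y w) w.1 (w.2 + y.1 * 'd f1 y w) 0.
    have c3 := contact w sG Vy.
    have tS := theta_skcoord p w (dG _ Vy).
    apply: engelP; rewrite ?[in RHS]co3_mk ?c3// tS !co_mk//.
    + exact: d1.
    + exact: (f_equal2 +%R (d2 y w Vy) (f_equal2 *%R E1 (erefl ('d f1 y w)))).
  have T1 : theta (G y) ('d G y (1, 0)) = e2 R.
    by rewrite (T (1, 0)) (df1 _ yr) /= mulr0 addr0.
  have T2 : theta (G y) ('d G y (0, 1)) = mk (m y) 0 (1 + y.1 * m y) 0 := T (0, 1).
  by rewrite T1 T2 mask_wedge.
- have c1 : {for (0 : R * R), continuous (fun y : R * R => y.1)} by exact: cvg_fst.
  have cc : {for (0 : R * R), continuous (@cst (R * R) R 1)} by exact: cst_continuous.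
  exact: cvgD cc (cvgM c1 cm).
- by rewrite /= mul0r addr0.
Unshelve. all: by end_near. Qed.

End Structure.

(** * Slices of balls and the spherical factor *)

Section NonMeasurableIntegrals.
Context d (T : measurableType d) (R : realType) (mu : {measure set T -> \bar R}).
Local Open Scope ereal_scope.

(** The integral of a nonnegative function is a supremum over simple functions
    below it, so monotonicity holds for functions that need not be measurable,
    as the densities below. *)
Lemma ge0_le_integral_gen (D : set T) (f1 f2 : T -> \bar R) :
  (forall x, D x -> 0 <= f1 x) -> (forall x, D x -> f1 x <= f2 x) ->
  \int[mu]_(x in D) f1 x <= \int[mu]_(x in D) f2 x.
Proof.
move=> f10 f12; rewrite !(integral_mkcond D).
have h10 x : 0 <= (f1 \_ D) x by apply: erestrict_ge0.
have h12 x : (f1 \_ D) x <= (f2 \_ D) x by apply: lee_restrict.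
rewrite !ge0_integralTE//; last by move=> x; exact: le_trans (h10 x) (h12 x).
apply: ereal_sup_le => _ [h hf <-]; exists h => // x.
exact: le_trans (hf x) (h12 x).
Qed.

Lemma integral_le_cst (D : set T) (f : T -> R) (c : R) : measurable D ->
  (forall x, D x -> 0 <= f x)%R -> (forall x, D x -> f x <= c)%R ->
  \int[mu]_(x in D) (f x)%:E <= c%:E * mu D.
Proof.
move=> mD f0 fc; rewrite -integral_cst//.
by apply: ge0_le_integral_gen => x Dx; rewrite lee_fin; [exact: f0|exact: fc].
Qed.

Lemma integral_ge_cst (D : set T) (f : T -> R) (c : R) : measurable D ->
  (0 <= c)%R -> (forall x, D x -> c <= f x)%R ->
  c%:E * mu D <= \int[mu]_(x in D) (f x)%:E.
Proof.
move=> mD c0 fc; rewrite -integral_cst//.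
by apply: ge0_le_integral_gen => x Dx; rewrite lee_fin//; exact: fc.
Qed.

End NonMeasurableIntegrals.

Section SphericalFactor.
Variable R : realType.
Local Notation mR := (measurableTypeR R).
Local Notation leb2 := (@lebesgue_measure R \x @lebesgue_measure R)%E.
Variable d : engel R -> engel R -> R.
Hypothesis hd : homogeneous_distance d.

(** The plane of X_2 and X_3, which is the homogeneous tangent space. *)
Definition plane_pt (z : R * R) : engel R := mk 0 z.1 z.2 0.

Lemma continuous_plane_pt : continuous plane_pt.
Proof.
move=> z; apply: continuous_mk.
- exact: cst_continuous.
- exact: cvg_fst.
- exact: cvg_snd.
- exact: cst_continuous.
Qed.

(** The slice of the ball of centre u and radius r by that plane. *)
Definition trace (u : engel R) (r : R) : set (R * R) := [set z | d u (plane_pt z) <= r].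

Lemma continuous_hdist_plane_pt u : continuous (fun z => d u (plane_pt z)).
Proof.
by move=> z; exact: (continuous_comp (@continuous_plane_pt z) (@continuous_hdist _ _ hd u _)).
Qed.

Lemma measurable_trace u r : measurable (trace u r : set (mR * mR)).
Proof.
apply: closed_measurable2.
apply: (@closed_comp _ _ (fun z => d u (plane_pt z)) [set y | y <= r]); last exact: closed_le.
by move=> z _; exact: continuous_hdist_plane_pt.
Qed.

Lemma dilation_plane_pt r z : dilation r (plane_pt z) = plane_pt (r * z.1, r ^+ 2 * z.2).
Proof. by apply: engelP; rewrite dilationE /plane_pt !co_mk /=; ring. Qed.

(** The dilation acts on the plane with weights 1 and 2, whence the factor
    rho^3. *)
Lemma leb2_trace_dilation u rho r : 0 < rho ->
  leb2 (trace (dilation rho u) (rho * r)) = ((rho ^+ 3)%:E * leb2 (trace u r))%E.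
Proof.
move=> rho0; have rho20 : 0 < rho ^+ 2 by rewrite exprn_gt0.
have -> : trace (dilation rho u) (rho * r) =
    affine2 rho^-1 0 (rho ^+ 2)^-1 0 @^-1` trace u r.
  have key (z : R * R) : (d (dilation rho u) (plane_pt z) <= rho * r) =
      (d u (plane_pt (rho^-1 * z.1 + 0, (rho ^+ 2)^-1 * z.2 + 0)) <= r).
    rewrite -[RHS](ler_pM2l rho0) -(hdist_dilation hd _ _ rho0) dilation_plane_pt /=.
    by rewrite !addr0 !mulVKf ?gt_eqF//; case: z.
  by apply/seteqP; split => z; rewrite /trace /affine2 /affine1 /= key.
rewrite leb2_affine ?invr_gt0//; last exact: measurable_trace.
by rewrite -invfM invrK -exprS.
Qed.

(** From hdist_bounded, after a dilation; the second kind coordinate on X_3 differs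
    from the linear one by a product of two terms of order r. *)
Lemma trace_bounded : exists2 M, 1 <= M & forall r (y : R * R) (e : engel R), 0 < r ->
  d 0 e <= 2 * r -> sk 1 e = y.1 -> sk 2 e = y.2 -> `|y.1| <= M * r /\ `|y.2| <= M * r ^+ 2.
Proof.
have [C C0 hC] := hdist_bounded hd.
exists (4 * C + 2 * C ^+ 2 + 1); first by have := sqr_ge0 C; lra.
move=> r y e r0 de e1 e2.
have r20 : 0 < 2 * r by rewrite mulr_gt0.
have b k : `|co k (dilation (2 * r)^-1 e)| <= C.
  have ri0 : 0 < (2 * r)^-1 by rewrite invr_gt0.
  have := hdist_dilation hd 0 e ri0; rewrite dilation0 => E.
  by apply: hC; rewrite E mulrC ler_pdivrMr// mul1r.
have aux n a : `|(2 * r)^-1 ^+ n * a| <= C -> `|a| <= C * (2 * r) ^+ n.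
  rewrite normrM exprVn normfV (gtr0_norm (exprn_gt0 _ r20)) mulrC.
  by rewrite ler_pdivrMr ?exprn_gt0.
have b0 : `|co 0 e| <= C * (2 * r) ^+ 1.
  by apply: aux; have := b 0%N; rewrite dilationE co_mk expr1.
have b1 : `|co 1 e| <= C * (2 * r) ^+ 1.
  by apply: aux; have := b 1%N; rewrite dilationE co_mk expr1.
have b2 : `|co 2 e| <= C * (2 * r) ^+ 2.
  by apply: aux; have := b 2%N; rewrite dilationE co_mk.
rewrite expr1 in b0 b1; rewrite -e1 -e2 /sk /=; split.
  by rewrite (le_trans b1)//; have := sqr_ge0 C; nra.
rewrite (le_trans (ler_normB _ _))// !normrM.
have n2 : `|2^-1 : R| = 2^-1 by rewrite ger0_norm.
rewrite n2; have : `|co 0 e| * `|co 1 e| <= (C * (2 * r)) * (C * (2 * r)) by rewrite ler_pM.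
have : 0 < r ^+ 2 by rewrite exprn_gt0.
move: b2; set x := `|co 2 e|; set w := `|co 0 e| * `|co 1 e|.
have -> : (C * (2 * r) ^+ 2) = 4 * C * r ^+ 2 by ring.
have -> : C * (2 * r) * (C * (2 * r)) = 4 * C ^+ 2 * r ^+ 2 by ring.
move=> h1 h2 h3; have : (4 * C + 2 * C ^+ 2 + 1) * r ^+ 2 = 4 * C * r ^+ 2 + 2 * C ^+ 2 * r ^+ 2 + r ^+ 2 by ring.
lra.
Qed.

Lemma sk_plane_pt z : sk 1 (plane_pt z) = z.1 /\ sk 2 (plane_pt z) = z.2.
Proof. by rewrite /sk /plane_pt /= !co_mk mul0r mul0r subr0. Qed.

(** Up to the factor alpha * beta, the spherical factor of the plane of X_2 and
    X_3. *)
Definition trace_sup : \bar R := ereal_sup [set leb2 (trace u 1) | u in [set u | d u 0 <= 1]].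

Lemma trace_sup_fin : trace_sup \is a fin_num.
Proof.
have [M M1 hM] := trace_bounded.
have M0 : 0 < 4 * M by lra.
have bnd u : d u 0 <= 1 -> (leb2 (trace u 1) <= ((4 * M) ^+ 2)%:E)%E.
  move=> du; rewrite -(leb2_box (- (2 * M), - (2 * M)) (ltW M0)).
  apply: le_measure; rewrite ?inE; [exact: measurable_trace|exact: measurable_box|].
  move=> z; rewrite /trace /= => dz.
  have d2 : d 0 (plane_pt z) <= 2 * 1.
    by have := hdist_triangle hd u 0 (plane_pt z); rewrite (hdist_sym hd 0 u); lra.
  have [s1 s2] := sk_plane_pt z.
  have [] := hM 1 z (plane_pt z) ltr01 d2 s1 s2.
  rewrite mulr1 expr1n mulr1 !ler_norml => /andP[? ?] /andP[? ?].
  by split; rewrite /= in_itv /=; apply/andP; split; lra.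
have ge : (0 <= trace_sup)%E.
  apply: (@le_trans _ _ (leb2 (trace 0 1))); first exact: measure_ge0.
  by apply: ereal_sup_ubound; exists 0 => //=; rewrite hdist_xx.
rewrite ge0_fin_numE// (@le_lt_trans _ _ ((4 * M) ^+ 2)%:E) ?ltry//.
by apply: ge_ereal_sup => _ [u du <-]; exact: bnd.
Qed.

Lemma leb2_trace_le_sup u : d u 0 <= 1 -> (leb2 (trace u 1) <= trace_sup)%E.
Proof. by move=> du; apply: ereal_sup_ubound; exists u. Qed.

Lemma leb2_trace_fin u : d u 0 <= 1 -> exists t, leb2 (trace u 1) = t%:E.
Proof.
move=> /leb2_trace_le_sup le; exists (fine (leb2 (trace u 1))); apply/esym/fineK.
rewrite ge0_fin_numE; last exact: measure_ge0.
by apply: (le_lt_trans le); rewrite ltey_eq trace_sup_fin.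
Qed.

Lemma leb2_trace_le u r : 0 < r -> d u 0 <= r ->
  (leb2 (trace u r) <= (r ^+ 3)%:E * trace_sup)%E.
Proof.
move=> r0 du; have ri0 : 0 < r^-1 by rewrite invr_gt0.
have -> : trace u r = trace (dilation r (dilation r^-1 u)) (r * 1).
  by rewrite dilation_comp mulfV ?gt_eqF// dilation1 mulr1.
rewrite leb2_trace_dilation// lee_pmul2l ?lte_fin ?exprn_gt0//.
apply: leb2_trace_le_sup.
have := hdist_dilation hd u 0 ri0; rewrite dilation0 => ->.
by rewrite mulrC ler_pdivrMr// mul1r.
Qed.

Lemma pow_near_one (a c : R) (n : nat) (eps : R) : 0 < eps ->
  exists t, [/\ 0 < t, t < 1 & `|c - (1 + a * t) ^+ n * c| < eps].
Proof.
move=> eps0.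
have cvg0 : ((1 + a * t) ^+ n * c) @[t --> 0^'+] --> (1 + a * 0) ^+ n * c.
  apply: cvg_at_right_filter; apply: cvgM; last exact: cvg_cst.
  apply: (@continuous_comp _ _ _ (fun t : R => 1 + a * t) (fun y => y ^+ n)).
    by apply: cvgD; [exact: cvg_cst|apply: cvgM; [exact: cvg_cst|exact: cvg_id]].
  exact: exprn_continuous.
have /cvgrPdist_lt/(_ eps eps0) near0 := cvg0.
rewrite mulr0 addr0 expr1n mul1r in near0.
near (0 : R)^'+ => t; exists t; split.
- by near: t; exact: nbhs_right_gt.
- by near: t; exact: nbhs_right_lt.
- by near: t.
Unshelve. all: by end_near. Qed.

Lemma le_lim_pow (x : \bar R) (c : R) (n : nat) :
  (forall eta, 0 < eta -> eta < 1 -> (x <= ((1 + eta) ^+ n * c)%:E)%E) -> (x <= c%:E)%E.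
Proof.
move=> h; apply/lee_addgt0Pr => eps eps0.
have [t [t0 t1]] := pow_near_one 1 c n eps0.
rewrite mul1r ltr_norml => /andP[? ?].
by rewrite (le_trans (h t t0 t1))// -EFinD lee_fin; lra.
Qed.

Lemma ge_lim_pow (x : \bar R) (c : R) (n : nat) :
  (forall eta, 0 < eta -> eta < 1 -> (((1 - eta) ^+ n * c)%:E <= x)%E) -> (c%:E <= x)%E.
Proof.
move=> h; apply/lee_addgt0Pr => eps eps0.
have [t [t0 t1]] := pow_near_one (- 1) c n eps0.
rewrite mulN1r ltr_norml => /andP[? ?].
apply: le_trans (leeD2r _ (h t t0 t1)).
by rewrite -EFinD lee_fin; lra.
Qed.

Section Metric.
Variable g : engel R -> 'M[R]_4.
Hypothesis hg : graded_metric g.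

Lemma graded_metric_deg (i j : 'I_4) : deg i != deg j -> g 0 i j = 0.
Proof.
move=> dij; have [_ _ [Y gY E]] := hg.
have [uY _] := gY; have [_ gV] := graded_invmx gY.
have -> : g 0 = invmx Y *m (invmx Y)^T.
  have -> : invmx Y *m (invmx Y)^T = invmx Y *m (Y *m g 0 *m Y^T) *m (invmx Y)^T.
    by rewrite E mulmx1.
  by rewrite !mulmxA mulVmx// mul1mx -mulmxA -trmx_mul mulVmx// trmx1 mulmx1.
rewrite mxE big1// => k _; rewrite [X in _ * X]mxE.
have [ik|/gV ->] := eqVneq (deg i) (deg k); last by rewrite mul0r.
by rewrite (gV j k) ?mulr0// -ik eq_sym.
Qed.

Lemma metric_sym : (g 0)^T = g 0.
Proof. by have [[h _ _] _ _] := hg. Qed.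

Lemma metric_pos (u : engel R) : u != 0 -> 0 < gram (g 0) u u.
Proof. by have [[_ h _] _ _] := hg; exact: h. Qed.

Lemma gram_e2e3 : gram (g 0) (e2 R) (e3 R) = 0.
Proof.
rewrite /gram mxE big1// => j _; rewrite [X in _ * X]mxE.
case: (ord4P j) => ->; rewrite -/(co _ (e3 R)) co_mk ?mulr0// mulr1 mxE big1// => i _.
have [g0 [g1 [g2 g3]]] := degE.
case: (ord4P i) => ->; rewrite -/(co _ (e2 R)) co_mk ?mul0r//.
by rewrite graded_metric_deg ?mulr0// g1 g2.
Qed.

(** The lengths of X_2 and X_3; these vectors are orthogonal for a graded
    metric. *)
Definition alpha : R := metric_norm g (e2 R).
Definition beta : R := metric_norm g (e3 R).

Lemma e2_neq0 : e2 R != 0.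
Proof. by apply/eqP => /(congr1 (@co R 1)); rewrite co_mk co0 => /eqP; rewrite oner_eq0. Qed.

Lemma e3_neq0 : e3 R != 0.
Proof. by apply/eqP => /(congr1 (@co R 2)); rewrite co_mk co0 => /eqP; rewrite oner_eq0. Qed.

Lemma alpha_gt0 : 0 < alpha.
Proof. by rewrite sqrtr_gt0; exact: (metric_pos e2_neq0). Qed.

Lemma beta_gt0 : 0 < beta.
Proof. by rewrite sqrtr_gt0; exact: (metric_pos e3_neq0). Qed.

Lemma metric_norm_plane_pt z w : metric_norm g (plane_pt z - plane_pt w) =
  Num.sqrt (sqdist (alpha * z.1, beta * z.2) (alpha * w.1, beta * w.2)).
Proof.
have -> : plane_pt z - plane_pt w = (z.1 - w.1) *: e2 R + (z.2 - w.2) *: e3 R.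
  by apply: engelP; rewrite !coD coN !coZ /plane_pt !co_mk; ring.
rewrite /metric_norm -/(gram _ _ _); congr Num.sqrt.
rewrite !(gramDl, gramDr, gramZl, gramZr) (gram_sym (e3 R) (e2 R) metric_sym) gram_e2e3.
have a2 : alpha ^+ 2 = gram (g 0) (e2 R) (e2 R).
  by rewrite sqr_sqrtr//; exact/ltW/(metric_pos e2_neq0).
have b2 : beta ^+ 2 = gram (g 0) (e3 R) (e3 R).
  by rewrite sqr_sqrtr//; exact/ltW/(metric_pos e3_neq0).
by rewrite /sqdist /= -a2 -b2; ring.
Qed.

Lemma norm2_e2e3 : norm2 (g 0) (wedge (e2 R) (e3 R)) = alpha * beta.
Proof.
rewrite norm2_wedge ?metric_sym// gram_e2e3 expr0n subr0 sqrtrM//.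
exact/ltW/(metric_pos e2_neq0).
Qed.

(** On the plane of X_2 and X_3 the Euclidean metric of g is that of R^2 after
    scaling the axes by alpha and beta. For the upper bound, the slice of the
    closed ball is surrounded by the slice of a slightly larger open ball. *)
Lemma spherical_factorE (V : {vspace engel R}) : \dim V = 2%N ->
  (forall x, x \in V <-> co 0 x = 0 /\ co 3 x = 0) ->
  spherical_factor d g V = ((alpha * beta)%:E * trace_sup)%E.
Proof.
move=> dimV memV.
have ab0 : 0 < alpha * beta by rewrite mulr_gt0 ?alpha_gt0 ?beta_gt0.
have cutE u : cball d u 1 `&` [set x | x \in V] = plane_pt @` trace u 1.
  apply/seteqP; split => [x [dx /memV[x0 x3]]|_ [z dz <-]].
    have E : plane_pt (co 1 x, co 2 x) = x by apply: engelP; rewrite /plane_pt !co_mk.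
    by exists (co 1 x, co 2 x) => //; rewrite /trace /= E.
  by split => //; apply/memV; rewrite /plane_pt !co_mk.
rewrite /spherical_factor dimV.
have lE : trace_sup = (fine trace_sup)%:E by rewrite fineK// trace_sup_fin.
have l0 : 0 <= fine trace_sup.
  apply/fine_ge0/(@le_trans _ _ (leb2 (trace 0 1))); first exact: measure_ge0.
  by apply: leb2_trace_le_sup; rewrite hdist_xx.
apply/le_anti/andP; split.
  apply: ge_ereal_sup => _ [u /= du <-]; rewrite cutE lE -EFinM.
  apply: (@le_lim_pow _ _ 3) => eta eta0 eta1.
  have e10 : 0 < 1 + eta by lra.
  pose O := [set z | d u (plane_pt z) < 1 + eta].
  have oO : open O.
    apply: (@open_comp _ _ (fun z => d u (plane_pt z)) [set y | y < 1 + eta]); last exact: open_lt.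
    by move=> z _; exact: continuous_hdist_plane_pt.
  have Oa : (leb2 O <= ((1 + eta) ^+ 3 * fine trace_sup)%:E)%E.
    rewrite EFinM -lE; apply: (@le_trans _ _ (leb2 (trace u (1 + eta)))).
      apply: le_measure; rewrite ?inE; [exact: open_measurable2|exact: measurable_trace|].
      by move=> z /= /ltW.
    by apply: leb2_trace_le => //; lra.
  have -> : (1 + eta) ^+ 3 * (alpha * beta * fine trace_sup) =
    alpha * beta * ((1 + eta) ^+ 3 * fine trace_sup) by ring.
  apply: (@hausdorff_measure_plane_le R (fun x y => metric_norm g (x - y)) _ _
    alpha_gt0 beta_gt0 plane_pt metric_norm_plane_pt _ _ _ oO _ Oa).
  by move=> z; rewrite /trace /O /=; lra.
rewrite -lee_pdivlMl//; apply: ge_ereal_sup => _ [u /= du <-].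
rewrite lee_pdivlMl//.
have H := @hausdorff_measure_plane_ge R (fun x y => metric_norm g (x - y)) _ _
  alpha_gt0 beta_gt0 plane_pt metric_norm_plane_pt _ (measurable_trace u 1).
rewrite -cutE in H; apply: (le_trans H).
by apply: ereal_sup_ubound; exists u; [exact: du|].
Qed.

End Metric.

End SphericalFactor.

(** * The density of the intrinsic measure in a chart *)

Section LocalMeasure.
Variable R : realType.
Local Notation mR := (measurableTypeR R).
Local Notation leb2 := (@lebesgue_measure R \x @lebesgue_measure R)%E.

Lemma continuous_sum_for (T : topologicalType) (I : finType) (P : pred I)
  (f : I -> T -> R) (t : T) :
  (forall i, P i -> {for t, continuous (f i)}) ->
  {for t, continuous (fun s => \sum_(i | P i) f i s)}.
Proof.
move=> h; apply: cvg_big => //.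
exact: add_continuous.
Qed.

Lemma continuous_norm2 (T : topologicalType) (A X : T -> 'M[R]_4) (t : T) :
  (forall i j, {for t, continuous (fun s => A s i j)}) ->
  (forall i j, {for t, continuous (fun s => X s i j)}) ->
  {for t, continuous (fun s => norm2 (A s) (X s))}.
Proof.
move=> cA cX.
pose F s := \sum_(i < 4) \sum_(j < 4 | (i < j)%N)
            \sum_(k < 4) \sum_(l < 4 | (k < l)%N)
              X s i j * X s k l * (A s i k * A s j l - A s i l * A s j k).
have cF : {for t, continuous F}.
  apply: continuous_sum_for => i _; apply: continuous_sum_for => j _.
  apply: continuous_sum_for => k _; apply: continuous_sum_for => l _.
  exact: cvgM (cvgM (cX i j) (cX k l))
    (cvgB (cvgM (cA i k) (cA j l)) (cvgM (cA i l) (cA j k))).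
exact: (@continuous_comp _ _ _ F Num.sqrt t cF (@sqrt_continuous R _)).
Qed.

Lemma continuous_wedge (T : topologicalType) (v w : T -> engel R) (t : T) :
  {for t, continuous v} -> {for t, continuous w} ->
  forall i j, {for t, continuous (fun s => wedge (v s) (w s) i j)}.
Proof.
move=> cv cw i j.
have c (u : T -> engel R) k : {for t, continuous u} -> {for t, continuous (fun s => u s 0 k)}.
  move=> cu; apply: (@continuous_comp _ _ _ u (fun x : engel R => x 0 k) t cu).
  exact: coord_continuous.
have cE : {for t, continuous (fun s => v s 0 i * w s 0 j - w s 0 i * v s 0 j)}.
  exact: cvgB (cvgM (c _ i cv) (c _ j cw)) (cvgM (c _ i cw) (c _ j cv)).
have E : (fun s => wedge (v s) (w s) i j) = (fun s => v s 0 i * w s 0 j - w s 0 i * v s 0 j).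
  by apply/funext => s; rewrite wedgeE.
by rewrite E.
Qed.

Lemma injective_free (T : {linear (R * R)%type -> engel R}) : injective T ->
  forall a b, a *: T (1, 0) + b *: T (0, 1) = 0 -> a = 0 /\ b = 0.
Proof.
move=> injT a b e.
have e1 : T (a, b) = T 0 := eq_trans (linear2E T (a, b)) (eq_trans e (esym (linear0 T))).
by have [-> ->] := injT _ _ e1.
Qed.

Variables (d : engel R -> engel R -> R) (hd : homogeneous_distance d).
Variables (g : engel R -> 'M[R]_4) (hg : graded_metric g).
Variables (Y : 'M[R]_4) (hY : graded_basis Y).
Variables (Sigma : set (engel R)) (hSigma : C1_surface Sigma).
Variables (gt : engel R -> 'M[R]_4) (hgt : riemannian_metric gt).

Lemma area_element_gt0 U phi z : surface_chart Sigma U phi -> U z ->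
  0 < area_element gt phi z.
Proof.
move=> [_ _ _ iphi _] Uz; have [gs gp _] := hgt.
apply: norm2_wedge_gt0; first exact: gs.
  by move=> u u0; exact: gp.
exact: (injective_free (iphi _ Uz)).
Qed.

Lemma continuous_area_element U phi z : surface_chart Sigma U phi -> U z ->
  {for z, continuous (area_element gt phi)}.
Proof.
move=> [_ dphi cphi _ _] Uz; have [_ _ gC] := hgt.
have cgt : continuous gt := gC 0%N.
have cp : {for z, continuous phi} := differentiable_continuous (dphi _ Uz).
apply: continuous_norm2.
  move=> i j.
  have c1 : {for z, continuous (fun s => gt (phi s))} := continuous_comp cp (cgt (phi z)).
  apply: (@continuous_comp _ _ _ (fun s => gt (phi s)) (fun x : 'M[R]_4 => x i j) z c1).
  exact: coord_continuous.
exact: continuous_wedge (cphi (1, 0) _ Uz) (cphi (0, 1) _ Uz).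
Qed.

Lemma part2Z M a xi : skew xi -> part2 Y M (a *: xi) = a *: part2 Y M xi.
Proof.
move=> sk; rewrite !part2E//; last exact: skewZ.
by apply/matrixP => i j; rewrite !mxE; case: ifP; rewrite ?mulr0.
Qed.

Lemma skew_mask M (xi : 'M[R]_4) : skew xi -> skew (mask M xi).
Proof.
move=> sk; apply/matrixP => i j; rewrite !mxE addnC.
by case: ifP; rewrite ?oppr0// => _; exact: skewE.
Qed.

(** The density of the intrinsic measure with respect to the surface measure. *)
Definition density (q : engel R) : R := norm2 (g q) (tau_part Y gt Sigma 3 q).

(** The unknown factor of the chosen tangent 2-vector cancels in the unit
    2-vector, up to its sign. *)
Lemma density_chart U phi z : surface_chart Sigma U phi -> U z ->
  density (phi z) = norm2 (g 0) (mask 3 (left_trivialize (phi z)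
     (wedge ('d phi z (1, 0)) ('d phi z (0, 1))))) / area_element gt phi z.
Proof.
move=> sphi Uz; have a0 := area_element_gt0 sphi Uz.
have [l l0 E] := tau_chart sphi Uz.
have [_ lg _] := hg.
rewrite /density /tau_part /unit_tau E.
move: a0; rewrite /area_element.
have := skew_wedge ('d phi z (1, 0)) ('d phi z (0, 1)).
move: (wedge _ _) => om sko a0.
have skt (a : R) : skew (left_trivialize (phi z) (a *: om)).
  by rewrite left_trivializeZ; apply/skewZ/skew_push2.
rewrite norm2Z// scalerA left_trivializeZ part2Z; last exact: skew_push2.
rewrite part2E//; last exact: skew_push2.
rewrite norm2_left_field//; last by apply/skewZ/skew_mask/skew_push2.
rewrite norm2Z; last by apply/skew_mask/skew_push2.
rewrite mulrC; congr (_ * _).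
rewrite normrM normfV normrM normr_id (gtr0_norm a0).
by field; rewrite normr_eq0 l0 gt_eqF.
Qed.

(** Small balls of d are small in norm: by homogeneity the bound of hdist_bounded
    on the unit ball shrinks with the radius. *)
Lemma hdist_norm_small (rho : R) : 0 < rho ->
  exists2 r, 0 < r & forall e, d 0 e <= r -> `|e| < rho.
Proof.
move=> rho0; have [C C0 hC] := hdist_bounded hd.
pose r := Num.min 1 (rho / (2 * C)).
have r0 : 0 < r by rewrite lt_min ltr01 divr_gt0// mulr_gt0.
have r1 : r <= 1 by rewrite ge_min lexx.
have rC : C * r <= rho / 2.
  have : r <= rho / (2 * C) by rewrite ge_min lexx orbT.
  by rewrite ler_pdivlMr ?mulr_gt0//; lra.
exists r => // e de.
have ri0 : 0 < r^-1 by rewrite invr_gt0.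
have b k : `|co k (dilation r^-1 e)| <= C.
  apply: hC; have := hdist_dilation hd 0 e ri0; rewrite dilation0 => ->.
  by rewrite mulrC ler_pdivrMr// mul1r.
have aux n a : `|r^-1 ^+ n.+1 * a| <= C -> `|a| <= C * r.
  rewrite normrM exprVn normfV (gtr0_norm (exprn_gt0 _ r0)) mulrC.
  rewrite ler_pdivrMr ?exprn_gt0// => h; rewrite (le_trans h)// ler_wpM2l ?(ltW C0)//.
  by rewrite exprS ler_piMr ?(ltW r0)// exprn_ile1 ?(ltW r0).
have h : `|e| <= C * r.
  apply: norm_le; first by rewrite mulr_ge0 ?ltW.
  apply: (@co_case R (fun t => `|t| <= C * r)).
  - by apply: (aux 0%N); have := b 0%N; rewrite dilationE co_mk expr1.
  - by apply: (aux 0%N); have := b 1%N; rewrite dilationE co_mk expr1.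
  - by apply: (aux 1%N); have := b 2%N; rewrite dilationE co_mk.
  - by apply: (aux 2%N); have := b 3%N; rewrite dilationE co_mk.
by rewrite (le_lt_trans h)//; lra.
Qed.

Lemma hdist_nbhs p (W : set (engel R)) : open W -> W p ->
  exists2 r, 0 < r & forall q, d p q <= r -> W q.
Proof.
move=> oW Wp.
have ce : {for (0 : engel R), continuous (emul p)}.
  by apply: differentiable_continuous; have D := is_diff_emul p 0; exact: ex_diff.
have nW : \forall e \near (0 : engel R), W (emul p e).
  by apply: ce; rewrite emulx0; exact: oW.
have /nbhs_normP[rho /= rho0 h] := nW.
have [r r0 hr] := hdist_norm_small rho0.
exists r => // q dq.
have -> : q = emul p (emul (- p) q) by rewrite emulA emulxN emul0x.
apply: h; rewrite /= sub0r normrN; apply: hr.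
by rewrite -hdist_left_quotient.
Qed.

Lemma closed_borel (F : set (engel R)) : closed F -> measurable (F : set (borelE R)).
Proof.
move=> cF; rewrite -[F]setCK; apply: measurableC; apply: sub_sigma_algebra.
exact: closed_openC.
Qed.

End LocalMeasure.

(** * The intrinsic measure of small balls *)

Section BallMeasure.
Variable R : realType.
Local Notation mR := (measurableTypeR R).
Local Notation leb2 := (@lebesgue_measure R \x @lebesgue_measure R)%E.
Local Notation disk rho := [set y : R * R | `|y| < rho].

Lemma nearly_constant (f : R * R -> R) (eta : R) : 0 < eta -> 0 < f 0 ->
  {for (0 : R * R), continuous f} ->
  exists2 rho, 0 < rho & forall y : R * R, `|y| < rho -> (1 - eta) * f 0 <= f y <= (1 + eta) * f 0.
Proof.
move=> eta0 f0 /cvgrPdist_lt/(_ (eta * f 0)) H.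
have /nbhs_normP[rho /= rho0 h] := H (mulr_gt0 eta0 f0).
exists rho => // y yr.
have := h y; rewrite /= sub0r normrN => /(_ yr).
by rewrite ltr_norml => /andP[? ?]; apply/andP; split; lra.
Qed.

Lemma disk_open rho : open (disk rho).
Proof.
apply: (@open_comp _ _ (fun y : R * R => `|y|) [set t | t < rho]); last exact: open_lt.
by move=> y _; exact: norm_continuous.
Qed.

Variables (d : engel R -> engel R -> R) (hd : homogeneous_distance d).
Variables (g : engel R -> 'M[R]_4) (hg : graded_metric g).
Variables (Y : 'M[R]_4) (hY : graded_basis Y).
Variables (Sigma : set (engel R)).
Variables (gt : engel R -> 'M[R]_4) (hgt : riemannian_metric gt).
Variables (sigma : {measure set (borelE R) -> \bar R}).
Hypothesis hsigma : riemannian_surface_measure gt Sigma sigma.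
Variables (p : engel R) (delta : R) (G : R * R -> engel R) (j : R * R -> R).
Hypothesis delta0 : 0 < delta.
Hypothesis sG : surface_chart Sigma (disk delta) G.
Hypothesis G0 : G 0 = p.
Hypothesis skG : forall y : R * R, `|y| < delta ->
  sk 1 (emul (- p) (G y)) = y.1 /\ sk 2 (emul (- p) (G y)) = y.2.
Hypothesis jG : forall y : R * R, `|y| < delta ->
  mask 3 (left_trivialize (G y) (wedge ('d G y (1, 0)) ('d G y (0, 1)))) = j y *: wedge (e2 R) (e3 R).
Hypothesis cj : {for (0 : R * R), continuous j}.
Hypothesis j0 : j 0 = 1.

Local Notation kappa := (alpha g * beta g).

Lemma density_G (y : R * R) : `|y| < delta -> density g Y Sigma gt (G y) = kappa * (`|j y| / area_element gt G y).
Proof.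
move=> yd; rewrite (density_chart hg hY hgt sG yd) (jG yd) norm2Z; last exact: skew_wedge.
by rewrite norm2_e2e3// [RHS]mulrCA mulrA.
Qed.

(** Small balls that contain p see only the part of the surface covered by the
    chart. *)
Lemma ball_in_chart (V : set (R * R)) (W : set (engel R)) (r2 r : R) (x : engel R) : 0 < r -> 
  G @` V = Sigma `&` W -> (forall q, d p q <= r2 -> W q) -> 2 * r <= r2 ->
  d x p <= r -> cball d x r `&` Sigma = cball d x r `&` G @` V.
Proof.
move=> r0 GV hW rr dx; rewrite GV; apply/seteqP; split => q [Bq] //.
  move=> Sq; split=> //; split=> //; apply: hW.
  have := hdist_triangle hd x p q; rewrite (hdist_sym hd p x).
  by move: Bq; rewrite /cball /=; lra.
by case.
Qed.

(** The part of the surface in the ball is the intersection of the ball with the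
    image of a compact box; so it is a Borel set, although the image of the
    whole chart is only relatively open in the surface. *)
Lemma closed_chart_piece (rho r x0 : R) (x : engel R) : 0 < r -> 
  (forall y : R * R, `|y| < rho -> d x (G y) <= r -> `|y| <= x0) -> x0 < rho -> rho <= delta ->
  closed (cball d x r `&` G @` disk rho).
Proof.
move=> r0 hb xr rd; have [_ dG _ _ _] := sG.
have -> : cball d x r `&` G @` disk rho = cball d x r `&` G @` [set y : R * R | `|y - 0| <= x0].
  apply/seteqP; split => q [Bq [y /= yr e]]; split => //; exists y => //=.
    by rewrite subr0; apply: (hb y yr); rewrite e.
  by move: yr; rewrite subr0 => yr; exact: le_lt_trans yr xr.
apply: closedI; first exact: closed_cball_hdist.
apply: compact_closed; first exact: norm_hausdorff.
apply: continuous_compact; last exact: compact_box.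
apply: continuous_in_subspaceT => y /set_mem /=; rewrite subr0 => yx.
apply: differentiable_continuous; apply: dG => /=.
exact: lt_le_trans (le_lt_trans yx xr) rd.
Qed.

(** In the adapted chart the area element and the density of the intrinsic
    measure are continuous at 0, where their product is alpha * beta; near 0
    each of them is within a factor 1 +- eta of its value at 0. *)
Lemma local_measure eta : 0 < eta -> eta < 1 ->
  exists rho r1, [/\ 0 < rho, rho <= delta, 0 < r1 & forall r x, 0 < r -> r < r1 -> d x p <= r ->
   let D := [set y : R * R | `|y| < rho /\ d x (G y) <= r] in
   [/\ measurable (D : set (mR * mR)),
     (((1 - eta) ^+ 2 * kappa)%:E * leb2 D <= intrinsic_measure Y g gt sigma Sigma 3 (cball d x r))%E &
     (intrinsic_measure Y g gt sigma Sigma 3 (cball d x r) <= ((1 + eta) ^+ 2 * kappa)%:E * leb2 D)%E]].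
Proof.
move=> eta0 eta1.
have k0 : 0 < kappa by rewrite mulr_gt0 ?alpha_gt0 ?beta_gt0.
have D0 : disk delta 0 by rewrite /= normr0.
pose a0 := area_element gt G 0.
have a00 : 0 < a0 := area_element_gt0 hgt sG D0.
have ca : {for (0 : R * R), continuous (area_element gt G)} := continuous_area_element hgt sG D0.
pose h (y : R * R) := `|j y| / area_element gt G y.
have ch : {for (0 : R * R), continuous h}.
  apply: (cvgM (cvg_norm cj)); apply: cvgV; [by rewrite gt_eqF|exact: ca].
have h0E : h 0 = a0^-1 by rewrite /h j0 normr1 mul1r.
have h0 : 0 < h 0 by rewrite h0E invr_gt0.
have [rho1 rho10 b1] := nearly_constant eta0 a00 ca.
have [rho2 rho20 b2] := nearly_constant eta0 h0 ch.
pose rho := Num.min delta (Num.min rho1 rho2).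
have rho0 : 0 < rho by rewrite !lt_min delta0 rho10.
have rd : rho <= delta by rewrite ge_min lexx.
have rr1 : rho <= rho1 by rewrite !ge_min lexx orbT.
have rr2 : rho <= rho2 by rewrite !ge_min lexx !orbT.
have sV : surface_chart Sigma (disk rho) G.
  by apply: (surface_chart_sub sG (@disk_open rho)) => y /= yr; exact: lt_le_trans yr rd.
have [_ dG _ _ [_ _ opG]] := sV.
have [W oW GV] := opG _ (@disk_open rho) (fun _ h => h).
have Wp : W p.
  have : (G @` disk rho) p by exists 0 => //=; rewrite normr0.
  by rewrite GV => -[].
have [r2 r20 hW] := hdist_nbhs hd oW Wp.
have [M M1 hM] := trace_bounded hd.
have M0 : 0 < M by lra.
pose r1 := Num.min 1 (Num.min (r2 / 2) (rho / (2 * M))).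
have r10 : 0 < r1 by rewrite !lt_min ltr01 !divr_gt0// mulr_gt0.
exists rho, r1; split => // r x r0 rr1' dx D.
have r_1 : r < 1 by move: rr1'; rewrite !lt_min => /andP[].
have r_2 : 2 * r <= r2 by move: rr1'; rewrite !lt_min => /and3P[_ ? _]; lra.
have r_M : M * r < rho / 2.
  move: rr1'; rewrite !lt_min => /and3P[_ _]; rewrite ltr_pdivlMr ?mulr_gt0//; lra.
have bd (y : R * R) : `|y| < rho -> d x (G y) <= r -> `|y| <= rho / 2.
  move=> yr dy; have [s1 s2] := skG (lt_le_trans yr rd).
  have de : d 0 (emul (- p) (G y)) <= 2 * r.
    rewrite -hdist_left_quotient//; have := hdist_triangle hd x p (G y).
    by rewrite (hdist_sym hd p x); lra.
  have [y1 y2] := hM r y _ r0 de s1 s2.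
  have r22 : r ^+ 2 <= r by rewrite expr2 ler_piMr// ltW.
  rewrite norm_pair_le; apply/andP; split; first by apply: (le_trans y1); exact: ltW.
  apply: (le_trans y2); apply: le_trans (ltW r_M).
  by rewrite ler_wpM2l// ltW.
have BS := ball_in_chart r0 GV hW r_2 dx.
have cB : closed (cball d x r `&` G @` disk rho).
  apply: (@closed_chart_piece rho r (rho / 2) x r0 bd) => //; lra.
have mB : measurable (cball d x r `&` G @` disk rho : set (borelE R)) := closed_borel cB.
have mb : measurable (cball d x r : set (borelE R)).
  by apply: (@closed_borel R); exact: closed_cball_hdist.
have DE : D = disk rho `&` G @^-1` cball d x r by [].
have mD : measurable (D : set (mR * mR)).
  have -> : D = disk rho `\` (disk rho `&` G @^-1` (~` cball d x r)).
    rewrite DE; apply/seteqP; split => y /=; first by move=> [? ?]; split=> // -[].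
    by move=> [yr]; rewrite not_andP => -[//|/contrapT].
  apply: measurableD; apply: open_measurable2; first exact: disk_open.
  have oB : open (~` cball d x r) by rewrite openC; exact: closed_cball_hdist.
  rewrite openE => y [yr yB]; rewrite /interior; apply: filterI.
    by apply: open_nbhs_nbhs; split => //; exact: disk_open.
  have cy : {for y, continuous G} := differentiable_continuous (dG _ yr).
  by apply: cy; exact: open_nbhs_nbhs.
have muE : intrinsic_measure Y g gt sigma Sigma 3 (cball d x r) =
    (\int[sigma]_(q in cball d x r `&` G @` disk rho) (density g Y Sigma gt q)%:E)%E.
  by rewrite -BS.
have sE : sigma (cball d x r `&` G @` disk rho) =
    (\int[leb2]_(y in D) (area_element gt G y)%:E)%E.
  by have [_ hs] := hsigma; exact: hs _ _ sV _ mb.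
have e1 : 0 <= 1 - eta by lra.
have e2 : 0 <= 1 + eta by lra.
have ea0 : kappa * h 0 * a0 = kappa by rewrite h0E mulfVK ?gt_eqF.
have kh0 : 0 < kappa * h 0 by rewrite mulr_gt0.
have dens q : (cball d x r `&` G @` disk rho) q ->
    (1 - eta) * (kappa * h 0) <= density g Y Sigma gt q <= (1 + eta) * (kappa * h 0).
  move=> [_ [y /= yr <-]]; rewrite density_G; last exact: lt_le_trans yr rd.
  rewrite mulrCA [X in _ <= _ <= X]mulrCA !(ler_pM2l k0).
  by apply: b2; exact: lt_le_trans yr rr2.
have area y : D y -> (1 - eta) * a0 <= area_element gt G y <= (1 + eta) * a0.
  by move=> [yr _]; apply: b1; exact: lt_le_trans yr rr1.
split => //.
- have -> : (1 - eta) ^+ 2 * kappa = ((1 - eta) * (kappa * h 0)) * ((1 - eta) * a0).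
    by rewrite -[in LHS]ea0; ring.
  rewrite muE EFinM -muleA.
  apply: (@le_trans _ _ (((1 - eta) * (kappa * h 0))%:E * sigma (cball d x r `&` G @` disk rho))%E).
    apply: lee_wpmul2l; first by rewrite lee_fin mulr_ge0// ltW.
    rewrite sE; apply: (@integral_ge_cst _ _ R leb2) => //.
      by rewrite mulr_ge0// ltW.
    by move=> y /area/andP[].
  apply: (@integral_ge_cst _ _ R sigma) => //; first by rewrite mulr_ge0// ltW.
  by move=> q /dens/andP[].
- have -> : (1 + eta) ^+ 2 * kappa = ((1 + eta) * (kappa * h 0)) * ((1 + eta) * a0).
    by rewrite -[in LHS]ea0; ring.
  rewrite muE EFinM -muleA.
  apply: (@le_trans _ _ (((1 + eta) * (kappa * h 0))%:E * sigma (cball d x r `&` G @` disk rho))%E).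
    apply: (@integral_le_cst _ _ R sigma) => //; last by move=> q /dens/andP[].
    by move=> q /dens/andP[+ _]; apply: le_trans; rewrite mulr_ge0// ltW.
  apply: lee_wpmul2l; first by rewrite lee_fin mulr_ge0// ltW.
  rewrite sE; apply: (@integral_le_cst _ _ R leb2) => //; last by move=> y /area/andP[].
  by move=> y /area/andP[+ _]; apply: le_trans; rewrite mulr_ge0// ltW.
Qed.

End BallMeasure.

(** * Blow-up at the point and the Federer density *)

Section BlowUp.
Variable R : realType.
Local Notation mR := (measurableTypeR R).
Local Notation leb2 := (@lebesgue_measure R \x @lebesgue_measure R)%E.
Local Notation disk rho := [set y : R * R | `|y| < rho].
Variables (d : engel R -> engel R -> R) (hd : homogeneous_distance d).
Variables (p : engel R) (delta K : R) (G : R * R -> engel R).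
Hypothesis K0 : 0 <= K.
Hypothesis HG : forall y : R * R, `|y| < delta -> exists a w,
  [/\ emul (- p) (G y) = of_sk a y.1 y.2 w,
          `|a| <= K * `|y.2| & `|w| <= K * `|y.2| ^+ 2].

Lemma plane_pt_quotient (y : R * R) (a w : R) : emul (- plane_pt y) (of_sk a y.1 y.2 w) = mk a 0 (a * y.1) w.
Proof.
by rewrite emulE /plane_pt /of_sk; apply: engelP; rewrite !co_mk !coN !co_mk ?coN ?co_mk; field.
Qed.

(** The left quotient of the two points is (a, 0, a b, w), with a = O(r^2),
    b = O(r) and w = O(r^4): its dilation by 1 / r has coordinates of order r. *)
Lemma close_to_plane M eta : 1 <= M -> 0 < eta -> exists2 r0, 0 < r0 &
  forall r (y : R * R), 0 < r -> r < r0 -> `|y| < delta -> `|y.1| <= M * r -> `|y.2| <= M * r ^+ 2 ->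
  d (plane_pt y) (emul (- p) (G y)) <= r * eta.
Proof.
move=> M1 eta0; have [e e0 he] := hdist_small hd eta0.
have A0 : 0 <= K * M ^+ 2 by rewrite mulr_ge0// sqr_ge0.
exists (e / (K * M ^+ 2 + 1)); first by rewrite divr_gt0//; lra.
move=> r y r0; rewrite ltr_pdivlMr; last by lra.
move=> re yd y1 y2; have [a [w [E ha hw]]] := HG yd.
have ri0 : 0 < r^-1 by rewrite invr_gt0.
rewrite E hdist_left_quotient// plane_pt_quotient.
rewrite -ler_pdivrMl//.
have := hdist_dilation hd 0 (mk a 0 (a * y.1) w) ri0; rewrite dilation0 => <-.
apply/ltW/he; rewrite dilationE.
have Kr : K * M ^+ 2 * r <= e by nra.
have M0 : 0 < M by lra.
have y22 : `|y.2| ^+ 2 <= (M * r ^+ 2) ^+ 2 by rewrite ler_pXn2r ?nnegrE// mulr_ge0// ?ltW// exprn_gt0.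
have ha' : `|a| <= K * (M * r ^+ 2) by apply: (le_trans ha); rewrite ler_wpM2l.
have hw' : `|w| <= K * (M * r ^+ 2) ^+ 2 by apply: (le_trans hw); rewrite ler_wpM2l.
have nri : `|r^-1| = r^-1 by rewrite gtr0_norm.
have aux n b : `|b| <= K * M ^+ 2 * r ^+ n.+1 -> `|r^-1 ^+ n * b| <= e.
  move=> hb; rewrite normrM normrX nri exprVn ler_pdivrMl ?exprn_gt0//.
  by apply: (le_trans hb); rewrite (exprS r n) mulrA [leRHS]mulrC ler_wpM2r// exprn_ge0// ltW.
apply: (@co_case R (fun t => `|t| <= e)); rewrite !co_mk ?mulr0 ?normr0 ?(ltW e0)//.
- rewrite -[r^-1]expr1; apply: aux; apply: (le_trans ha').
  rewrite -mulrA ler_wpM2l//; apply: ler_wpM2r; first by rewrite exprn_ge0// ltW.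
  by rewrite expr2 ler_peMr// ltW.
- apply: aux; rewrite normrM.
  apply: (le_trans (ler_pM _ _ ha' y1)) => //; rewrite le_eqVlt; apply/orP; left; apply/eqP; ring.
- apply: aux; apply: (le_trans hw'); rewrite le_eqVlt; apply/orP; left; apply/eqP; ring.
Qed.

(** By close_to_plane, moving the surface onto the plane of X_2 and X_3 costs an
    error r * eta in the radius of the ball. *)
Lemma blow_up_upper eta : 0 < eta -> exists2 r0, 0 < r0 &
  forall r x (y : R * R), 0 < r -> r < r0 -> d x p <= r -> `|y| < delta -> d x (G y) <= r ->
  trace d (emul (- p) x) (r * (1 + eta)) y.
Proof.
move=> eta0; have [M M1 hM] := trace_bounded hd.
have [r0 r00 h] := close_to_plane M1 eta0; exists r0 => // r x y rp rr dx yd dy.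
have de : d 0 (emul (- p) (G y)) <= 2 * r.
  rewrite -hdist_left_quotient//; have := hdist_triangle hd x p (G y).
  by rewrite (hdist_sym hd p x); lra.
have [a [w [E _ _]]] := HG yd.
have [s1 s2] : sk 1 (emul (- p) (G y)) = y.1 /\ sk 2 (emul (- p) (G y)) = y.2.
  by rewrite E /sk /of_sk /= !co_mk; split => //; field.
have [y1 y2] := hM r y _ rp de s1 s2.
have := h r y rp rr yd y1 y2; rewrite /trace /=.
have := hdist_triangle hd (emul (- p) (G y)) (emul (- p) x) (plane_pt y).
rewrite hdist_emul// (hdist_sym hd (emul (- p) (G y)) (plane_pt y)); lra.
Qed.

(** The same comparison in the other direction, with the radius reduced
    beforehand so that the error brings it back to r. *)
Lemma blow_up_lower eta rho : 0 < eta -> eta < 1 -> 0 < rho -> rho <= delta -> exists2 r0, 0 < r0 &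
  forall r u (y : R * R), 0 < r -> r < r0 -> d u 0 <= r * (1 - eta) -> trace d u (r * (1 - eta)) y ->
  `|y| < rho /\ d (emul p u) (G y) <= r.
Proof.
move=> eta0 eta1 rho0 rd; have [M M1 hM] := trace_bounded hd.
have M0 : 0 < M by lra.
have [r0 r00 h] := close_to_plane M1 eta0.
exists (Num.min r0 (Num.min 1 (rho / M))).
  by rewrite !lt_min r00 ltr01 divr_gt0.
move=> r u y rp; rewrite !lt_min => /and3P[rr r_1]; rewrite ltr_pdivlMr// => r_M du.
rewrite /trace /= => dy.
have re : r * (1 - eta) <= r by rewrite ler_piMr ?ltW//; lra.
have de : d 0 (plane_pt y) <= 2 * r.
  by have := hdist_triangle hd u 0 (plane_pt y); rewrite (hdist_sym hd 0 u); lra.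
have [s1 s2] := sk_plane_pt y.
have [y1 y2] := hM r y _ rp de s1 s2.
have r22 : M * r ^+ 2 <= M * r by rewrite ler_pM2l// expr2 ler_piMr// ltW.
have yr : `|y| < rho.
  apply: (@le_lt_trans _ _ (M * r)); last by lra.
  by rewrite norm_pair_le y1 (le_trans y2 r22).
split => //.
have := h r y rp rr (lt_le_trans yr rd) y1 y2.
have -> : G y = emul p (emul (- p) (G y)) by rewrite emulA emulxN emul0x.
rewrite hdist_emul// emulA emulNx emul0x => hy.
have := hdist_triangle hd (plane_pt y) u (emul (- p) (G y)); lra.
Qed.

End BlowUp.

Section FedererDensity.
Variable R : realType.
Variables (d : engel R -> engel R -> R) (hd : homogeneous_distance d).
Variable p : engel R.

(** The normalizing factor of the density, for a ball of radius r, whose diameter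
    is 2 r. *)
Lemma federer_weight (r : R) : 0 < r -> 2 ^+ 3 / fine (2 * r)%:E ^+ 3 = (r ^+ 3)^-1.
Proof. by move=> r0 /=; field; rewrite gt_eqF. Qed.

Lemma federer_density_le (mu : set (engel R) -> \bar R) (c r0 : R) : 0 < r0 ->
  (forall r x, 0 < r -> r < r0 -> d x p <= r -> (mu (cball d x r) <= (r ^+ 3 * c)%:E)%E) ->
  (federer_density d 3 mu p <= c%:E)%E.
Proof.
move=> r00 h; apply: ge_ereal_inf; eexists; first by exists r0; [exact: r00|reflexivity].
apply: ge_ereal_sup => _ [B [Bp [[x [r [rp BE]]] dB]] <-].
rewrite BE /cball /= in Bp; rewrite BE diam_cball// lte_fin in dB.
rewrite BE diam_cball// federer_weight// lee_pdivrMl ?exprn_gt0// -EFinM.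
by apply: h => //; lra.
Qed.

Lemma federer_density_ge (mu : set (engel R) -> \bar R) (c : R) :
  (forall eps, 0 < eps -> exists r x, [/\ 0 < r, 2 * r < eps, d x p <= r &
    ((r ^+ 3 * c)%:E <= mu (cball d x r))%E]) ->
  (c%:E <= federer_density d 3 mu p)%E.
Proof.
move=> h; apply: le_ereal_inf_tmp => _ [eps /= eps0 <-].
have [r [x [r0 re dx hmu]]] := h _ eps0.
apply: (@le_trans _ _ ((2 ^+ 3 / fine (diam d (cball d x r)) ^+ 3)%:E * mu (cball d x r))%E).
  by rewrite diam_cball// federer_weight// lee_pdivlMl ?exprn_gt0.
apply: ereal_sup_ubound; exists (cball d x r) => //; split => //; split.
  by exists x, r.
by rewrite diam_cball// lte_fin.
Qed.

End FedererDensity.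

Section HomogeneousTangent.
Variable R : realType.
Variables (Y : 'M[R]_4) (hY : graded_basis Y) (Sigma : set (engel R)) (p : engel R).

(** The chosen tangent 2-vector is only known up to a nonzero factor, which does
    not change the annihilator. *)
Lemma homogeneous_tangentE (U : set (R * R)) (G : R * R -> engel R) z (a : R) :
  surface_chart Sigma U G -> U z -> G z = p -> point_degree Y Sigma p = 3%N -> a != 0 ->
  mask 3 (left_trivialize (G z) (wedge ('d G z (1, 0)) ('d G z (0, 1)))) = a *: wedge (e2 R) (e3 R) ->
  exists2 c, c != 0 & homogeneous_tangent Y Sigma p = annihilator (c *: wedge (e2 R) (e3 R)).
Proof.
move=> sG Uz Gz deg3 a0 E; have [l l0 tE] := tau_chart sG Uz.
rewrite Gz in E tE.
exists (l * a); first exact: mulf_neq0.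
rewrite /homogeneous_tangent deg3 /xi_ tE left_trivializeZ part2Z//; last exact/skew_push2/skew_wedge.
by rewrite part2E//; [rewrite E scalerA|exact/skew_push2/skew_wedge].
Qed.

End HomogeneousTangent.

Theorem proposition6p3 (R : realType)
  (d : engel R -> engel R -> R) (hd : homogeneous_distance d)
  (g : engel R -> 'M[R]_4) (hg : graded_metric g)
  (Y : 'M[R]_4) (hY : graded_basis Y)
  (Sigma : set (engel R)) (hSigma : C1_surface Sigma)
  (hdeg : surface_degree Y Sigma 3)
  (gt : engel R -> 'M[R]_4) (hgt : riemannian_metric gt)
  (sigma : {measure set (borelE R) -> \bar R})
  (hsigma : riemannian_surface_measure gt Sigma sigma)
  (p : engel R) (hp : Sigma p) (hpmax : point_degree Y Sigma p = 3%N) :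
  federer_density d 3 (intrinsic_measure Y g gt sigma Sigma 3) p =
  spherical_factor d g (homogeneous_tangent Y Sigma p).
Proof.
have [_ deg3] := hdeg.
have [delta [K [G [j [delta0 K0 sG G0 [HG jG cj j0]]]]]] := adapted_chart hY deg3 hp hSigma hpmax.
have D0 : [set y : R * R | `|y| < delta] 0 by rewrite /= normr0.
have j00 : j 0 != 0 by rewrite j0 oner_neq0.
have [c c0 ->] := homogeneous_tangentE hY sG D0 G0 hpmax j00 (jG 0 D0).
rewrite (spherical_factorE hd hg (dim_annihilator c0)); last by move=> x; exact: mem_annihilator.
have skG (y : R * R) : `|y| < delta -> sk 1 (emul (- p) (G y)) = y.1 /\ sk 2 (emul (- p) (G y)) = y.2.
  by move=> /HG[a [w [-> _ _]]]; rewrite /sk /of_sk /= !co_mk; split => //; field.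
have LM := local_measure hd hg hY hgt hsigma delta0 sG G0 skG jG cj j0.
have k0 : 0 < alpha g * beta g by rewrite mulr_gt0 ?alpha_gt0 ?beta_gt0.
have tE : trace_sup d = (fine (trace_sup d))%:E by rewrite fineK// trace_sup_fin.
apply/le_anti/andP; split.
  (* the exponent 5 is 2 for the densities plus 3 for the radius *)
  rewrite tE -EFinM; apply: (@le_lim_pow R _ _ 5) => eta eta0 eta1.
  have [rho [r1 [rho0 rd r10 hmu]]] := LM _ eta0 eta1.
  have [r2 r20 hup] := blow_up_upper hd K0 HG eta0.
  apply: (@federer_density_le R d hd p _ _ (Num.min r1 r2)); first by rewrite lt_min r10.
  move=> r x r0; rewrite lt_min => /andP[rr1 rr2] dx.
  have [mD _ hD] := hmu r x r0 rr1 dx; apply: (le_trans hD).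
  have re : 0 < r * (1 + eta) by rewrite mulr_gt0//; lra.
  have -> : r ^+ 3 * ((1 + eta) ^+ 5 * (alpha g * beta g * fine (trace_sup d))) =
    ((1 + eta) ^+ 2 * (alpha g * beta g)) * ((r * (1 + eta)) ^+ 3 * fine (trace_sup d)) by ring.
  rewrite [X in (_ <= X)%E]EFinM; apply: lee_wpmul2l.
    by rewrite lee_fin mulr_ge0 ?sqr_ge0// ltW.
  rewrite EFinM -tE; apply: le_trans (@leb2_trace_le R d hd (emul (- p) x) _ re _); last first.
    have -> : d (emul (- p) x) 0 = d x p by rewrite -(emulNx p) hdist_emul.
    by apply: (le_trans dx); rewrite ler_peMr ?ltW//; lra.
  apply: le_measure; rewrite ?inE; [exact: mD|exact: measurable_trace|].
  by move=> y [yr dy]; apply: hup => //; exact: lt_le_trans yr rd.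
rewrite -lee_pdivlMl//; apply: ge_ereal_sup => _ [u /= du <-]; rewrite lee_pdivlMl//.
have [t ltE] := leb2_trace_fin hd du.
rewrite ltE -EFinM; apply: (@ge_lim_pow R _ _ 5) => eta eta0 eta1.
have [rho [r1 [rho0 rd r10 hmu]]] := LM _ eta0 eta1.
have [r2 r20 hlow] := blow_up_lower hd K0 HG eta0 eta1 rho0 rd.
apply: (@federer_density_ge R d hd) => eps eps0.
have [r [r0 rr1 rr2 re]] : exists r, [/\ 0 < r, r < r1, r < r2 & 2 * r < eps].
  pose m := Num.min r1 (Num.min r2 (eps / 2)).
  have m0 : 0 < m by rewrite !lt_min r10 r20 divr_gt0.
  have [a1 a2 a3] : [/\ m <= r1, m <= r2 & m <= eps / 2] by split; rewrite !ge_min lexx ?orbT.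
  by exists (m / 2); split; lra.
have e0 : 0 < r * (1 - eta) by rewrite mulr_gt0//; lra.
(* the center is taken for the reduced radius, as in blow_up_lower *)
pose v := dilation (r * (1 - eta)) u.
have dv : d v 0 <= r * (1 - eta).
  by rewrite -[X in d v X](dilation0 (r * (1 - eta))) hdist_dilation// ler_piMr// ltW.
have dp : d (emul p v) p <= r.
  rewrite -[X in d _ X](emulx0 p) hdist_emul//; apply: (le_trans dv).
  by rewrite ler_piMr ?ltW//; lra.
exists r, (emul p v); split => //.
have [mD hD _] := hmu r _ r0 rr1 dp; apply: le_trans hD.
have -> : r ^+ 3 * ((1 - eta) ^+ 5 * (alpha g * beta g * t)) =
  ((1 - eta) ^+ 2 * (alpha g * beta g)) * ((r * (1 - eta)) ^+ 3 * t) by ring.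
rewrite [X in (X <= _)%E]EFinM; apply: lee_wpmul2l.
  by rewrite lee_fin mulr_ge0 ?sqr_ge0// ltW.
rewrite EFinM -ltE -leb2_trace_dilation//.
apply: le_measure; rewrite ?inE; [exact: measurable_trace|exact: mD|].
by move=> y; rewrite mulr1 => ty; exact: hlow r v y r0 rr2 dv ty.
Qed.
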